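(* For every pair of integers $p,q\geq 2$, the ideal triangulation $\mathcal{T}_{K(p,q)}$ of the complement $S^3-K(p,q)$ of the double twist knot $K(p,q)$ is geometric.
   Context: Knots. For integers $p,q\ge 2$, the double twist knot $K(p,q)\subset S^3$ is the 2-bridge knot with exactly two twist regions, containing $2p$ and $2q$ negative crossings. Equivalently, $S^3-K(p,q)$ is obtained from the complement of the Borromean rings by $-1/p$ Dehn filling on one component and $-1/q$ Dehn filling on another (slopes with respect to the standard meridian and homological longitude; slope $1/n$ means $\mu+n\lambda$). For example $K(2,2)=7_4$. The triangulation $\mathcal{T}_{K(p,q)}$. Each ideal tetrahedron has ideal vertices labelled $0,1,2,3$. A face pairing $\Delta(ijk)\to\Delta'(i'j'k')$ glues face $ijk$ of $\Delta$ to face $i'j'k'$ of $\Delta'$ by the simplicial map $i\mapsto i',j\mapsto j',k\mapsto k'$. Start with six tetrahedra $\Delta_0,\dots,\Delta_5$ and face pairings $\Delta_0(012)\to\Delta_2(021)$, $\Delta_0(013)\to\Delta_1(201)$, $\Delta_0(023)\to\Delta_3(130)$, $\Delta_0(123)\to\Delta_5(213)$, $\Delta_1(013)\to\Delta_2(310)$, $\Delta_1(123)\to\Delta_4(213)$, $\Delta_2(123)\to\Delta_3(321)$, $\Delta_3(012)\to\Delta_4(210)$, $\Delta_3(023)\to\Delta_5(021)$, $\Delta_4(013)\to\Delta_5(310)$. (This is a 10-tetrahedron triangulation of the Borromean rings complement with the two tetrahedra meeting each of two crossing circle cusps removed.) The unglued faces form two 1-punctured tori: torus 1 consists of $\Delta_4(023),\Delta_5(023)$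 and torus 2 of $\Delta_1(023),\Delta_2(023)$. The edge classes on torus $i$ are denoted $\mathcal{O}_0^i$ (edges $23$ of its two faces), $\mathcal{O}_1^i$ (edges $02$) and $\mathcal{P}^i$ (edges $03$); they have slopes $1/0$, $-1/1$, $0/1$ respectively. Next glue a layered solid torus to each torus. On torus 1, with parameter $p$: for $j=0,1,\dots,p-3$ in turn (no step if $p=2$), layer a tetrahedron $\Delta_j^1$ over the edge $\mathcal{O}_j^1$, that is, glue two of its faces to the two current boundary triangles so that the edge shared by those two faces is glued to $\mathcal{O}_j^1$; the opposite edge of $\Delta_j^1$ is a new boundary edge $\mathcal{O}_{j+2}^1$ (slope $-1/(j+2)$), and the new boundary torus has edges $\mathcal{O}_{j+1}^1,\mathcal{O}_{j+2}^1,\mathcal{P}^1$. Finally fold along $\mathcal{O}_{p-2}^1$: identify the two remaining boundary triangles by the map fixing $\mathcal{O}_{p-2}^1$ pointwise, which identifies $\mathcal{O}_{p-1}^1$ with $\mathcal{P}^1$ and makes the slope $-1/p$ homotopically trivial. Do the same on torus 2 with parameter $q$, using tetrahedra $\Delta_0^2,\dots,\Delta_{q-3}^2$ and edges $\mathcal{O}_j^2,\mathcal{P}^2$. Explicitly, if $p\ge3$: $\Delta_0^1(012)\to\Delta_4(320)$, $\Delta_0^1(013)\to\Delta_5(230)$; $\Delta_{j+1}^1(012)\to\Delta_j^1(032)$, $\Delta_{j+1}^1(013)\to\Delta_j^1(213)$ for $0\le j\le p-4$; and $\Delta_{p-3}^1(023)\to\Delta_{p-3}^1(231)$. If $p=2$: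 $\Delta_4(023)\to\Delta_5(032)$. If $q\ge 3$: $\Delta_0^2(012)\to\Delta_1(320)$, $\Delta_0^2(013)\to\Delta_2(230)$; $\Delta_{j+1}^2(012)\to\Delta_j^2(032)$, $\Delta_{j+1}^2(013)\to\Delta_j^2(213)$ for $0\le j\le q-4$; and $\Delta_{q-3}^2(023)\to\Delta_{q-3}^2(231)$. If $q=2$: $\Delta_1(023)\to\Delta_2(032)$. The result $\mathcal{T}_{K(p,q)}$ has $p+q+2$ tetrahedra and is an ideal triangulation of $S^3-K(p,q)$. Geometric. An ideal triangulation of a cusped hyperbolic 3-manifold is geometric if its tetrahedra inherit the structure of positively oriented convex hyperbolic ideal tetrahedra from the complete hyperbolic structure, i.e. the manifold with its complete hyperbolic structure is obtained by gluing positively oriented hyperbolic ideal tetrahedra according to the triangulation. *)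

(* Defs.v *)
From Stdlib Require Import Relation_Operators.
From HB Require Import structures.
From mathcomp Require Import all_boot all_order all_algebra.
From mathcomp Require Import all_classical all_reals all_analysis.

Set Implicit Arguments.
Unset Strict Implicit.
Unset Printing Implicit Defensive.

Import Order.TTheory GRing.Theory Num.Theory.

Local Open Scope classical_set_scope.
Local Open Scope ring_scope.

(** * Ideal triangulations *)

(* [(D, (i, j, k))] is the face ijk of the tetrahedron D.  The order of the
   labels matters: a pairing (D, (i, j, k)) ~> (D', (i', j', k')) is the
   simplicial map i |-> i', j |-> j', k |-> k'. *)
Definition face (X : Type) : Type := X * ('I_4 * 'I_4 * 'I_4).

Record triangulation := Triangulation {
  tet : finType;
  pairings : seq (face tet * face tet) }.

Local Notation "F ~> G" := (F, G) (at level 70, only parsing).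

(* The layered solid torus glued to the punctured torus with triangles A(023)
   and B(023).  It has n layers, [n = p - 2] in terms of the slope -1/p that is
   killed; [D j] is the j-th layer. *)
Definition layered_solid_torus (X : Type) (A B : X) (n : nat) :
    ('I_n -> X) -> seq (face X * face X) :=
  match n return ('I_n -> X) -> seq (face X * face X) with
  | 0 => fun _ => [:: (A, (0, 2, 3)) ~> (B, (0, 3, 2))]
  | k.+1 => fun D =>
      [:: (D ord0, (0, 1, 2)) ~> (A, (3, 2, 0));
          (D ord0, (0, 1, 3)) ~> (B, (2, 3, 0))]
      ++ flatten
        [seq [:: (D (lift ord0 j), (0, 1, 2))
                   ~> (D (widen_ord (leqnSn k) j), (0, 3, 2));
                 (D (lift ord0 j), (0, 1, 3))
                   ~> (D (widen_ord (leqnSn k) j), (2, 1, 3))]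
        | j <- enum 'I_k]
      ++ [:: (D ord_max, (0, 2, 3)) ~> (D ord_max, (2, 3, 1))]
  end.

(* T_{K(p,q)} is the ideal triangulation of the complement in the 3-sphere of the
   double twist knot K(p,q), for p, q >= 2.  Its p + q + 2 tetrahedra are six core
   tetrahedra, then the layers of the solid tori glued to torus 1 and torus 2. *)
Definition K_tet (p q : nat) : finType := ('I_6 + ('I_(p - 2) + 'I_(q - 2)))%type.

Definition core (p q : nat) (i : 'I_6) : K_tet p q := inl i.
Definition layer1 (p q : nat) (j : 'I_(p - 2)) : K_tet p q := inr (inl j).
Definition layer2 (p q : nat) (j : 'I_(q - 2)) : K_tet p q := inr (inr j).

Definition core_pairings (p q : nat) : seq (face (K_tet p q) * face (K_tet p q)) :=
  let D := @core p q in
  [:: (D 0, (0, 1, 2)) ~> (D 2, (0, 2, 1));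
      (D 0, (0, 1, 3)) ~> (D 1, (2, 0, 1));
      (D 0, (0, 2, 3)) ~> (D 3, (1, 3, 0));
      (D 0, (1, 2, 3)) ~> (D 5, (2, 1, 3));
      (D 1, (0, 1, 3)) ~> (D 2, (3, 1, 0));
      (D 1, (1, 2, 3)) ~> (D 4, (2, 1, 3));
      (D 2, (1, 2, 3)) ~> (D 3, (3, 2, 1));
      (D 3, (0, 1, 2)) ~> (D 4, (2, 1, 0));
      (D 3, (0, 2, 3)) ~> (D 5, (0, 2, 1));
      (D 4, (0, 1, 3)) ~> (D 5, (3, 1, 0))].

Definition T_K (p q : nat) : triangulation :=
  @Triangulation (K_tet p q)
    (core_pairings p q
     ++ layered_solid_torus (core p q 4) (core p q 5) (@layer1 p q)
     ++ layered_solid_torus (core p q 1) (core p q 2) (@layer2 p q)).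

(** * Hyperbolic 3-space: the hyperboloid model *)

Definition lorentz (R : realType) (x y : 'rV[R]_4) : R :=
  - (x 0 0 * y 0 0) + \sum_(i < 3) x 0 (lift ord0 i) * y 0 (lift ord0 i).

Definition hyp3 (R : realType) : set 'rV[R]_4 :=
  [set x | lorentz x x = -1 /\ 0 < x 0 0].

(* cosh (hdist x y) = - lorentz x y; the right-hand side spells out arcosh. *)
Definition hdist (R : realType) (x y : 'rV[R]_4) : R :=
  let c := - lorentz x y in ln (c + Num.sqrt (c ^+ 2 - 1)).

(* The ideal boundary consists of the rays spanned by the future light-like
   vectors. *)
Definition future_light (R : realType) (v : 'rV[R]_4) : Prop :=
  lorentz v v = 0 /\ 0 < v 0 0.

Definition same_ideal_point (R : realType) (v w : 'rV[R]_4) : Prop :=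
  exists2 c : R, 0 < c & w = c *: v.

(* The isometries of hyperbolic space, acting by [x |-> x *m g] both on the
   hyperboloid and on its ideal boundary. *)
Definition hyp_isometry (R : realType) (g : 'M[R]_4) : Prop :=
  (forall x y : 'rV[R]_4, lorentz (x *m g) (y *m g) = lorentz x y) /\
  (forall x : 'rV[R]_4, hyp3 x -> hyp3 (x *m g)).

(* [row i V] represents the i-th ideal vertex.  The sign of the determinant is
   the orientation given by the labelling; which sign is called positive is
   immaterial, as a reflection of hyperbolic space exchanges the two. *)
Definition pos_ideal_tetrahedron (R : realType) (V : 'M[R]_4) : Prop :=
  (forall i : 'I_4, future_light (row i V)) /\ 0 < \det V.

(* The convex hull in hyperbolic space of the four ideal vertices. *)
Definition hyp_tet (R : realType) (V : 'M[R]_4) : set 'rV[R]_4 :=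
  [set x | hyp3 x /\
    exists2 a : 'rV[R]_4, (forall i : 'I_4, 0 <= a 0 i) & x = a *m V].

Definition hyp_face (R : realType) (V : 'M[R]_4) (f : 'I_4 * 'I_4 * 'I_4) :
    set 'rV[R]_4 :=
  let: (i, j, k) := f in
  [set x | hyp3 x /\ exists a b c : R,
    [/\ 0 <= a, 0 <= b, 0 <= c & x = a *: row i V + b *: row j V + c *: row k V]].

(** * Gluing ideal tetrahedra *)

(* [x] and [y] correspond under the isometry from the face f of V to the face f'
   of W that sends ideal vertices to ideal vertices in the given order.  That
   isometry of ideal triangles is unique, although [g] is not. *)
Definition face_isometry (R : realType) (V : 'M[R]_4) (f : 'I_4 * 'I_4 * 'I_4)
    (W : 'M[R]_4) (f' : 'I_4 * 'I_4 * 'I_4) (x y : 'rV[R]_4) : Prop :=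
  let: (i, j, k) := f in
  let: (i', j', k') := f' in
  [/\ hyp_face V f x, hyp_face W f' y &
    exists g : 'M[R]_4,
      [/\ hyp_isometry g,
          same_ideal_point (row i V *m g) (row i' W),
          same_ideal_point (row j V *m g) (row j' W),
          same_ideal_point (row k V *m g) (row k' W) &
          y = x *m g]].

(* A point of the disjoint union of the tetrahedra is a pair (t, x) with
   [x] in [hyp_tet (V t)]. *)
Definition glued (R : realType) (T : triangulation) (V : tet T -> 'M[R]_4) :
    tet T * 'rV[R]_4 -> tet T * 'rV[R]_4 -> Prop :=
  clos_refl_sym_trans _ (fun a b => exists f f' : 'I_4 * 'I_4 * 'I_4,
    ((a.1, f), (b.1, f')) \in pairings T /\
    face_isometry (V a.1) f (V b.1) f' a.2 b.2).

(* M is a hyperbolic 3-manifold: every point has a ball isometric to a ball of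
   hyperbolic space of the same radius. *)
Definition hyperbolic3 (R : realType) (M : metricType R) : Prop :=
  forall m : M, exists r : R, exists f : M -> 'rV[R]_4,
    [/\ 0 < r,
        forall y, ball m r y -> hyp3 (f y),
        forall y z, ball m r y -> ball m r z -> hdist (f y) (f z) = mdist y z &
        forall h, hyp3 h -> hdist (f m) h < r -> exists2 y, ball m r y & f y = h].

(* The library's [cauchy_cvg], which it only states for pointed types. *)
Definition complete_metric (R : realType) (M : metricType R) : Prop :=
  forall F : set_system M, ProperFilter F -> cauchy F -> exists m : M, F --> m.

(* The maps [phi t] present M as the space obtained from the hyperbolic ideal
   tetrahedra [V t] by the face pairings of T: as a set (the first two clauses),
   as a topological space (the third: M has the quotient topology, continuity of
   [phi t] being implied by the fourth), and geometrically (the fourth: the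
   metric of M restricts to the hyperbolic metric of each tetrahedron). *)
Definition obtained_by_gluing (R : realType) (T : triangulation)
    (V : tet T -> 'M[R]_4) (M : metricType R) (phi : tet T -> 'rV[R]_4 -> M) : Prop :=
  [/\ forall m : M, exists t : tet T, exists2 x, hyp_tet (V t) x & phi t x = m,
      forall (t t' : tet T) x x', hyp_tet (V t) x -> hyp_tet (V t') x' ->
        (phi t x = phi t' x' <-> glued V (t, x) (t', x')),
      forall U : set M,
        (forall (t : tet T) x, hyp_tet (V t) x -> U (phi t x) ->
          exists2 r : R, 0 < r &
            forall y, hyp_tet (V t) y -> hdist x y < r -> U (phi t y)) ->
        open U &
      forall (t : tet T) x, hyp_tet (V t) x ->
        exists2 r : R, 0 < r & forall y z, hyp_tet (V t) y -> hyp_tet (V t) z ->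
          hdist x y < r -> hdist x z < r -> mdist (phi t y) (phi t z) = hdist y z].

(* By Mostow-Prasad rigidity the complete hyperbolic structure M on the
   triangulated manifold is unique, so that it may be quantified existentially. *)
Definition geometric_triangulation (R : realType) (T : triangulation) : Prop :=
  exists (V : tet T -> 'M[R]_4) (M : metricType R) (phi : tet T -> 'rV[R]_4 -> M),
    [/\ forall t : tet T, pos_ideal_tetrahedron (V t),
        hyperbolic3 M, complete_metric M & obtained_by_gluing V phi].

(* Main.v *)
(* Following Casson and Rivin, maximize the volume of the angle structures of the
   triangulation, the sum of the log-sine integrals of the angles.  It suffices to do so for
   angle structures that are invariant under the symmetries of T_K(p,q).  At a maximum, each
   tetrahedron is nondegenerate or flat, with angles 0, 0, pi, as the derivative of the volume
   is infinite where a single angle vanishes; the edge equations then force all tetrahedra to be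
   nondegenerate or all to be flat, and a flat structure has less volume than any positive one.
   So the maximum is interior, and the Lagrange multipliers of the edge equations are the
   logarithms of edge lengths: the sines of the angles of each tetrahedron are proportional to
   the products of the lengths of opposite edges.

   Given such lengths, choose light-like vectors v_i with <v_i, v_j> = -2 l_ij^2 as vertices of
   each tetrahedron.  The face pairings then preserve the vectors, and since the angles around
   each edge add up to 2 pi, the open star of every edge develops onto hyperbolic space.  Hence
   the quotient, with its path metric, is hyperbolic.  It is complete because the logarithm of
   the barycentric coordinate sum of a point with respect to the v_i is Lipschitz on the
   quotient and has compact sublevel sets. *)

Require Import Defs.
From Stdlib Require Import Relation_Operators.
From HB Require Import structures.
From mathcomp Require Import all_boot all_order all_algebra.
From mathcomp Require Import all_classical all_reals all_analysis.
From mathcomp Require Import ring lra zify.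

Set Implicit Arguments.
Unset Strict Implicit.
Unset Printing Implicit Defensive.

Import Order.TTheory GRing.Theory Num.Theory numFieldNormedType.Exports.

Local Open Scope classical_set_scope.
Local Open Scope ring_scope.

(** A point of hyperbolic space is never a multiple of a light-like vertex, so each point of an
    ideal tetrahedron has two positive barycentric coordinates and lies in the open star of an edge.
    One kind of chart thus serves interior, face and edge points. A face pairing determines the
    vertices only up to scaling; the lengths fix the scale, so that pairings become equalities of
    barycentric coordinates. This common scale is also the source of completeness: no cusp equations
    have to be checked.

    A reduced tetrahedron may stand for two, hence the weights in the volume. The multipliers of the
    edge equations give the lengths, those of the angle sums the factors of proportionality.

    The shape of this triangulation enters through a positive angle structure and through the
    alternative that all tetrahedra are flat or none is. In a layered solid torus both rest on one
    fact: an angle of each layer is half a second difference of a sequence that ends with 0. So this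
    sequence is convex, a strictly convex choice gives positive angles, and a flat tetrahedron
    forces its neighbours. *)

Section Lorentz.
Variable R : realType.
Implicit Types x y z u v w o : 'rV[R]_4.

(** * The Lorentz form and the hyperboloid *)

Lemma lorentzE x y : lorentz x y =
  - (x 0 0 * y 0 0) + (x 0 1 * y 0 1 + x 0 2 * y 0 2 + x 0 3 * y 0 3).
Proof.
rewrite /lorentz !big_ord_recl big_ord0 addr0 !addrA.
by do !congr (_ + _); congr (x 0 _ * y 0 _); apply/val_inj.
Qed.

Lemma lorentzC x y : lorentz x y = lorentz y x.
Proof. by rewrite !lorentzE; ring. Qed.

Lemma lorentzDl x y z : lorentz (x + y) z = lorentz x z + lorentz y z.
Proof. by rewrite !lorentzE !mxE; ring. Qed.

Lemma lorentzZl (a : R) x z : lorentz (a *: x) z = a * lorentz x z.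
Proof. by rewrite !lorentzE !mxE; ring. Qed.

Lemma lorentzNl x z : lorentz (- x) z = - lorentz x z.
Proof. by rewrite !lorentzE !mxE; ring. Qed.

Lemma lorentzBl x y z : lorentz (x - y) z = lorentz x z - lorentz y z.
Proof. by rewrite lorentzDl lorentzNl. Qed.

Lemma lorentzDr x y z : lorentz z (x + y) = lorentz z x + lorentz z y.
Proof. by rewrite !(lorentzC z) lorentzDl. Qed.

Lemma lorentzZr (a : R) x z : lorentz z (a *: x) = a * lorentz z x.
Proof. by rewrite !(lorentzC z) lorentzZl. Qed.

Lemma lorentzBr x y z : lorentz z (x - y) = lorentz z x - lorentz z y.
Proof. by rewrite !(lorentzC z) lorentzBl. Qed.

Lemma lorentzNr x z : lorentz z (- x) = - lorentz z x.
Proof. by rewrite !(lorentzC z) lorentzNl. Qed.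

Definition lorentz_lin := (lorentzDl, lorentzDr, lorentzZl, lorentzZr,
  lorentzNl, lorentzNr).

Lemma le_eq_trans (a b c : R) : a <= b -> b = c -> a <= c.
Proof. by move=> ? <-. Qed.

Lemma eq_le_trans (a b c : R) : a = b -> b <= c -> a <= c.
Proof. by move=> ->. Qed.

(** Lagrange's identity: after eliminating [u 0 0] by orthogonality, o_0^2 <u,u> is a sum of
    squares. *)
Lemma hyp3_perp_ge0 o u : hyp3 o -> lorentz u o = 0 -> 0 <= lorentz u u.
Proof.
case; rewrite !lorentzE.
move: (o 0 0) (o 0 1) (o 0 2) (o 0 3) (u 0 0) (u 0 1) (u 0 2) (u 0 3).
move=> o0 o1 o2 o3 u0 u1 u2 u3 ho o0p hu.
have o02 : 0 < o0 ^+ 2 by rewrite exprn_gt0.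
rewrite -(pmulr_rge0 _ o02).
have -> : o0 ^+ 2 * (- (u0 * u0) + (u1 * u1 + u2 * u2 + u3 * u3)) =
  (u1 ^+ 2 + u2 ^+ 2 + u3 ^+ 2) + (u1 * o2 - u2 * o1) ^+ 2
    + (u1 * o3 - u3 * o1) ^+ 2 + (u2 * o3 - u3 * o2) ^+ 2.
  have e1 : u0 * o0 = u1 * o1 + u2 * o2 + u3 * o3 by lra.
  have e2 : o0 ^+ 2 = 1 + (o1 * o1 + o2 * o2 + o3 * o3) by lra.
  have -> : o0 ^+ 2 * (- (u0 * u0) + (u1 * u1 + u2 * u2 + u3 * u3)) =
    o0 ^+ 2 * (u1 * u1 + u2 * u2 + u3 * u3) - (u0 * o0) ^+ 2 by ring.
  by rewrite e1 e2; ring.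
by rewrite !addr_ge0 // sqr_ge0.
Qed.

(** On the complement of [o] the form is only known to be semidefinite here, so a null [w] gets its
    own argument. *)
Lemma lorentz_CS o u w : hyp3 o -> lorentz u o = 0 -> lorentz w o = 0 ->
  lorentz u w ^+ 2 <= lorentz u u * lorentz w w.
Proof.
move=> ho hu hw.
have H (a b : R) : 0 <= a ^+ 2 * lorentz u u + a * b * 2 * lorentz u w
    + b ^+ 2 * lorentz w w.
  have := @hyp3_perp_ge0 o (a *: u + b *: w) ho.
  rewrite !lorentz_lin hu hw (lorentzC w u) => H.
  by apply: le_eq_trans (H ltac:(ring)) _; ring.
have Hu := hyp3_perp_ge0 ho hu; have Hw := hyp3_perp_ge0 ho hw.
have [w0|w0] := eqVneq (lorentz w w) 0.
  rewrite w0 mulr0; have [->|uw0] := eqVneq (lorentz u w) 0; first by rewrite expr0n.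
  (* With this coefficient the quadratic form takes the value -1. *)
  have := H 1 (- (lorentz u u + 1) / (2 * lorentz u w)); rewrite w0.
  set q := (X in 0 <= X); have -> : q = -1 by rewrite /q; field.
  by rewrite ler0N1.
have wp : 0 < lorentz w w by rewrite lt_def w0 Hw.
have := H (lorentz w w) (- lorentz u w).
set q := (X in 0 <= X); have -> : q = lorentz w w * (lorentz u u * lorentz w w
    - lorentz u w ^+ 2) by rewrite /q; ring.
by rewrite pmulr_rge0 // subr_ge0.
Qed.

(* [ch x y] is cosh (hdist x y). *)
Definition ch x y := - lorentz x y.

Lemma chxx x : hyp3 x -> ch x x = 1.
Proof. by case=> hx _; rewrite /ch hx opprK. Qed.

(** Reversed Cauchy-Schwarz inequality. A light-like [y] is allowed, so that it applies to ideal
    vertices. *)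
Lemma timelike_gt0 x y : hyp3 x -> lorentz y y <= 0 -> 0 < y 0 0 -> 0 < ch x y.
Proof.
rewrite /hyp3 /= /ch !lorentzE.
move: (x 0 0) (x 0 1) (x 0 2) (x 0 3) (y 0 0) (y 0 1) (y 0 2) (y 0 3).
move=> x0 x1 x2 x3 y0 y1 y2 y3 [hx x0p] hy y0p.
have h : (x1 * y1 + x2 * y2 + x3 * y3) ^+ 2 < (x0 * y0) ^+ 2.
  have -> : (x0 * y0) ^+ 2 = (x0 * x0) * (y0 * y0) by ring.
  have -> : x0 * x0 = 1 + (x1 * x1 + x2 * x2 + x3 * x3) by lra.
  apply: (@lt_le_trans _ _ ((1 + (x1 * x1 + x2 * x2 + x3 * x3)) *
     (y1 * y1 + y2 * y2 + y3 * y3) +  (y0 * y0 - (y1 * y1 + y2 * y2 + y3 * y3)) 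
    + (x1 * x1 + x2 * x2 + x3 * x3) * (y0 * y0 - (y1 * y1 + y2 * y2 + y3 * y3)))); last first.
    by rewrite le_eqVlt; apply/orP; left; apply/eqP; ring.
  rewrite -subr_gt0.
  set d := (X in 0 < X).
  have -> : d = y0 * y0 + (x1 * y2 - x2 * y1) ^+ 2
    + (x1 * y3 - x3 * y1) ^+ 2 + (x2 * y3 - x3 * y2) ^+ 2
    + (x1 * x1 + x2 * x2 + x3 * x3) * (y0 * y0 - (y1 * y1 + y2 * y2 + y3 * y3)).
    by rewrite /d; ring.
  have p : 0 < y0 * y0 by rewrite mulr_gt0.
  have q : 0 <= (x1 * x1 + x2 * x2 + x3 * x3) * (y0 * y0 - (y1 * y1 + y2 * y2 + y3 * y3)).
    by apply: mulr_ge0; [rewrite -!expr2 !addr_ge0 ?sqr_ge0 | lra].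
  have := sqr_ge0 (x1 * y2 - x2 * y1); have := sqr_ge0 (x1 * y3 - x3 * y1).
  have := sqr_ge0 (x2 * y3 - x3 * y2).
  by lra.
have xy : 0 < x0 * y0 by rewrite mulr_gt0.
have : x1 * y1 + x2 * y2 + x3 * y3 < x0 * y0.
  apply: le_lt_trans (ler_norm _) _.
  by rewrite -(@ltr_pXn2r _ 2%N) ?nnegrE ?normr_ge0 ?(ltW xy) // -normrX ger0_norm ?sqr_ge0.
by lra.
Qed.

Lemma ch_ge1 x y : hyp3 x -> hyp3 y -> 1 <= ch x y.
Proof.
move=> hx hy.
have p : 0 < ch x y by apply: timelike_gt0 => //; case: hy => // -> _; rewrite oppr_le0 ler01.
have := @hyp3_perp_ge0 y (x - ch x y *: y) hy.
have [[ex _] [ey _]] := (hx, hy).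
rewrite !lorentz_lin ex ey (lorentzC y x) /ch in p *.
move=> H; have := H ltac:(ring).
move: (lorentz x y) p => c p h.
have : 1 <= (- c) ^+ 2 by rewrite sqrrN; nra.
by rewrite -[X in X <= _](expr1n _ 2) ler_pXn2r // ?nnegrE ?ler01 // ltW.
Qed.

Lemma ch_sqrB1_ge0 x y : hyp3 x -> hyp3 y -> 0 <= ch x y ^+ 2 - 1.
Proof. by move=> hx hy; rewrite subr_ge0 -[X in X <= _](expr1n _ 2) ler_pXn2r // ?nnegrE ?ler01 ?(le_trans ler01) // ch_ge1. Qed.

(** [x - y] is null and orthogonal to [y], so Cauchy-Schwarz makes it orthogonal to the complement
    of [y] and hence to everything. *)
Lemma ch_eq1 x y : hyp3 x -> hyp3 y -> ch x y = 1 -> x = y.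
Proof.
move=> hx hy xy; have [[ex _] [ey _]] := (hx, hy).
have d0 : lorentz (x - y) y = 0 by rewrite lorentzBl ey; rewrite /ch in xy; lra.
have dd : lorentz (x - y) (x - y) = 0.
  by rewrite !lorentz_lin ex ey (lorentzC y x); rewrite /ch in xy; lra.
have hz w : lorentz w y = 0 -> lorentz (x - y) w = 0.
  move=> wy; have := lorentz_CS hy d0 wy; rewrite dd mul0r => h.
  by apply/eqP; rewrite -sqrf_eq0 eq_le h sqr_ge0.
have hall w : lorentz (x - y) w = 0.
  have -> : w = (w + lorentz w y *: y) - lorentz w y *: y by rewrite addrK.
  by rewrite lorentzBr hz ?lorentzZr ?d0 ?mulr0 ?subr0 // !lorentz_lin ey mulrN1 subrr.
apply/eqP; rewrite -subr_eq0; apply/eqP/rowP => i; rewrite [RHS]mxE.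
have := hall (\row_j (j == i)%:R); rewrite lorentzE !mxE.
have : i \in [:: 0; 1; 2; 3].
  by case: i => [[|[|[|[|//]]]] hi]; rewrite !inE -!val_eqE.
by rewrite !inE => /or4P[] /eqP -> /=;
  rewrite ?eqxx /= ?(mulr1, mulr0, addr0, oppr0, add0r) => // /eqP;
  rewrite oppr_eq0 => /eqP.
Qed.

(** The right-hand side is cosh of the sum of the two distances; the bound is Cauchy-Schwarz for the
    components of [x] and [z] orthogonal to [y]. *)
Lemma ch_triangle x y z : hyp3 x -> hyp3 y -> hyp3 z ->
  ch x z <= ch x y * ch y z +
    Num.sqrt (ch x y ^+ 2 - 1) * Num.sqrt (ch y z ^+ 2 - 1).
Proof.
move=> hx hy hz; have [[ex _] [ey _] [ez _]] := And3 hx hy hz.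
have := @lorentz_CS y (x - ch x y *: y) (z - ch y z *: y) hy.
have P1 := ch_sqrB1_ge0 hx hy; have P2 := ch_sqrB1_ge0 hy hz.
rewrite !lorentz_lin ex ey ez (lorentzC y x) (lorentzC z y) /ch in P1 P2 *.
move=> H; have := H ltac:(ring) ltac:(ring) => {H}.
move: (lorentz x y) (lorentz y z) (lorentz x z) P1 P2 => a b c P1 P2 H.
rewrite -sqrtrM // -lerBlDl; apply: le_trans (ler_norm _) _.
rewrite -sqrtr_sqr; apply: ler_wsqrtr.
by apply: le_eq_trans (eq_le_trans _ H) _; ring.
Qed.

(** * Hyperbolic cosine, sine and distance *)

Definition cosh (t : R) := (expR t + expR (- t)) / 2.
Definition sinh (t : R) := (expR t - expR (- t)) / 2.

Lemma cosh2_sinh2 t : cosh t ^+ 2 = 1 + sinh t ^+ 2.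
Proof.
rewrite /cosh /sinh expRN; have := expR_gt0 t; move: (expR t) => a /lt0r_neq0 a0.
by field.
Qed.

Lemma coshD s t : cosh (s + t) = cosh s * cosh t + sinh s * sinh t.
Proof.
rewrite /cosh /sinh opprD !expRD; move: (expR s) (expR t) (expR (- s)) (expR (- t)).
by move=> a b c d; field.
Qed.

Lemma coshN t : cosh (- t) = cosh t.
Proof. by rewrite /cosh opprK addrC. Qed.

Lemma sinhN t : sinh (- t) = - sinh t.
Proof. by rewrite /sinh opprK -mulNr opprB. Qed.

Lemma cosh0 : cosh 0 = 1.
Proof. by rewrite /cosh oppr0 expR0; lra. Qed.

Lemma sinh0 : sinh 0 = 0.
Proof. by rewrite /sinh oppr0 expR0; lra. Qed.

Lemma sinh_ge0 t : 0 <= t -> 0 <= sinh t.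
Proof. by move=> t0; rewrite /sinh divr_ge0 ?subr_ge0 ?ler_expR //; lra. Qed.

Lemma sinh_gt0 t : 0 < t -> 0 < sinh t.
Proof. by move=> t0; rewrite /sinh divr_gt0 ?subr_gt0 ?ltr_expR //; lra. Qed.

Lemma cosh_gt0 t : 0 < cosh t.
Proof. by rewrite /cosh divr_gt0 ?addr_gt0 ?expR_gt0. Qed.

Lemma cosh_ge1 t : 1 <= cosh t.
Proof.
rewrite -(@ler_pXn2r _ 2%N) ?nnegrE ?ler01 ?(ltW (cosh_gt0 _)) //.
by rewrite cosh2_sinh2 expr1n lerDl sqr_ge0.
Qed.

Lemma ltr_cosh s t : 0 <= s -> s < t -> cosh s < cosh t.
Proof.
move=> s0 st; have -> : t = s + (t - s) by ring.
have d0 : 0 < t - s by rewrite subr_gt0.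
rewrite coshD; apply: (@lt_le_trans _ _ (cosh s * cosh (t - s))); last first.
  by rewrite lerDl mulr_ge0 ?sinh_ge0 // ltW.
rewrite -[X in X < _]mulr1 ltr_pM2l ?cosh_gt0 //.
rewrite -(@ltr_pXn2r _ 2%N) ?nnegrE ?ler01 ?(ltW (cosh_gt0 _)) //.
by rewrite cosh2_sinh2 expr1n ltrDl exprn_gt0 // sinh_gt0.
Qed.

Lemma ler_cosh s t : 0 <= s -> 0 <= t -> (cosh s <= cosh t) = (s <= t).
Proof.
move=> s0 t0; apply/idP/idP; last first.
  by rewrite le_eqVlt => /orP[/eqP-> //|/(ltr_cosh s0)/ltW].
by apply: contraTT; rewrite -!ltNge => /(ltr_cosh t0).
Qed.

Lemma ltr_coshE s t : 0 <= s -> 0 <= t -> (cosh s < cosh t) = (s < t).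
Proof. by move=> s0 t0; rewrite !ltNge ler_cosh. Qed.

Lemma cosh_inj s t : 0 <= s -> 0 <= t -> cosh s = cosh t -> s = t.
Proof. by move=> s0 t0 e; apply/eqP; rewrite eq_le -(ler_cosh s0 t0) -(ler_cosh t0 s0) e lexx. Qed.

Lemma acosh_ge0 (c : R) : 1 <= c -> 0 <= ln (c + Num.sqrt (c ^+ 2 - 1)).
Proof. by move=> c1; rewrite ln_ge0 // (le_trans c1) // lerDl sqrtr_ge0. Qed.

Lemma acoshK (c : R) : 1 <= c -> cosh (ln (c + Num.sqrt (c ^+ 2 - 1))) = c.
Proof.
move=> c1; have s0 := sqrtr_ge0 (c ^+ 2 - 1).
have p : 0 < c + Num.sqrt (c ^+ 2 - 1) by rewrite ltr_pwDl //; lra.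
have q : 0 <= c ^+ 2 - 1.
  by rewrite subr_ge0 -[X in X <= _](expr1n _ 2) ler_pXn2r // nnegrE; lra.
rewrite /cosh expRN lnK ?posrE //.
have := sqr_sqrtr q; move: (Num.sqrt _) p {s0} => s p hs.
suff -> : (c + s)^-1 = c - s by lra.
apply: (mulfI (lt0r_neq0 p)); rewrite divff ?gt_eqF //.
have -> : (c + s) * (c - s) = c ^+ 2 - s ^+ 2 by ring.
by rewrite hs; ring.
Qed.

Lemma hdist_ge0 x y : hyp3 x -> hyp3 y -> 0 <= hdist x y.
Proof. by move=> hx hy; apply: acosh_ge0; exact: ch_ge1. Qed.

Lemma cosh_hdist x y : hyp3 x -> hyp3 y -> cosh (hdist x y) = ch x y.
Proof. by move=> hx hy; apply: acoshK; exact: ch_ge1. Qed.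

Lemma sinh_hdist x y : hyp3 x -> hyp3 y ->
  sinh (hdist x y) = Num.sqrt (ch x y ^+ 2 - 1).
Proof.
move=> hx hy; rewrite -cosh_hdist // cosh2_sinh2 addrC addKr sqrtr_sqr.
by rewrite ger0_norm // sinh_ge0 // hdist_ge0.
Qed.

Lemma hdist_eq x y x' y' : lorentz x y = lorentz x' y' -> hdist x y = hdist x' y'.
Proof. by rewrite /hdist => ->. Qed.

Lemma hdistC x y : hdist x y = hdist y x.
Proof. by apply: hdist_eq; exact: lorentzC. Qed.

Lemma hdistxx x : hyp3 x -> hdist x x = 0.
Proof.
by move=> hx; apply: cosh_inj; rewrite ?hdist_ge0 // cosh_hdist // chxx // cosh0.
Qed.

Lemma hdist_eq0 x y : hyp3 x -> hyp3 y -> hdist x y = 0 -> x = y.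
Proof.
by move=> hx hy e; apply: ch_eq1 => //; rewrite -cosh_hdist // e cosh0.
Qed.

Lemma hdist_triangle x y z : hyp3 x -> hyp3 y -> hyp3 z ->
  hdist x z <= hdist x y + hdist y z.
Proof.
move=> hx hy hz; rewrite -ler_cosh ?addr_ge0 ?hdist_ge0 //.
by rewrite coshD !cosh_hdist // !sinh_hdist // ch_triangle.
Qed.

Lemma hdist_ltE x y r : hyp3 x -> hyp3 y -> 0 <= r ->
  (hdist x y < r) = (ch x y < cosh r).
Proof. by move=> hx hy r0; rewrite -cosh_hdist // ltr_coshE ?hdist_ge0. Qed.

(** Split [h] and [w] along [o] and its complement: the second component of [h] has norm sinh (hdist
    o h). This makes the continuity of linear forms on hyperbolic space quantitative. *)
Lemma lorentz_dist_le o h w : hyp3 o -> hyp3 h ->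
  `|lorentz h w - ch o h * lorentz o w| <=
    Num.sqrt (ch o h ^+ 2 - 1) * Num.sqrt (lorentz w w + lorentz w o ^+ 2).
Proof.
move=> ho hh; have [[eo _] [eh _]] := (ho, hh).
have p1 := ch_sqrB1_ge0 ho hh.
have := @lorentz_CS o (h - ch o h *: o) (w + lorentz w o *: o) ho.
rewrite !lorentz_lin eo eh (lorentzC o h) (lorentzC h o) (lorentzC o w) /ch in p1 *.
move=> H; have := H ltac:(ring) ltac:(ring) => {H} H.
rewrite -sqrtrM // -sqrtr_sqr; apply: ler_wsqrtr.
move: (lorentz w o) H => wo H.
by apply: le_eq_trans (eq_le_trans _ H) _; ring.
Qed.

End Lorentz.

(** * Geodesic segments *)

Section Geodesic.
Variable R : realType.
Implicit Types x y z u v w o h : 'rV[R]_4.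

Lemma hyp3_of_ch o x : hyp3 o -> lorentz x x = -1 -> 0 < ch o x -> hyp3 x.
Proof.
move=> ho hx c; split=> //; case: (ltrgt0P (x 0 0)) => // x0.
  suff: 0 < ch o (- x) by rewrite /ch lorentzNr opprK; rewrite /ch in c; lra.
  apply: timelike_gt0 => //; last by rewrite !mxE oppr_gt0.
  by rewrite lorentzNl lorentzNr opprK hx oppr_le0 ler01.
move: hx; rewrite lorentzE x0.
have := sqr_ge0 (x 0 1); have := sqr_ge0 (x 0 2); have := sqr_ge0 (x 0 3).
by rewrite !expr2; lra.
Qed.

(** [u] is the unit tangent vector at [x] pointing to [y]. *)
Lemma geodesic x y : hyp3 x -> hyp3 y -> exists u,
  let g s := cosh s *: x + sinh s *: u in
  [/\ g 0 = x, g (hdist x y) = y & forall s t, 0 <= s -> s <= t ->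
    t <= hdist x y -> hyp3 (g s) /\ hdist (g s) (g t) = t - s].
Proof.
move=> hx hy; have [[ex _] [ey _]] := (hx, hy).
pose L := hdist x y; have L0 : 0 <= L by exact: hdist_ge0.
have g0 u : cosh 0 *: x + sinh 0 *: u = x by rewrite cosh0 sinh0 scale1r scale0r addr0.
have [e|Lne] := eqVneq L 0.
  (* Coincident end points have no direction; the zero vector does, since only the parameter 0
     occurs. *)
  exists 0 => g; split; first exact: g0.
    by rewrite -/L e /g g0; apply: hdist_eq0.
  move=> s t s0 st; rewrite -/L e => t0.
  have -> : s = 0 by lra.
  have -> : t = 0 by lra.
  by rewrite subrr /g g0 hdistxx.
have Lp : 0 < L by rewrite lt_def Lne.
have sp := sinh_gt0 Lp; have sn := lt0r_neq0 sp.
have cL : lorentz x y = - cosh L by rewrite cosh_hdist // /ch opprK.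
have c2 := cosh2_sinh2 L.
pose u := (sinh L)^-1 *: (y - cosh L *: x).
have gL : cosh L *: x + sinh L *: u = y.
  by rewrite /u scalerA mulfV // scale1r addrC subrK.
have ux : lorentz u x = 0.
  by rewrite !lorentz_lin ex (lorentzC y x) cL; field.
have uu : lorentz u u = 1.
  rewrite !lorentz_lin ex ey (lorentzC y x) cL.
  transitivity ((cosh L ^+ 2 - 1) / sinh L ^+ 2); first by field.
  by rewrite c2 [1 + _]addrC addrK divff // sqrf_eq0.
move: u gL ux uu => u gL ux uu; exists u => g.
have gg s t : lorentz (g s) (g t) = - cosh (t - s).
  by rewrite /g !lorentz_lin ex (lorentzC x u) ux uu coshD coshN sinhN; ring.
have hg s : hyp3 (g s).
  apply: (@hyp3_of_ch x) => //; first by rewrite gg subrr cosh0.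
  have -> : x = g 0 by rewrite /g g0.
  by rewrite /ch gg opprK cosh_gt0.
split; first exact: g0.
- exact: gL.
- move=> s t s0 st tL; split => //.
  by apply: cosh_inj; rewrite ?hdist_ge0 ?subr_ge0 // cosh_hdist // /ch gg opprK.
Qed.

(** * Neighbourhoods of a point of hyperbolic space *)

Definition hnear o (P : set 'rV[R]_4) :=
  exists2 r : R, 0 < r & forall h, hyp3 h -> hdist o h < r -> P h.

Lemma hnearW o (P Q : set 'rV[R]_4) : hnear o P ->
  (forall h, hyp3 h -> P h -> Q h) -> hnear o Q.
Proof. by move=> [r r0 H] PQ; exists r => // h hh /H /(PQ _ hh); apply. Qed.

Lemma hnearI o (P Q : set 'rV[R]_4) : hnear o P -> hnear o Q -> hnear o (P `&` Q).
Proof.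
move=> [r r0 HP] [s s0 HQ]; exists (Num.min r s); first by rewrite lt_min r0.
by move=> h hh; rewrite lt_min => /andP[] /HP P1 /HQ Q1; split; auto.
Qed.

Lemma hnear_true o (P : set 'rV[R]_4) : (forall h, hyp3 h -> P h) -> hnear o P.
Proof. by exists 1 => // h hh _; auto. Qed.

Lemma hnear_all o n (P : nat -> set 'rV[R]_4) :
  (forall k, (k < n)%N -> hnear o (P k)) ->
  hnear o (fun h => forall k, (k < n)%N -> P k h).
Proof.
elim: n => [|n IH] H; first by apply: hnear_true.
have /IH h1 : forall k, (k < n)%N -> hnear o (P k) by move=> k kn; apply/H/ltnW.
apply: (hnearW (hnearI h1 (H n (ltnSn _)))) => h _ [H1 H2] k.
by rewrite ltnS leq_eqVlt => /orP[/eqP -> //|]; exact: H1.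
Qed.

(** Linear forms given by their Lorentz duals; barycentric coordinates and their sum are handled in
    this shape. *)
Definition hlin (l : 'rV[R]_4 -> R) := exists w, forall h, l h = lorentz h w.

Lemma hlinD l l' : hlin l -> hlin l' -> hlin (fun h => l h + l' h).
Proof. by move=> [w e] [w' e']; exists (w + w') => h; rewrite e e' lorentzDr. Qed.

Lemma hlinZ c l : hlin l -> hlin (fun h => c * l h).
Proof. by move=> [w e]; exists (c *: w) => h; rewrite e lorentzZr. Qed.

Lemma hlinZr c l : hlin l -> hlin (fun h => l h * c).
Proof. by move=> /(hlinZ c)[w e]; exists w => h; rewrite -e mulrC. Qed.

Lemma hlin_coord i : hlin (fun h => h 0 i).
Proof.
exists (\row_j (if i == 0 then - (j == i)%:R else (j == i)%:R)) => h.
rewrite lorentzE !mxE.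
have : i \in [:: 0; 1; 2; 3].
  by case: i => [[|[|[|[|//]]]] hi]; rewrite !inE -!val_eqE.
by rewrite !inE => /or4P[] /eqP -> /=;
  rewrite ?eqxx /= ?(mulr1, mulr0, addr0, oppr0, add0r, mulrN, opprK).
Qed.

Lemma hnear_gt0 o l : hyp3 o -> hlin l -> 0 < l o -> hnear o (fun h => 0 < l h).
Proof.
move=> ho [w e] lo; have [eo _] := ho.
pose K := Num.sqrt (lorentz w w + lorentz w o ^+ 2) + 1.
have K0 : 0 < K by rewrite ltr_wpDl ?sqrtr_ge0.
pose ep := l o / K; have ep0 : 0 < ep by rewrite divr_gt0.
(* The radius [r] has hyperbolic sine [ep], so that the part of [h] orthogonal to [o] contributes
   less than [l o]. *)
pose c := Num.sqrt (1 + ep ^+ 2).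
have c1 : 1 < c.
  by rewrite -[X in X < _]sqrtr1 ltr_sqrt ?ltrDl ?exprn_gt0 // addr_gt0 ?exprn_gt0.
pose r := ln (c + Num.sqrt (c ^+ 2 - 1)).
have rc : cosh r = c by apply: acoshK; exact: ltW.
have r0 : 0 <= r by apply/acosh_ge0/ltW.
exists r.
  rewrite lt_def r0 andbT; apply/eqP => re; move: rc; rewrite re cosh0 => cE.
  by move: c1; rewrite -cE ltxx.
move=> h hh; rewrite hdist_ltE // rc => cc.
have p1 := ch_ge1 ho hh.
have s1 : Num.sqrt (ch o h ^+ 2 - 1) < ep.
  rewrite -[X in _ < X]ger0_norm ?(ltW ep0) // -sqrtr_sqr ltr_sqrt ?exprn_gt0 //.
  rewrite ltrBlDl -[X in _ < X]sqr_sqrtr ?addr_ge0 ?sqr_ge0 // -/c.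
  by rewrite ltr_pXn2r // nnegrE; lra.
have := lorentz_dist_le w ho hh; rewrite -(e h) -(e o).
have s0 := sqrtr_ge0 (ch o h ^+ 2 - 1).
have K1 : Num.sqrt (lorentz w w + lorentz w o ^+ 2) = K - 1 by rewrite /K addrK.
rewrite K1; set s := Num.sqrt _ in s0 s1 *.
rewrite ler_norml => /andP[H _].
have : s * (K - 1) < l o.
  have : s * (K - 1) <= s * K by rewrite ler_wpM2l //; lra.
  have : s * K < l o by rewrite -ltr_pdivlMr.
  lra.
have : 0 <= (ch o h - 1) * l o by rewrite mulr_ge0 ?subr_ge0 // ltW.
by move=> *; lra.
Qed.

Lemma hnear_lt0 o l : hyp3 o -> hlin l -> l o < 0 -> hnear o (fun h => l h < 0).
Proof.
move=> ho /(hlinZ (-1)) hl l0; apply: (hnearW (hnear_gt0 ho hl _)).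
  by rewrite mulN1r oppr_gt0.
by move=> h _; rewrite mulN1r oppr_gt0.
Qed.

(** For points at distance d, [lorentz_dist_le] bounds [l y] by (cosh d + K sinh d) times [l x], and
    that factor is at most exp (K d). The lower bound [s0] serves to absorb <w,w> into a multiple of
    (l x)^2. *)
Lemma hlin_growth l s0 : hlin l -> 0 < s0 -> exists K : nat, forall x y,
  hyp3 x -> hyp3 y -> s0 <= l x -> l y <= expR (K%:R * hdist x y) * l x.
Proof.
move=> [w e] s00.
have expK (K : nat) (d : R) : 0 <= d -> cosh d + K.+1%:R * sinh d <= expR (K.+1%:R * d).
  move=> d0; have c1 := cosh_ge1 d; have sp := sinh_ge0 d0.
  have ed : expR d = cosh d + sinh d by rewrite /cosh /sinh; lra.
  elim: K => [|K IH]; first by rewrite !mul1r ed.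
  rewrite (_ : K.+2%:R * d = K.+1%:R * d + d); last by rewrite -(natr1 K.+1) mulrDl mul1r.
  rewrite expRD ed; have K0 : 0 <= K.+1%:R :> R by exact: ler0n.
  apply: (@le_trans _ _ ((cosh d + K.+1%:R * sinh d) * (cosh d + sinh d))); last first.
    by rewrite ler_wpM2r // addr_ge0 //; lra.
  rewrite -(natr1 K.+1); move: (K.+1%:R) K0 (cosh d) (sinh d) c1 sp => k k0 c s c1 sp.
  have k1 : 0 <= k * s by rewrite mulr_ge0.
  have k2 : 0 <= k * s * s by rewrite mulr_ge0.
  have k3 : 0 <= k * s * (c - 1) by rewrite mulr_ge0 // subr_ge0.
  have k4 : 0 <= s * (c - 1) by rewrite mulr_ge0 // subr_ge0.
  have k5 : 0 <= c * (c - 1) by rewrite mulr_ge0 // ?subr_ge0 //; lra.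
  by nra.
pose q := 1 + `|lorentz w w| / s0 ^+ 2.
have q1 : 1 <= q by rewrite lerDl divr_ge0 ?normr_ge0 ?sqr_ge0.
exists (Num.truncn q).+1 => x y hx hy lx.
have qK : q <= (Num.truncn q).+1%:R by apply/ltW/truncnS_gt.
set K := (Num.truncn q).+1%:R in qK *.
have lp : 0 < l x by apply: lt_le_trans lx.
have := lorentz_dist_le w hx hy; rewrite -(e x) -(e y) ler_norml => /andP[_].
rewrite -sinh_hdist // -cosh_hdist //.
have d0 := hdist_ge0 hx hy.
have : Num.sqrt (lorentz w w + lorentz w x ^+ 2) <= K * l x.
  have K0 : 0 <= K * l x by rewrite mulr_ge0 ?ler0n // ltW.
  rewrite -[X in _ <= X]ger0_norm // -sqrtr_sqr; apply: ler_wsqrtr.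
  rewrite (lorentzC w x) -(e x) exprMn.
  have : lorentz w w <= `|lorentz w w| / s0 ^+ 2 * l x ^+ 2.
    apply: le_trans (ler_norm _) _; rewrite -mulrA ler_peMr ?normr_ge0 // mulrC.
    by rewrite ler_pdivlMr ?exprn_gt0 // mul1r ler_pXn2r // nnegrE ltW.
  have : q * l x ^+ 2 <= K ^+ 2 * l x ^+ 2.
    rewrite ler_wpM2r ?sqr_ge0 //; apply: le_trans qK _.
    by rewrite expr2 ler_peMr ?ler0n // ler1n.
  by rewrite mulrDl mul1r; lra.
move: (Num.sqrt _) => S SK H.
have s0' := sinh_ge0 d0.
have : sinh (hdist x y) * S <= sinh (hdist x y) * (K * l x) by rewrite ler_wpM2l.
have := expK (Num.truncn q) _ d0; rewrite -/K => E1.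
have : (cosh (hdist x y) + K * sinh (hdist x y)) * l x <= expR (K * hdist x y) * l x.
  by rewrite ler_wpM2r // ltW.
move: (expR _) (sinh _) (cosh _) H => E s c; lra.
Qed.

End Geodesic.

(** * The path pseudometric on the glued tetrahedra *)

Section Reach.
Variables (R : realType) (T : triangulation) (V : tet T -> 'M[R]_4).
Local Notation X := (tet T * 'rV[R]_4)%type.
Implicit Types a b c : X.

Definition tet_point a := hyp_tet (V a.1) a.2.

Definition face_step a b := exists f f' : 'I_4 * 'I_4 * 'I_4,
  ((a.1, f), (b.1, f')) \in pairings T /\
  face_isometry (V a.1) f (V b.1) f' a.2 b.2.

Lemma hyp_face_tet (W : 'M[R]_4) f x : hyp_face W f x -> hyp_tet W x.
Proof.
case: f => [[i j] k] [hx [a [b [c [a0 b0 c0 e]]]]]; split => //.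
exists (a *: delta_mx 0 i + b *: delta_mx 0 j + c *: delta_mx 0 k).
  by move=> l; rewrite !mxE /= !addr_ge0 ?mulr_ge0 ?ler0n.
by rewrite e !mulmxDl -!scalemxAl -!rowE.
Qed.

Lemma face_step_point a b : face_step a b -> tet_point a /\ tet_point b.
Proof.
move=> [[[i j] k] [[[i' j'] k'] [_ [h1 h2 _]]]].
by split; [apply: hyp_face_tet h1 | apply: hyp_face_tet h2].
Qed.

Lemma tet_point_hyp a : tet_point a -> hyp3 a.2.
Proof. by case. Qed.

(* [reach a b r]: there is a chain of segments in tetrahedra, of total length r,
   from a to b, whose consecutive segments are matched by face pairings. *)
Inductive reach : X -> X -> R -> Prop :=
| reach_refl a : tet_point a -> reach a a 0
| reach_step a b c r : reach a b r -> face_step b c \/ face_step c b -> reach a c r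
| reach_move a t x y r : reach a (t, x) r -> hyp_tet (V t) y ->
    reach a (t, y) (r + hdist x y).

Lemma reach_point a b r : reach a b r -> [/\ tet_point a, tet_point b & 0 <= r].
Proof.
elim=> {a b r} [a ha|a b c r _ [h1 h2 h3] h|a t x y r _ [h1 h2 h3] hy]; split => //.
  by case: h => /face_step_point[].
by rewrite addr_ge0 // hdist_ge0 //; [case: h2 | case: hy].
Qed.

Lemma reach_trans a b c r s : reach a b r -> reach b c s -> reach a c (r + s).
Proof.
move=> H H'; elim: H' H => {b c s} [b hb|b c d s _ IH h|b t x y s _ IH hy] H.
- by rewrite addr0.
- by apply: (reach_step (IH H) h).
- by rewrite addrA; apply: (reach_move (IH H)).
Qed.

Lemma reach_move1 t x y : hyp_tet (V t) x -> hyp_tet (V t) y ->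
  reach (t, x) (t, y) (hdist x y).
Proof. by move=> hx hy; rewrite -[hdist _ _]add0r; apply: reach_move => //; apply: reach_refl. Qed.

Lemma reach_sym a b r : reach a b r -> reach b a r.
Proof.
elim=> {a b r} [a ha|a b c r H IH h|a t x y r H IH hy]; first exact: reach_refl.
  rewrite -[r]add0r; apply: reach_trans IH; apply: (@reach_step _ c).
    by apply: reach_refl; case: h => /face_step_point[].
  by case: h; [right|left].
rewrite addrC hdistC; apply: reach_trans IH.
by apply: reach_move1 => //; have [_] := reach_point H.
Qed.

(** Passing between glued points costs no length, so the lengths of chains make sense on the
    quotient. *)
Lemma glued_reach a b c r : glued V a b -> reach c a r <-> reach c b r.
Proof.
move=> H; elim: H c r => {a b} [a b h|a|a b _ IH|a b d _ IH1 _ IH2] c r //.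
- by split=> /reach_step; apply; [left|right].
- by split=> /IH.
- by split=> [/IH1/IH2|/IH2/IH1].
Qed.

Definition reach_dist a b := inf [set r | reach a b r].

Hypothesis conn : forall a b, tet_point a -> tet_point b -> exists r, reach a b r.

Lemma reach_lb a b : has_lbound [set r | reach a b r].
Proof. by exists 0 => r /reach_point[]. Qed.

Lemma reach_dist_le a b r : reach a b r -> reach_dist a b <= r.
Proof. by move=> H; apply: ge_inf => //; exact: reach_lb. Qed.

Lemma reach_dist_lt a b r : tet_point a -> tet_point b -> reach_dist a b < r ->
  exists2 s, s < r & reach a b s.
Proof.
move=> ha hb h; have [s hs] := conn ha hb.
have hi : has_inf [set r | reach a b r] by split; [exists s | exact: reach_lb].
have e0 : 0 < r - reach_dist a b by rewrite subr_gt0.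
have [s' rs] := inf_adherent e0 hi.
by rewrite -/(reach_dist a b) addrC subrK => sr; exists s'.
Qed.

Lemma reach_dist_ge a b r : tet_point a -> tet_point b ->
  (forall s, reach a b s -> r <= s) -> r <= reach_dist a b.
Proof.
move=> ha hb h; have [s hs] := conn ha hb.
by apply: lb_le_inf; [exists s | move=> t; apply: h].
Qed.

Lemma reach_dist_sym a b : reach_dist a b = reach_dist b a.
Proof.
by rewrite /reach_dist; congr inf; apply/seteqP; split=> r /= /reach_sym.
Qed.

Lemma reach_dist_glued a b b' : glued V b b' -> reach_dist a b = reach_dist a b'.
Proof.
by move=> h; rewrite /reach_dist; congr inf; apply/seteqP; split=> r /= /(glued_reach _ _ h).
Qed.

Lemma reach_distxx a : tet_point a -> reach_dist a a = 0.
Proof.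
move=> ha; apply/eqP; rewrite eq_le reach_dist_le /=; last exact: reach_refl.
by apply: reach_dist_ge => // s /reach_point[].
Qed.

Lemma reach_dist_triangle a b c : tet_point a -> tet_point b -> tet_point c ->
  reach_dist a c <= reach_dist a b + reach_dist b c.
Proof.
move=> ha hb hc; apply/ler_addgt0Pl => e e0.
have e2 : 0 < e / 2 by rewrite divr_gt0.
have [s sl hs] := reach_dist_lt ha hb (ltr_pwDr e2 (lexx (reach_dist a b))).
have [t tl ht] := reach_dist_lt hb hc (ltr_pwDr e2 (lexx (reach_dist b c))).
apply: le_trans (reach_dist_le (reach_trans hs ht)) _; lra.
Qed.

(** * Charts of the glued space *)

(* [C y h] says that the point y of a tetrahedron near a is developed to the
   point h of hyperbolic space. *)
Record chart (a : X) (o : 'rV[R]_4) (C : X -> 'rV[R]_4 -> Prop) (r : R) : Prop := Chart {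
  chart_r : 0 < r;
  chart_o : hyp3 o;
  chart_center : C a o;
  chart_point : forall y h, C y h -> tet_point y /\ hyp3 h;
  chart_step : forall y z h, C y h -> hdist o h < r ->
    face_step y z \/ face_step z y -> C z h;
  chart_move : forall t y z h, C (t, y) h -> hyp_tet (V t) z ->
    exists2 h', C (t, z) h' & hdist h h' = hdist y z;
  chart_cover : forall h, hyp3 h -> hdist o h < r -> exists y, C y h;
  chart_seg : forall y y' h h', C y h -> C y' h' -> hdist o h < r / 4 ->
    hdist o h' < r / 4 -> reach y y' (hdist h h');
  chart_inj : forall y h h', C y h -> C y h' -> hdist o h < r -> hdist o h' < r ->
    h = h';
  chart_glued : forall y y' h, C y h -> C y' h -> hdist o h < r -> glued V y y';
  chart_finite : exists (n : nat) (z : nat -> X),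
    (forall k, (k < n)%N -> tet_point (z k) /\ glued V a (z k)) /\
    forall y h, C y h -> hdist o h < r -> exists k,
      [/\ (k < n)%N, (z k).1 = y.1 & hdist (z k).2 y.2 = hdist o h] }.

(** Path lifting: the chain is developed move by move, as long as its length keeps it inside the
    ball where crossing a face is controlled. *)
Lemma chart_develop a o C r y z s h : chart a o C r -> reach y z s -> C y h ->
  hdist o h + s < r -> exists2 h', C z h' & hdist h h' <= s.
Proof.
move=> ch; elim=> {y z s} [b hb|b c d s _ IH st|b t x y s H IH hy] Ch hr.
- by exists h => //; rewrite hdistxx //; case: (chart_point ch Ch).
- have [h' C' le] := IH Ch hr; exists h' => //.
  apply: (chart_step ch C') st.
  have [_ hh] := chart_point ch Ch; have [_ hh'] := chart_point ch C'.
  by apply: le_lt_trans (hdist_triangle (chart_o ch) hh hh') _; lra.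
- have [_ hx s0] := reach_point H.
  have d0 : 0 <= hdist x y by rewrite hdist_ge0 //; [case: hx|case: hy].
  have [|h' C' le] := IH Ch; first lra.
  have [h'' C'' e] := chart_move ch C' hy; exists h'' => //.
  have [_ hh] := chart_point ch Ch; have [_ hh'] := chart_point ch C'.
  have [_ hh''] := chart_point ch C''.
  by apply: le_trans (hdist_triangle hh hh' hh'') _; rewrite e; lra.
Qed.

(** A chain shorter than r/2 stays in the chart, and by injectivity its developed end is [k]. A
    longer one exceeds the distance of two points within r/4 of the centre. *)
Lemma chart_isometry a o C r y z h k : chart a o C r -> C y h -> C z k ->
  hdist o h < r / 4 -> hdist o k < r / 4 -> reach_dist y z = hdist h k.
Proof.
move=> ch Ch Ck oh ok.
have [[hy hh] [hz hk]] := (chart_point ch Ch, chart_point ch Ck).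
have r0 := chart_r ch; have ho := chart_o ch.
apply/eqP; rewrite eq_le reach_dist_le; last exact: (chart_seg ch).
apply: reach_dist_ge => // s hs.
have [s1|s1] := leP (r / 2) s.
  by apply: le_trans (hdist_triangle hh ho hk) _; rewrite (hdistC h); lra.
have [|k' Ck' le] := chart_develop ch hs Ch; first lra.
have [_ hk'] := chart_point ch Ck'.
suff -> : k = k' by [].
apply: (chart_inj ch Ck Ck'); first lra.
by apply: le_lt_trans (hdist_triangle ho hh hk') _; lra.
Qed.

Lemma chart_reach_dist_lt a o C r z s : chart a o C r -> tet_point a -> tet_point z ->
  s <= r -> reach_dist a z < s -> exists2 h, C z h & hdist o h < s.
Proof.
move=> ch ha hz sr /(reach_dist_lt ha hz)[t ts hs].
have oo : hdist _ _ = 0 := hdistxx (chart_o ch).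
have [|h Ch le] := chart_develop ch hs (chart_center ch).
  by rewrite oo add0r; apply: lt_le_trans sr.
by exists h => //; apply: le_lt_trans ts.
Qed.

Hypothesis charts : forall a, tet_point a -> exists o C r, chart a o C r.

(** In the chart at [a], distance 0 develops [b] to the centre, where [chart_glued] identifies
    it. *)
Lemma reach_dist_eq0 a b : tet_point a -> tet_point b -> reach_dist a b = 0 -> glued V a b.
Proof.
move=> ha hb ab; have [p [C [r ch]]] := charts ha.
have r0 := chart_r ch; have r4 : 0 < r / 4 by lra.
have oo : hdist _ _ = 0 := hdistxx (chart_o ch).
have r4r : r / 4 <= r by lra.
have ab4 : reach_dist a b < r / 4 by rewrite ab.
have [h Ch hr] := chart_reach_dist_lt ch ha hb r4r ab4.
have := chart_isometry ch (chart_center ch) Ch; rewrite oo ab => /(_ r4 hr) e.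
have [_ hh] := chart_point ch Ch.
have E : p = h by apply: hdist_eq0 => //; exact: chart_o ch.
apply: (chart_glued ch (chart_center ch) (h := p)); rewrite ?oo // E; exact: Ch.
Qed.

(** * The quotient metric space *)

Definition gcls := {C : set X | `[< exists2 a, tet_point a & C = [set b | glued V a b] >]}.

HB.instance Definition _ := gen_eqMixin gcls.
HB.instance Definition _ := gen_choiceMixin gcls.

Lemma gcls_rep (m : gcls) : exists2 a, tet_point a & val m = [set b | glued V a b].
Proof. by case: m => C /= /asboolP. Qed.

Definition grep (m : gcls) : X := s2val (cid2 (gcls_rep m)).

Lemma grep_point m : tet_point (grep m).
Proof. by rewrite /grep; case: cid2. Qed.

Lemma grepE m : val m = [set b | glued V (grep m) b].
Proof. by rewrite /grep; case: cid2. Qed.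

Definition mk_gcls a (ha : tet_point a) : gcls :=
  exist _ [set b | glued V a b] (asboolT (ex_intro2 _ _ a ha erefl)).

Lemma mk_gclsK a (ha : tet_point a) : glued V a (grep (mk_gcls ha)).
Proof.
have /(congr1 (fun C : set X => C (grep (mk_gcls ha)))) /= := grepE (mk_gcls ha).
by move=> ->; apply: rst_refl.
Qed.

Lemma gcls_eq m m' : glued V (grep m) (grep m') -> m = m'.
Proof.
move=> h; apply/val_inj; rewrite !grepE; apply/seteqP; split=> b /= hb.
  by apply: rst_trans hb; apply: rst_sym.
by apply: rst_trans hb.
Qed.

Definition gdist m m' := reach_dist (grep m) (grep m').

Lemma gdistxx m : gdist m m = 0.
Proof. by apply: reach_distxx; exact: grep_point. Qed.

Lemma gdist_eq0 m m' : gdist m m' = 0 -> m = m'.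
Proof. by move=> h; apply/gcls_eq/reach_dist_eq0 => //; exact: grep_point. Qed.

Lemma gdist_sym m m' : gdist m m' = gdist m' m.
Proof. exact: reach_dist_sym. Qed.

Lemma gdist_triangle m' m m'' : gdist m m'' <= gdist m m' + gdist m' m''.
Proof. by apply: reach_dist_triangle; exact: grep_point. Qed.

Definition gspace : metricType R :=
  HB.pack gcls (isMetric.Build R gcls gdistxx gdist_eq0 gdist_sym gdist_triangle).

End Reach.

(** * The quotient is a hyperbolic manifold obtained by gluing *)

Section GluedSpace.
Variables (R : realType) (T : triangulation) (V : tet T -> 'M[R]_4).
Local Notation X := (tet T * 'rV[R]_4)%type.
Implicit Types a b c : X.
Hypothesis conn : forall a b, tet_point V a -> tet_point V b -> exists r, reach V a b r.
Hypothesis charts : forall a, tet_point V a -> exists o C r, chart V a o C r.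
Variables (a0 : X) (ha0 : tet_point V a0).

Local Notation M := (gspace conn charts).

(** Outside the tetrahedron the value is a filler, the class of [a0]. *)
Definition gproj (t : tet T) (x : 'rV[R]_4) : M :=
  match pselect (tet_point V (t, x)) with
  | left h => mk_gcls h
  | right _ => mk_gcls ha0
  end.

Lemma gprojK t x : hyp_tet (V t) x -> glued V (t, x) (grep (gproj t x)).
Proof.
move=> hx; rewrite /gproj; case: pselect => [h|//]; exact: mk_gclsK.
Qed.

Lemma mdistE (m m' : M) : mdist m m' = reach_dist V (grep m) (grep m').
Proof. by []. Qed.

Lemma mdist_gproj t x t' x' : hyp_tet (V t) x -> hyp_tet (V t') x' ->
  mdist (gproj t x) (gproj t' x') = reach_dist V (t, x) (t', x').
Proof.
move=> hx hx'; rewrite mdistE -(reach_dist_glued _ (gprojK hx')) reach_dist_sym.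
by rewrite -(reach_dist_glued _ (gprojK hx)) reach_dist_sym.
Qed.

Lemma gproj_grep (m : M) : gproj (grep m).1 (grep m).2 = m.
Proof.
apply/gcls_eq/rst_sym.
have := @gprojK (grep m).1 (grep m).2 (grep_point m).
by rewrite -surjective_pairing.
Qed.

Lemma gproj_eqP t x t' x' : hyp_tet (V t) x -> hyp_tet (V t') x' ->
  gproj t x = gproj t' x' <-> glued V (t, x) (t', x').
Proof.
move=> hx hx'; split=> [e|h].
  apply: rst_trans (gprojK hx) _; rewrite e; apply: rst_sym; exact: gprojK.
apply: gcls_eq; apply: rst_trans (gprojK hx'); apply: rst_trans h.
by apply: rst_sym; exact: gprojK.
Qed.

Lemma gspace_hyperbolic : hyperbolic3 M.
Proof.
move=> m; have hm := grep_point m.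
have [p [C [r ch]]] := charts hm.
have r0 := chart_r ch; have hp := chart_o ch.
have pp : hdist p p = 0 := hdistxx hp.
pose P (y : M) (h : 'rV[R]_4) := C (grep y) h /\ hdist p h < r / 4.
have Pex (y : M) : ball m (r / 4) y -> exists h, P y h.
  rewrite ballEmdist /= => h.
  have r4 : r / 4 <= r by lra.
  have [k Ck hk] := chart_reach_dist_lt conn ch hm (grep_point y) r4 h.
  by exists k.
(* The developing map of the ball; [chart_inj] makes the choice unique. *)
pose f (y : M) := xget p [set h | P y h].
have fP (y : M) : ball m (r / 4) y -> P y (f y).
  by move=> /Pex[h Ph]; rewrite /f; case: xgetP => [? -> //|/(_ h)].
have fE (y : M) h : P y h -> f y = h.
  move=> [C1 h1]; rewrite /f; case: xgetP => [? -> [C2 h2]|/(_ h)[]//].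
  by apply: (chart_inj ch C2 C1); lra.
have fm : f m = p by apply: fE; split; [exact: chart_center ch | rewrite pp; lra].
exists (r / 4), f; split.
- by lra.
- by move=> y /fP[/(chart_point ch)[_ ?] _].
- move=> y z /fP[C1 h1] /fP[C2 h2]; rewrite mdistE.
  by rewrite (chart_isometry conn ch C1 C2).
- move=> h hh; rewrite fm => hr.
  have [|y Cy] := chart_cover ch hh; first lra.
  have [hy _] := chart_point ch Cy.
  case: y Cy hy => t y Cy hy; have g := gprojK hy.
  have Cg : C (grep (gproj t y)) h.
    have hpt := grep_point (gproj t y).
    (* The chosen representative of the class may differ from [y]; a chain of length 0 carries the
       developed point over to it. *)
    have : reach V (t, y) (grep (gproj t y)) 0.
      by apply/(glued_reach _ _ g); exact: reach_refl.
    move=> /(chart_develop ch)/(_ Cy)[|h' C' le]; first lra.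
    suff -> : h = h' by [].
    have [_ hh'] := chart_point ch C'.
    by apply: hdist_eq0 => //; apply/eqP; rewrite eq_le le hdist_ge0.
  exists (gproj t y); last exact: fE.
  rewrite ballEmdist /= mdistE (chart_isometry conn ch (chart_center ch) Cg) //.
  by rewrite pp; lra.
Qed.

(** For the quotient topology, [chart_finite] provides finitely many copies of the point such that
    each nearby point lies in the tetrahedron of one of them, at the right distance from it; the
    least of their radii works. *)
Lemma gspace_obtained : obtained_by_gluing V gproj.
Proof.
split.
- move=> m; exists (grep m).1, (grep m).2; first exact: (grep_point m).
  exact: gproj_grep.
- by move=> t t' x x'; exact: gproj_eqP.
- move=> U HU; rewrite openE => m Um; rewrite /interior.
  have hm := grep_point m.
  have [p [C [r ch]]] := charts hm; have r0 := chart_r ch.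
  have [n [z [Hz Hz']]] := chart_finite ch.
  have Hr k : (k < n)%N -> exists2 s, 0 < s & forall y, hyp_tet (V (z k).1) y ->
      hdist (z k).2 y < s -> U (gproj (z k).1 y).
    move=> /Hz[hk gk]; apply: HU => //.
    suff -> : gproj (z k).1 (z k).2 = m by [].
    rewrite -[RHS]gproj_grep; apply/gproj_eqP => //.
    by rewrite -!surjective_pairing; apply: rst_sym.
  have [s s0 Hs] : exists2 s, 0 < s & forall k, (k < n)%N -> forall y,
      hyp_tet (V (z k).1) y -> hdist (z k).2 y < s -> U (gproj (z k).1 y).
    elim: (n) Hr => [|n' IH] Hr; first by exists 1.
    have [|s s0 Hs] := IH; first by move=> k kn; apply/Hr/ltnW.
    have [s' s'0 Hs'] := Hr n' (ltnSn _).
    exists (Num.min s s'); first by rewrite lt_min s0.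
    move=> k; rewrite ltnS leq_eqVlt => /orP[/eqP ->|kn] y hy; rewrite lt_min => /andP[h1 h2].
      exact: Hs'.
    exact: Hs h1.
  apply/nbhs_ballP; exists (Num.min s r); first by rewrite /= lt_min s0.
  move=> y; rewrite ballEmdist /= mdistE => hy.
  have sr : Num.min s r <= r by rewrite ge_min lexx orbT.
  have [h Ch hh] := chart_reach_dist_lt conn ch hm (grep_point y) sr hy.
  have [|k [kn e1 e2]] := Hz' _ _ Ch; first by move: hh; rewrite lt_min => /andP[].
  rewrite -(gproj_grep y) -e1; apply: (Hs k kn).
    by rewrite e1; exact: (grep_point y).
  by rewrite e2; move: hh; rewrite lt_min => /andP[].
- move=> t x hx; have [p [C [r ch]]] := charts (hx : tet_point V (t, x)).
  have r0 := chart_r ch; exists (r / 4); first lra.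
  move=> y z hy hz xy xz; rewrite mdist_gproj //.
  have [h1 C1 e1] := chart_move ch (chart_center ch) hy.
  have [h2 C2 e2] := chart_move ch (chart_center ch) hz.
  have r4r : r / 4 <= r by lra.
  have d : reach_dist V (t, y) (t, z) = hdist h1 h2.
    by apply: (chart_isometry conn ch C1 C2); rewrite ?e1 ?e2.
  rewrite d; apply/eqP; rewrite eq_le -{1}d reach_dist_le /=; last exact: reach_move1.
  have [h3 C3 e3] := chart_move ch C1 hz.
  suff -> : h2 = h3 by rewrite e3.
  have [[_ hp2] [_ hp3] [_ hp1]] := And3 (chart_point ch C2) (chart_point ch C3) (chart_point ch C1).
  have hp := chart_o ch.
  apply: (chart_inj ch C2 C3); first by rewrite e2; lra.
  apply: le_lt_trans (hdist_triangle hp hp1 hp3) _; rewrite e1 e3.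
  apply: (@le_lt_trans _ _ (hdist x y + (hdist x y + hdist x z))); last lra.
  rewrite lerD2l -(hdistC y x); apply: hdist_triangle; first by case: hy.
    by case: hx.
  by case: hz.
Qed.

(** * Completeness *)

Variables (S : X -> R) (K : nat).
Hypothesis S_step : forall a b, face_step V a b -> S a = S b.
Hypothesis S_growth : forall t x y, hyp_tet (V t) x -> hyp_tet (V t) y ->
  S (t, y) <= expR (K%:R * hdist x y) * S (t, x).
Hypothesis S_compact : forall t (r : R), compact [set x | hyp_tet (V t) x /\ S (t, x) <= r].

Lemma S_reach a b r : reach V a b r -> S b <= expR (K%:R * r) * S a.
Proof.
elim=> {a b r} [a ha|a b c r _ IH h|a t x y r H IH hy].
- by rewrite mulr0 expR0 mul1r.
- by have <- : S b = S c by case: h => /S_step.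
- have [_ hx _] := reach_point H.
  apply: le_trans (S_growth hx hy) _; rewrite mulrDr expRD.
  rewrite [expR (K%:R * r) * _]mulrC -mulrA ler_wpM2l ?expR_ge0 //.
Qed.

(** Compares the ambient topology, in which compactness is stated, with the hyperbolic metric. *)
Lemma hdist_nbhs (x : 'rV[R]_4) e : hyp3 x -> 0 < e ->
  \forall y \near x, hyp3 y -> hdist x y < e.
Proof.
move=> hx e0.
have c1 : 1 < cosh e by rewrite -cosh0 ltr_cosh.
have cont : {for x, continuous (fun y => ch x y)}.
  have C i : x 0 i * y 0 i @[y --> x] --> x 0 i * x 0 i.
    by apply: cvgM; [exact: cvg_cst | exact: coord_continuous].
  have E : (fun y => ch x y) = (fun y => - (- (x 0 0 * y 0 0) +
      (x 0 1 * y 0 1 + x 0 2 * y 0 2 + x 0 3 * y 0 3))).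
    by apply/funext => y; rewrite /ch lorentzE.
  rewrite E; exact: (cvgN (cvgD (cvgN (C 0)) (cvgD (cvgD (C 1) (C 2)) (C 3)))).
have : \forall y \near x, ch x y < cosh e.
  by apply: (cvgr_lt (ch x x) cont); rewrite chxx.
by apply: filterS => y h hy; rewrite hdist_ltE // ltW.
Qed.

(** A Cauchy filter contains a ball of radius 1, on which [S] is bounded above. This confines it to
    a finite union of compact images, and a Cauchy filter converges to any of its cluster points. *)
Lemma gspace_complete : complete_metric M.
Proof.
move=> F FF /cauchyP Fc.
have [m0 Fm0] := Fc 1 ltr01.
pose c := expR (K%:R) * `|S (grep m0)|.
pose A t : set 'rV[R]_4 := [set x | hyp_tet (V t) x /\ S (t, x) <= c].
pose B := \big[setU/set0]_(t <- index_enum (tet T)) (gproj t @` A t).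
have cB : compact B.
  apply: bigsetU_compact => t _; apply: continuous_compact; last exact: S_compact.
  apply/subspace_continuousP => x [hx _].
  apply/(@metricType_numDomainType.cvgrPdist_lt R M) => e e0.
  have hx3 : hyp3 x by case: hx.
  have := hdist_nbhs hx3 e0.
  rewrite near_withinE; apply: filterS => y hxy [hy _].
  rewrite mdist_gproj //; apply: le_lt_trans (reach_dist_le (reach_move1 hx hy)) _.
  by apply: hxy; case: hy.
have FB : F B.
  apply: filterS Fm0 => m; rewrite ballEmdist /= mdistE.
  move=> /(reach_dist_lt conn (grep_point m0) (grep_point m))[s s1 /S_reach hs].
  rewrite /B -bigcup_seq; exists (grep m).1; first by rewrite /= mem_index_enum.
  exists (grep m).2; last exact: gproj_grep.
  split; first exact: (grep_point m).
  rewrite -surjective_pairing; apply: le_trans hs _.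
  apply: (@le_trans _ _ (expR (K%:R * s) * `|S (grep m0)|)).
    by rewrite ler_wpM2l ?expR_ge0 // ler_norm.
  by rewrite ler_wpM2r ?normr_ge0 // ler_expR ler_piMr ?ler0n // ltW.
have [m [_ mF]] := cB F FF FB.
exists m; apply/(@metricType_numDomainType.fcvgrPdist_lt R M) => e e0.
have e3 : 0 < e / 3 by lra.
have [m1 Fm1] := Fc _ e3.
have [|m2 [h1 h2]] := mF _ (ball m (e / 3)) Fm1; first exact: nbhsx_ballx.
move: h1 h2; rewrite !ballEmdist /= => h1 h2.
apply: filterS Fm1 => y; rewrite ballEmdist /= => h3.
have := metric_triangle m m2 y; have := metric_triangle m2 m1 y.
by rewrite (metric_sym m2 m1); lra.
Qed.

End GluedSpace.

Lemma ord4_cases (m : 'I_4) (i j k l : 'I_4) : uniq [:: i; j; k; l] ->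
  [|| m == i, m == j, m == k | m == l].
Proof.
move=> u; have : m \in [:: i; j; k; l].
  have [|_ ->] := uniq_min_size u (fun x _ => mem_enum 'I_4 x); last by rewrite mem_enum.
  by rewrite size_enum_ord.
by rewrite !inE.
Qed.

Lemma big_ord4 (R : nmodType) (G : 'I_4 -> R) (i j k l : 'I_4) :
  uniq [:: i; j; k; l] -> \sum_m G m = G i + G j + G k + G l.
Proof.
move=> u; rewrite -big_enum /=.
have p : perm_eq (enum 'I_4) [:: i; j; k; l].
  apply: uniq_perm => //; first exact: enum_uniq.
  by move=> m; rewrite mem_enum !inE; apply/esym; exact: ord4_cases.
by rewrite (perm_big _ p) !big_cons big_nil /= addr0 !addrA.
Qed.

(** * Light-like frames with an edge in standard position *)

Section Frames.
Variable R : realType.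

Definition rv4 (a b c d : R) : 'rV[R]_4 := \row_i nth 0 [:: a; b; c; d] i.

Lemma rv4E a b c d : (rv4 a b c d 0 0 = a) * (rv4 a b c d 0 1 = b) *
  (rv4 a b c d 0 2 = c) * (rv4 a b c d 0 3 = d).
Proof. by rewrite !mxE. Qed.

Lemma rv4P (x y : 'rV[R]_4) : x 0 0 = y 0 0 -> x 0 1 = y 0 1 -> x 0 2 = y 0 2 ->
  x 0 3 = y 0 3 -> x = y.
Proof.
move=> h0 h1 h2 h3; apply/rowP => m; have := @ord4_cases m 0 1 2 3 isT.
by case/or4P => /eqP ->.
Qed.

Definition lplus (L : R) := rv4 L (- L) 0 0.
Definition lminus (L : R) := rv4 L L 0 0.

(* The light-like vector u with <u, lplus L> = -2 a^2 and <u, lminus L> = -2 b^2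
   whose projection orthogonal to the plane of lplus and lminus has argument phi. *)
Definition lpolar (L a b phi : R) := rv4 ((a ^+ 2 + b ^+ 2) / L) ((a ^+ 2 - b ^+ 2) / L)
  (2 * a * b / L * cos phi) (2 * a * b / L * sin phi).

Lemma lorentz_pp L : lorentz (lplus L) (lplus L) = 0.
Proof. by rewrite lorentzE !rv4E; ring. Qed.
Lemma lorentz_mm L : lorentz (lminus L) (lminus L) = 0.
Proof. by rewrite lorentzE !rv4E; ring. Qed.
Lemma lorentz_pm L : lorentz (lplus L) (lminus L) = - 2 * L ^+ 2.
Proof. by rewrite lorentzE !rv4E; ring. Qed.
Lemma lorentz_pl L a b phi : L != 0 ->
  lorentz (lplus L) (lpolar L a b phi) = - 2 * a ^+ 2.
Proof. by move=> L0; rewrite lorentzE !rv4E; field. Qed.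
Lemma lorentz_ml L a b phi : L != 0 ->
  lorentz (lminus L) (lpolar L a b phi) = - 2 * b ^+ 2.
Proof. by move=> L0; rewrite lorentzE !rv4E; field. Qed.

Lemma lorentz_ll L a b a' b' phi phi' : L != 0 ->
  lorentz (lpolar L a b phi) (lpolar L a' b' phi') =
  - 2 * (a ^+ 2 * b' ^+ 2 + a' ^+ 2 * b ^+ 2 - 2 * a * b * a' * b' * cos (phi' - phi)) / L ^+ 2.
Proof. by move=> L0; rewrite lorentzE !rv4E cosB; field. Qed.

Lemma lorentz_ll0 L a b phi : L != 0 -> lorentz (lpolar L a b phi) (lpolar L a b phi) = 0.
Proof. by move=> L0; rewrite lorentz_ll // subrr cos0; field. Qed.

Lemma lplus_gt0 L : 0 < L -> 0 < lplus L 0 0.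
Proof. by rewrite rv4E. Qed.
Lemma lminus_gt0 L : 0 < L -> 0 < lminus L 0 0.
Proof. by rewrite rv4E. Qed.
Lemma lpolar_gt0 L a b phi : 0 < L -> 0 < a -> 0 < lpolar L a b phi 0 0.
Proof. by move=> L0 a0; rewrite rv4E divr_gt0 // ltr_pwDl ?exprn_gt0 ?sqr_ge0. Qed.

(** Coordinates of h with respect to lplus, lminus and two polar vectors. *)
Definition sec_r (L a b phi th : R) (h : 'rV[R]_4) : R :=
  (h 0 3 * cos phi - h 0 2 * sin phi) / (2 * a * b / L * sin th).
Definition sec_s (L a b phi th : R) (h : 'rV[R]_4) : R :=
  (h 0 2 * sin (phi + th) - h 0 3 * cos (phi + th)) / (2 * a * b / L * sin th).
Definition sec_p (L b b' s r : R) (h : 'rV[R]_4) : R :=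
  (h 0 0 - h 0 1) / (2 * L) - s * (b / L) ^+ 2 - r * (b' / L) ^+ 2.
Definition sec_q (L a a' s r : R) (h : 'rV[R]_4) : R :=
  (h 0 0 + h 0 1) / (2 * L) - s * (a / L) ^+ 2 - r * (a' / L) ^+ 2.

Lemma sec_decomp L a b a' b' phi th h : L != 0 -> a != 0 -> b != 0 -> a' != 0 ->
  b' != 0 -> sin th != 0 ->
  let s := sec_s L a b phi th h in let r := sec_r L a' b' phi th h in
  h = sec_p L b b' s r h *: lplus L + sec_q L a a' s r h *: lminus L +
      s *: lpolar L a b phi + r *: lpolar L a' b' (phi + th).
Proof.
move=> L0 a0 b0 a'0 b'0 th0 s r.
have E : sin th = sin (phi + th) * cos phi - cos (phi + th) * sin phi.
  by rewrite -sinB [phi + th]addrC addrK.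
have D0 : sin (phi + th) * cos phi - cos (phi + th) * sin phi != 0 by rewrite -E.
apply: rv4P; rewrite !mxE /=; rewrite /sec_p /sec_q.
- by move: s r => s r; field; rewrite L0.
- by move: s r => s r; field; rewrite L0.
- rewrite /s /r /sec_s /sec_r E; move: D0; move: (cos _) (sin _) (cos _) (sin _) => c d e f D0.
  by field; rewrite ?L0 ?a0 ?b0 ?a'0 ?b'0 ?D0.
- rewrite /s /r /sec_s /sec_r E; move: D0; move: (cos _) (sin _) (cos _) (sin _) => c d e f D0.
  by field; rewrite ?L0 ?a0 ?b0 ?a'0 ?b'0 ?D0.
Qed.

Lemma lorentz_sum (b b' : 'rV[R]_4) (A A' : 'M[R]_4) :
  lorentz (b *m A) (b' *m A') =
  \sum_i \sum_j b 0 i * b' 0 j * lorentz (row i A) (row j A').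
Proof.
rewrite (mulmx_sum_row b) (mulmx_sum_row b').
have H1 (I : Type) (s : seq I) (G : I -> 'rV[R]_4) y :
    lorentz (\sum_(i <- s) G i) y = \sum_(i <- s) lorentz (G i) y.
  elim: s => [|i s IH]; last by rewrite !big_cons lorentzDl IH.
  by rewrite !big_nil lorentzE !mxE; ring.
rewrite H1; apply: eq_bigr => i _; rewrite lorentzC H1; apply: eq_bigr => j _.
by rewrite lorentzZl lorentzZr mulrA [b' 0 j * _]mulrC lorentzC.
Qed.

(** Frames with equal Gram matrices differ by an isometry of the form. *)
Lemma gram_isometry (A B : 'M[R]_4) : A \in unitmx ->
  (forall i j, lorentz (row i A) (row j A) = lorentz (row i B) (row j B)) ->
  forall x y, lorentz (x *m (invmx A *m B)) (y *m (invmx A *m B)) = lorentz x y.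
Proof.
move=> uA H x y; rewrite -{2}(mulmxKV uA x) -{2}(mulmxKV uA y) !mulmxA !lorentz_sum.
by apply: eq_bigr => i _; apply: eq_bigr => j _; rewrite H.
Qed.

(** The sign of the product with a light-like vector tells the two sheets of the hyperboloid apart,
    so one future vector with a future image is enough. *)
Lemma hyp_isometry_light (g : 'M[R]_4) (v : 'rV[R]_4) :
  (forall x y, lorentz (x *m g) (y *m g) = lorentz x y) ->
  future_light v -> future_light (v *m g) -> hyp_isometry g.
Proof.
move=> iso [v0 vp] [w0 wp]; split=> // x hx; have [ex xp] := hx.
have E : lorentz (x *m g) (x *m g) = -1 by rewrite iso.
have c1 : 0 < ch x v by apply: timelike_gt0 => //; rewrite v0.
split=> //; case: (ltrgt0P ((x *m g) 0 0)) => // x0.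
  have hy : hyp3 (- (x *m g)).
    by split; rewrite ?lorentzNl ?lorentzNr ?opprK // !mxE in x0 *; rewrite oppr_gt0.
  have := @timelike_gt0 _ _ (v *m g) hy; rewrite w0 lexx => /(_ isT wp).
  by rewrite /ch lorentzNl iso; rewrite /ch in c1; lra.
move: E; rewrite lorentzE x0.
have := sqr_ge0 ((x *m g) 0 1); have := sqr_ge0 ((x *m g) 0 2).
have := sqr_ge0 ((x *m g) 0 3); rewrite !expr2.
by move=> *; lra.
Qed.

End Frames.

(** * Angular sectors around an axis *)

Section Sectors.
Variable R : realType.

Lemma polar (a b : R) : exists r psi,
  [/\ 0 <= r, 0 <= psi, psi < 2 * pi & a = r * cos psi /\ b = r * sin psi].
Proof.
have pi0 := @pi_gt0 R.
pose r := Num.sqrt (a ^+ 2 + b ^+ 2).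
have r0 : 0 <= r by exact: sqrtr_ge0.
have r2 : r ^+ 2 = a ^+ 2 + b ^+ 2 by rewrite sqr_sqrtr // addr_ge0 ?sqr_ge0.
have [e|rn] := eqVneq r 0.
  move: r2; rewrite e expr0n /= => /esym/eqP.
  rewrite paddr_eq0 ?sqr_ge0 // !sqrf_eq0 => /andP[/eqP -> /eqP ->].
  by exists 0, 0; rewrite !mul0r lexx; split=> //; lra.
have rp : 0 < r by rewrite lt_def rn.
have c1 : (a / r) ^+ 2 + (b / r) ^+ 2 = 1.
  by rewrite !expr_div_n -mulrDl -r2 divff // expf_neq0.
have ab : -1 <= a / r <= 1.
  by rewrite -ler_norml -(@ler_pXn2r _ 2%N) ?nnegrE ?normr_ge0 // -normrX expr1n
    ger0_norm ?sqr_ge0 // -c1 lerDl sqr_ge0.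
have ca := acosK ab; have sa := sin_acos ab.
have sb : Num.sqrt (1 - (a / r) ^+ 2) = `|b| / r.
  by rewrite -c1 addrC addKr sqrtr_sqr normrM normfV (ger0_norm r0).
have [a0 api] := (acos_ge0 ab, acos_lepi ab).
have [b0|b0] := leP 0 b.
  exists r, (acos (a / r)); split=> //; first by lra.
  by rewrite sa sb ca ger0_norm // ![r * _]mulrC !divfK.
exists r, (2 * pi - acos (a / r)).
have ap : 0 < acos (a / r).
  rewrite lt_def a0 andbT; apply/eqP => e; move: sa.
  rewrite e sin0 sb => /esym/eqP; rewrite mulf_eq0 normr_eq0 invr_eq0 (negbTE rn) orbF.
  by move=> /eqP; lra.
split=> //; [by lra|by lra|].
have e2 : 2 * pi - acos (a / r) = - acos (a / r) + pi *+ 2 by rewrite mulr_natl addrC.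
rewrite e2 cosD2pi sinD2pi cosN sinN sa sb ca ltr0_norm // mulNr opprK.
by rewrite ![r * _]mulrC !divfK.
Qed.

Lemma sin_ge0_cases (x : R) : - (2 * pi) < x -> x < 2 * pi -> 0 <= sin x ->
  0 <= x <= pi \/ x <= - pi.
Proof.
move=> x1 x2 s0; have pi0 := @pi_gt0 R.
have [x0|x0] := leP 0 x.
  left; rewrite leNgt; apply/negP => xpi.
  have : 0 < sin (x - pi) by apply: sin_gt0_pi; lra.
  by rewrite sinB cospi sinpi; lra.
right; rewrite leNgt; apply/negP => xpi.
have : 0 < sin (- x) by apply: sin_gt0_pi; lra.
by rewrite sinN; lra.
Qed.

Variables (th : nat -> R) (n : nat).
Hypothesis th_gt0 : forall k, 0 < th k.
Hypothesis th_ltpi : forall k, th k < pi.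
Definition psum k := \sum_(m < k) th m.
Hypothesis psum_n : psum n = 2 * pi.

Lemma psum0 : psum 0 = 0.
Proof. by rewrite /psum big_ord0. Qed.

Lemma psumS k : psum k.+1 = psum k + th k.
Proof. by rewrite /psum big_ord_recr. Qed.

Lemma ltr_psum j k : (j < k)%N -> psum j < psum k.
Proof.
elim: k => // k IH; rewrite ltnS leq_eqVlt => /orP[/eqP ->|/IH h].
  by rewrite psumS ltrDl.
by rewrite psumS; have := th_gt0 k; lra.
Qed.

Lemma ler_psum j k : (j <= k)%N -> psum j <= psum k.
Proof. by rewrite leq_eqVlt => /orP[/eqP -> //|/ltr_psum/ltW]. Qed.

Lemma psum_ge0 k : 0 <= psum k.
Proof. by rewrite -psum0 ler_psum. Qed.

Variable psi : R.
Hypothesis psi_range : 0 <= psi < 2 * pi.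

(** A sector of angle less than pi is an intersection of two half-planes. Up to nonnegative factors,
    the two sines will be the barycentric coordinates off the axis. *)
Definition in_sector k := 0 <= sin (psum k.+1 - psi) /\ 0 <= sin (psi - psum k).

(** The conditions are periodic in [psi], whose range is half-open; the closing ray at angle 2 pi
    therefore shows up as [psi = 0]. *)
Lemma in_sectorP k : (k < n)%N -> in_sector k ->
  psum k <= psi <= psum k.+1 \/ psi = 0 /\ k.+1 = n.
Proof.
move=> kn [h1 h2]; have pi0 := @pi_gt0 R; have /andP[p0 p2] := psi_range.
have k1 : psum k < 2 * pi by rewrite -psum_n ltr_psum.
have k2 : psum k.+1 <= 2 * pi by rewrite -psum_n ler_psum.
have k0 := psum_ge0 k; have tk := th_gt0 k; have tk' := th_ltpi k; have kS := psumS k.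
have x1 : - (2 * pi) < psi - psum k by lra.
have x2 : psi - psum k < 2 * pi by lra.
case: (sin_ge0_cases x1 x2 h2) => [/andP[c1 c2]|c].
  have y1 : - (2 * pi) < psum k.+1 - psi by lra.
  have [y2|y2] := ltP (psum k.+1 - psi) (2 * pi); last by exfalso; lra.
  by left; case: (sin_ge0_cases y1 y2 h1) => [/andP[d1 d2]|d]; apply/andP; split; lra.
have y1 : - (2 * pi) < psum k.+1 - psi by lra.
have [y2|y2] := ltP (psum k.+1 - psi) (2 * pi).
  by exfalso; case: (sin_ge0_cases y1 y2 h1) => [/andP[d1 d2]|d]; lra.
right; have e0 : psi = 0 by lra.
split=> //; apply/eqP; rewrite eqn_leq kn /= leqNgt; apply/negP => kn'.
by have := ltr_psum kn'; rewrite psum_n; lra.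
Qed.

Lemma in_sector2 k k' : (k < k')%N -> (k' < n)%N -> in_sector k -> in_sector k' ->
  k' = k.+1 /\ psi = psum k' \/ [/\ k = 0, k'.+1 = n & psi = 0].
Proof.
move=> kk kn' /(in_sectorP (ltn_trans kk kn')) h /(in_sectorP kn') h'.
have /andP[p0 p2] := psi_range.
have s1 := ler_psum kk; have s2 := ltr_psum kk.
case: h' => [/andP[a1 a2]|[e1 e2]].
  case: h => [/andP[b1 b2]|[_ e]]; last by move: kn'; rewrite -e ltnS leqNgt kk.
  left; have e : psi = psum k' by lra.
  split=> //; apply/eqP; rewrite eqn_leq kk andbT leqNgt; apply/negP => kk'.
  by have := ltr_psum kk' => ?; exfalso; lra.
right; split=> //; case: h => [/andP[b1 b2]|[_ e]].
  case: (posnP k) => // kp; have := ltr_psum kp; rewrite psum0 => ?; exfalso; lra.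
by move: kn'; rewrite -e ltnS leqNgt kk.
Qed.

Lemma sector_cover : exists2 k, (k < n)%N & in_sector k.
Proof.
have /andP[p0 p2] := psi_range; have pi0 := @pi_gt0 R.
have [k kn /andP[k1 k2]] : exists2 k, (k < n)%N & psum k <= psi < psum k.+1.
  have : psi < psum n by rewrite psum_n.
  elim: (n) => [|m IH]; first by rewrite psum0; lra.
  have [h|h] := ltP psi (psum m); last by exists m; rewrite ?ltnSn // h.
  by have [k km h'] := IH h; exists k => //; exact: ltnW.
exists k => //; have tk := th_ltpi k; have := psumS k => e.
by split; apply: sin_ge0_pi; lra.
Qed.

End Sectors.

(** Supremum argument for finitely many closed sets that cover an interval; only the two ends of a
    step must lie in the same set. It will cut a geodesic of a chart into segments, each in one
    tetrahedron. *)
Lemma closed_cover_chain (R : realType) (L : R) n (P : nat -> R -> Prop) (Q : R -> R -> Prop) :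
  0 <= L ->
  (forall k t, (k < n)%N -> 0 <= t <= L -> ~ P k t ->
    exists2 e, 0 < e & forall s, 0 <= s <= L -> `|s - t| < e -> ~ P k s) ->
  (forall s, 0 <= s <= L -> exists2 k, (k < n)%N & P k s) ->
  (forall k s t, (k < n)%N -> 0 <= s -> s <= t -> t <= L -> P k s -> P k t -> Q s t) ->
  (forall s t u, Q s t -> Q t u -> Q s u) -> Q 0 L.
Proof.
move=> L0 clos cover PQ Qtr.
have near t : 0 <= t <= L -> exists2 e, 0 < e & forall s, 0 <= s <= L -> `|s - t| < e ->
    forall k, (k < n)%N -> P k s -> P k t.
  move=> ht; elim: (n) clos => [|m IH] clos; first by exists 1.
  have [|e e0 He] := IH; first by move=> k u km; apply/clos/ltnW.
  have [Pm|Pm] := pselect (P m t).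
    exists e => // s hs st k; rewrite ltnS leq_eqVlt => /orP[/eqP -> //|km].
    exact: He hs st k km.
  have [e' e'0 He'] := clos m t (ltnSn _) ht Pm.
  exists (Num.min e e'); first by rewrite lt_min e0.
  move=> s hs; rewrite lt_min => /andP[st st'] k.
  rewrite ltnS leq_eqVlt => /orP[/eqP -> /(He' _ hs st') //|km].
  exact: He hs st k km.
pose A := [set t | 0 <= t <= L /\ Q 0 t].
have A0 : A 0.
  have h0 : 0 <= (0 : R) <= L by rewrite lexx.
  split=> //; have [k kn Pk] := cover _ h0; apply: (PQ k) => //.
have supA : has_sup A by split; [exists 0 | exists L => t [/andP[_ tL] _]].
pose c := sup A.
have hc : 0 <= c <= L.
  apply/andP; split; first exact: (sup_upper_bound supA).
  by apply: ge_sup => [|t [/andP[]]]; [exists 0|].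
have [e e0 He] := near c hc.
have [t [ht Qt] tc] := sup_adherent e0 supA; rewrite -/c in tc.
have tc' : t <= c by apply: (sup_upper_bound supA).
have Qc : Q 0 c.
  have [k kn Pt] := cover t ht; apply: Qtr Qt _; apply: (PQ k) => //.
  - by case/andP: ht.
  - by case/andP: hc.
  - by apply: He Pt => //; rewrite ltr_norml; lra.
have [cL|] := ltP c L; last by case/andP: hc => c0 cL Lc; have -> : L = c by lra.
pose u := Num.min L (c + e / 2).
have uc : c < u by rewrite lt_min cL /=; lra.
have uL : u <= L by rewrite ge_min lexx.
have ue : u <= c + e / 2 by rewrite ge_min lexx orbT.
have hu : 0 <= u <= L by case/andP: hc => c0 _; lra.
have [k kn Pu] := cover u hu.
have : A u.
  split=> //; apply: Qtr Qc _; apply: (PQ k) => //; [by case/andP: hc|exact: ltW|].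
  by apply: He Pu => //; rewrite ltr_norml; lra.
by move=> /(sup_upper_bound supA); rewrite -/c leNgt uc.
Qed.

(** * Tetrahedra with prescribed edge lengths and angles *)

Section Decorated.
Variables (R : realType) (T : triangulation).
Variables (ell th : tet T -> 'I_4 -> 'I_4 -> R).
Hypothesis ell_sym : forall t i j, ell t i j = ell t j i.
Hypothesis ell_gt0 : forall t i j, 0 < ell t i j.
Hypothesis th_gt0 : forall t i j, 0 < th t i j.
Hypothesis th_ltpi : forall t i j, th t i j < pi.
(** The products of opposite lengths are the sides of a Euclidean triangle whose angles are the
    dihedral angles. *)
Hypothesis cos_law : forall t i j k l, uniq [:: i; j; k; l] ->
  (ell t i j * ell t k l) ^+ 2 =
  (ell t i k * ell t j l) ^+ 2 + (ell t i l * ell t j k) ^+ 2 -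
  2 * (ell t i k * ell t j l) * (ell t i l * ell t j k) * cos (th t i j).

(* (t, (i, j, k, l)) is the tetrahedron t at its edge ij; turning around this edge
   leaves t through the face opposite to k. *)
Definition flag := (tet T * ('I_4 * 'I_4 * 'I_4 * 'I_4))%type.
Definition fv0 (f : flag) := f.2.1.1.1.
Definition fv1 (f : flag) := f.2.1.1.2.
Definition fv2 (f : flag) := f.2.1.2.
Definition fv3 (f : flag) := f.2.2.
Definition funiq (f : flag) := uniq [:: fv0 f; fv1 f; fv2 f; fv3 f].
Definition fell (f : flag) := ell f.1 (fv0 f) (fv1 f).
Definition fth (f : flag) := th f.1 (fv0 f) (fv1 f).

Lemma funiq_neq f : funiq f ->
  [/\ fv0 f != fv1 f, fv0 f != fv2 f & fv0 f != fv3 f] /\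
  [/\ fv1 f != fv2 f, fv1 f != fv3 f & fv2 f != fv3 f].
Proof.
rewrite /funiq /= !inE !negb_or andbT => /andP[/and3P[-> -> ->]].
by move=> /andP[/andP[-> ->] ->].
Qed.

Definition fpol2 (f : flag) phi : 'rV[R]_4 :=
  lpolar (fell f) (ell f.1 (fv0 f) (fv2 f)) (ell f.1 (fv1 f) (fv2 f)) phi.
Definition fpol3 (f : flag) phi : 'rV[R]_4 :=
  lpolar (fell f) (ell f.1 (fv0 f) (fv3 f)) (ell f.1 (fv1 f) (fv3 f)) phi.

(* The tetrahedron of f placed with its edge (fv0 f, fv1 f) in standard position
   and with fv2 f at the angle phi around that edge. *)
Definition fmx (f : flag) (phi : R) : 'M[R]_4 :=
  \matrix_m (if m == fv0 f then lplus (fell f) else if m == fv1 f then lminus (fell f)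
   else if m == fv2 f then fpol2 f phi else fpol3 f (phi + fth f)).

Lemma row_fmx f phi : funiq f ->
  [/\ row (fv0 f) (fmx f phi) = lplus (fell f),
      row (fv1 f) (fmx f phi) = lminus (fell f),
      row (fv2 f) (fmx f phi) = fpol2 f phi &
      row (fv3 f) (fmx f phi) = fpol3 f (phi + fth f)].
Proof.
move=> /funiq_neq[[h1 h2 h3] [h4 h5 h6]].
rewrite !rowK !eqxx [fv1 f == fv0 f]eq_sym [fv2 f == fv0 f]eq_sym [fv2 f == fv1 f]eq_sym.
rewrite [fv3 f == fv0 f]eq_sym [fv3 f == fv1 f]eq_sym [fv3 f == fv2 f]eq_sym.
by rewrite (negbTE h1) (negbTE h2) (negbTE h3) (negbTE h4) (negbTE h5) (negbTE h6).
Qed.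

Lemma mul_fmx f phi (b : 'rV[R]_4) : funiq f ->
  b *m fmx f phi = b 0 (fv0 f) *: lplus (fell f) + b 0 (fv1 f) *: lminus (fell f) +
   b 0 (fv2 f) *: fpol2 f phi + b 0 (fv3 f) *: fpol3 f (phi + fth f).
Proof.
move=> u; rewrite mulmx_sum_row (big_ord4 _ u).
by have [-> -> -> ->] := row_fmx phi u.
Qed.

(** The polar vectors are built to have the right products with the ends of the edge; their own
    product is right by the law of cosines. *)
Lemma fmx_gram f phi i j : funiq f ->
  lorentz (row i (fmx f phi)) (row j (fmx f phi)) =
  if i == j then 0 else - 2 * ell f.1 i j ^+ 2.
Proof.
move=> u; have [r0 r1 r2 r3] := row_fmx phi u.
have [[h1 h2 h3] [h4 h5 h6]] := funiq_neq u.
have L0 : fell f != 0 by rewrite gt_eqF ?ell_gt0.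
have law : lorentz (fpol2 f phi) (fpol3 f (phi + fth f)) =
    - 2 * ell f.1 (fv2 f) (fv3 f) ^+ 2.
  rewrite lorentz_ll // [phi + _]addrC addrK.
  have := cos_law f.1 u; rewrite -/(fell f) -/(fth f) => e.
  apply: (mulfI (expf_neq0 2 L0)).
  rewrite (_ : fell f ^+ 2 * (- 2 * ell f.1 (fv2 f) (fv3 f) ^+ 2) =
    - 2 * (fell f * ell f.1 (fv2 f) (fv3 f)) ^+ 2); last by ring.
  by rewrite e; field.
have := ord4_cases i u; case/or4P => /eqP ->; have := ord4_cases j u; case/or4P => /eqP ->;
  rewrite ?eqxx ?(negbTE h1) ?(negbTE h2) ?(negbTE h3) ?(negbTE h4) ?(negbTE h5) ?(negbTE h6) ?r0 ?r1 ?r2 ?r3;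
  rewrite 1?eq_sym ?(negbTE h1) ?(negbTE h2) ?(negbTE h3) ?(negbTE h4) ?(negbTE h5) ?(negbTE h6);
  by rewrite ?law ?(lorentz_pp, lorentz_mm, lorentz_pm, lorentz_ll0 _ _ _ L0) ?(lorentz_pl _ _ _ L0) ?(lorentz_ml _ _ _ L0)
   // 1?lorentzC ?law ?(lorentz_pp, lorentz_mm, lorentz_pm, lorentz_ll0 _ _ _ L0) ?(lorentz_pl _ _ _ L0) ?(lorentz_ml _ _ _ L0)
  // 1?ell_sym.
Qed.

Definition fcoord (f : flag) phi (h : 'rV[R]_4) := h *m invmx (fmx f phi).

Lemma fth_sin f : 0 < sin (fth f).
Proof. by rewrite sin_gt0_pi // th_gt0 th_ltpi. Qed.

Definition fsec_s f phi := sec_s (fell f) (ell f.1 (fv0 f) (fv2 f)) (ell f.1 (fv1 f) (fv2 f)) phi (fth f).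
Definition fsec_r f phi := sec_r (fell f) (ell f.1 (fv0 f) (fv3 f)) (ell f.1 (fv1 f) (fv3 f)) phi (fth f).

(** The explicit coordinates prove that the four vertices form a basis, and show that those at [fv2]
    and [fv3] depend only on the projection of [h] orthogonal to the plane of the edge. *)
Lemma fsec_decomp f phi h : funiq f -> exists b : 'rV[R]_4,
  [/\ b *m fmx f phi = h, b 0 (fv2 f) = fsec_s f phi h & b 0 (fv3 f) = fsec_r f phi h].
Proof.
move=> u; have [[h1 h2 h3] [h4 h5 h6]] := funiq_neq u.
have E := @sec_decomp R (fell f) (ell f.1 (fv0 f) (fv2 f)) (ell f.1 (fv1 f) (fv2 f))
  (ell f.1 (fv0 f) (fv3 f)) (ell f.1 (fv1 f) (fv3 f)) phi (fth f) h.
exists (\row_m (if m == fv0 f then sec_p (fell f) (ell f.1 (fv1 f) (fv2 f))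
     (ell f.1 (fv1 f) (fv3 f)) (fsec_s f phi h) (fsec_r f phi h) h
   else if m == fv1 f then sec_q (fell f) (ell f.1 (fv0 f) (fv2 f))
     (ell f.1 (fv0 f) (fv3 f)) (fsec_s f phi h) (fsec_r f phi h) h
   else if m == fv2 f then fsec_s f phi h else fsec_r f phi h)).
rewrite mul_fmx // !mxE !eqxx [fv1 f == fv0 f]eq_sym [fv2 f == fv0 f]eq_sym [fv2 f == fv1 f]eq_sym.
rewrite [fv3 f == fv0 f]eq_sym [fv3 f == fv1 f]eq_sym [fv3 f == fv2 f]eq_sym.
rewrite (negbTE h1) (negbTE h2) (negbTE h3) (negbTE h4) (negbTE h5) (negbTE h6).
split => //; rewrite [RHS]E ?gt_eqF ?ell_gt0 //; exact: fth_sin.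
Qed.

Lemma fmx_unit f phi : funiq f -> fmx f phi \in unitmx.
Proof.
move=> u; have /choice[B HB] : forall i : 'I_4, exists b : 'rV[R]_4,
    b *m fmx f phi = row i 1%:M.
  by move=> i; have [b [e _ _]] := fsec_decomp phi (row i 1%:M) u; exists b.
have : (\matrix_i B i) *m fmx f phi = 1%:M.
  by apply/row_matrixP => i; rewrite row_mul rowK HB.
by move/mulmx1_unit => [].
Qed.

Lemma fcoordK f phi h : funiq f -> fcoord f phi h *m fmx f phi = h.
Proof. by move=> u; rewrite /fcoord mulmxKV ?fmx_unit. Qed.

Lemma fmxK f phi b : funiq f -> fcoord f phi (b *m fmx f phi) = b.
Proof. by move=> u; rewrite /fcoord mulmxK ?fmx_unit. Qed.

Lemma fcoord2 f phi h : funiq f -> fcoord f phi h 0 (fv2 f) = fsec_s f phi h.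
Proof. by move=> u; have [b [<- <- _]] := fsec_decomp phi h u; rewrite fmxK. Qed.

Lemma fcoord3 f phi h : funiq f -> fcoord f phi h 0 (fv3 f) = fsec_r f phi h.
Proof. by move=> u; have [b [<- _ <-]] := fsec_decomp phi h u; rewrite fmxK. Qed.

Lemma fcoord_hlin f phi i : hlin (fun h => fcoord f phi h 0 i).
Proof.
have : hlin (fun h => \sum_m h 0 m * invmx (fmx f phi) m i).
  rewrite /index_enum; elim: (Finite.enum _) => [|m s [w IH]].
    by exists 0 => h; rewrite big_nil lorentzE !mxE; ring.
  have [w' H] := hlinZr (invmx (fmx f phi) m i) (@hlin_coord R m).
  by exists (w' + w) => h; rewrite big_cons IH H lorentzDr.
by move=> [w H]; exists w => h; rewrite -H /fcoord mxE.
Qed.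

(** * The ideal tetrahedra *)

Definition flag0 (t : tet T) : flag := (t, (0, 1, 2, 3)).

Lemma funiq0 t : funiq (flag0 t).
Proof. by []. Qed.

Definition ideal_tet (t : tet T) : 'M[R]_4 := fmx (flag0 t) 0.
Definition bary (t : tet T) (x : 'rV[R]_4) : 'rV[R]_4 := fcoord (flag0 t) 0 x.

Lemma baryK t x : bary t x *m ideal_tet t = x.
Proof. exact: fcoordK. Qed.

Lemma mulK_bary t b : bary t (b *m ideal_tet t) = b.
Proof. exact: fmxK. Qed.

Lemma row_fmx_light f phi i : funiq f -> future_light (row i (fmx f phi)).
Proof.
move=> u; split; first by rewrite fmx_gram // eqxx.
have [r0 r1 r2 r3] := row_fmx phi u.
by have := ord4_cases i u; case/or4P => /eqP ->; rewrite ?r0 ?r1 ?r2 ?r3;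
  [apply: lplus_gt0|apply: lminus_gt0|apply: lpolar_gt0|apply: lpolar_gt0]; exact: ell_gt0.
Qed.

Lemma hyp_tetP t x : hyp_tet (ideal_tet t) x <-> hyp3 x /\ forall i, 0 <= bary t x 0 i.
Proof.
split=> [[hx [a a0 e]]|[hx b0]].
  by split=> // i; rewrite e mulK_bary.
by split=> //; exists (bary t x) => //; rewrite baryK.
Qed.

(* Development of the tetrahedron of f onto its placement. *)
Definition dev (f : flag) phi (x : 'rV[R]_4) := bary f.1 x *m fmx f phi.

Lemma lorentz_dev f phi x y : funiq f -> lorentz (dev f phi x) (dev f phi y) = lorentz x y.
Proof.
move=> u; rewrite -{2}(baryK f.1 x) -{2}(baryK f.1 y) /dev !lorentz_sum.
by apply: eq_bigr => i _; apply: eq_bigr => j _; rewrite !fmx_gram.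
Qed.

Lemma fmx_isometry f phi : funiq f ->
  hyp_isometry (invmx (ideal_tet f.1) *m fmx f phi).
Proof.
move=> u; apply: (@hyp_isometry_light _ _ (row 0 (ideal_tet f.1))).
- by apply: gram_isometry => [|i j]; [exact: fmx_unit | rewrite !fmx_gram].
- exact: row_fmx_light.
- rewrite mulmxA rowE mulmxK ?fmx_unit // -rowE; exact: row_fmx_light.
Qed.

Lemma dev_hyp3 f phi x : funiq f -> hyp3 x -> hyp3 (dev f phi x).
Proof. by move=> /(fmx_isometry phi)[_ H] /H; rewrite mulmxA. Qed.

Lemma hdist_dev f phi x y : funiq f -> hdist (dev f phi x) (dev f phi y) = hdist x y.
Proof. by move=> u; apply: hdist_eq; exact: lorentz_dev. Qed.

Lemma fcoord_dev f phi x : funiq f -> fcoord f phi (dev f phi x) = bary f.1 x.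
Proof. exact: fmxK. Qed.

Definition undev (f : flag) phi (h : 'rV[R]_4) := fcoord f phi h *m ideal_tet f.1.

Lemma undevK f phi h : funiq f -> dev f phi (undev f phi h) = h.
Proof. by move=> u; rewrite /dev /undev mulK_bary fcoordK. Qed.

Lemma bary_undev f phi h : bary f.1 (undev f phi h) = fcoord f phi h.
Proof. by rewrite /undev mulK_bary. Qed.

Lemma devK f phi x : funiq f -> undev f phi (dev f phi x) = x.
Proof. by move=> u; rewrite /undev fcoord_dev // baryK. Qed.

Lemma undev_isometry f phi : funiq f ->
  hyp_isometry (invmx (fmx f phi) *m ideal_tet f.1).
Proof.
move=> u; apply: (@hyp_isometry_light _ _ (row 0 (fmx f phi))).
- by apply: gram_isometry => [|i j]; [exact: fmx_unit | rewrite !fmx_gram].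
- exact: row_fmx_light.
- rewrite mulmxA rowE mulmxK ?fmx_unit // -rowE; exact: row_fmx_light.
Qed.

Lemma undev_hyp3 f phi h : funiq f -> hyp3 h -> hyp3 (undev f phi h).
Proof. by move=> /(undev_isometry phi)[_ H] /H; rewrite mulmxA. Qed.

Lemma ideal_tet_pos t : pos_ideal_tetrahedron (ideal_tet t).
Proof.
split=> [i|]; first exact: row_fmx_light.
have [r0 r1 r2 r3] := row_fmx 0 (funiq0 t).
have E i c : ideal_tet t i c = row i (fmx (flag0 t) 0) 0 c by rewrite [RHS]mxE.
(* Adding the first column to the second makes the matrix of vertices lower triangular, with
   positive diagonal. *)
pose N : 'M[R]_4 := \matrix_(i, j) ((i == j) || (i == 0) && (j == 1))%:R.
have ord4 (P : 'I_4 -> Prop) : P 0 -> P 1 -> P 2 -> P 3 -> forall i, P i.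
  by move=> p0 p1 p2 p3 i; have := @ord4_cases i 0 1 2 3 isT; case/or4P => /eqP ->.
have detN : \det N = 1.
  rewrite -det_tr det_trig.
    by rewrite (@big_ord_recl _ _ _ 3) !big_ord_recl big_ord0 !mxE /= !mulr1.
  apply/is_trig_mxP => i j; rewrite !mxE => ij.
  by elim/ord4: i ij => ij; elim/ord4: j ij.
rewrite -[X in 0 < X]mulr1 -detN -det_mulmx det_trig.
  apply: prodr_gt0 => i _; rewrite mxE (big_ord4 _ (funiq0 t)) !E.
  have sp : 0 < sin (fth (flag0 t)) := fth_sin _.
  have lp : 0 < fell (flag0 t) := ell_gt0 _ _ _.
  have ll i' j' : 0 < ell t i' j' := ell_gt0 _ _ _.
  elim/ord4: i; rewrite ?r0 ?r1 ?r2 ?r3 !mxE /= ?cos0 ?sin0 ?add0r ?(mulr0, mulr1, addr0, add0r) //.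
  - by rewrite addr_gt0.
  - by rewrite !mulr_gt0 ?invr_gt0 //; apply: ll.
  - by rewrite !mulr_gt0 ?invr_gt0 //; apply: ll.
apply/is_trig_mxP => i j ij; rewrite mxE (big_ord4 _ (funiq0 t)) !E.
elim/ord4: i ij => ij; elim/ord4: j ij => // _;
  rewrite ?r0 ?r1 ?r2 ?r3 !mxE /= ?sin0 ?(mulr0, mulr1, addr0, add0r, subrr) //.
Qed.

(** * Face pairings in barycentric coordinates *)

#[local] Opaque bary.

(** An isometry only has to match vertices up to positive factors. Equal lengths of the three edges
    give these factors pairwise products 1, so all are 1 and barycentric coordinates are preserved.
    Conversely, both tetrahedra are moved so that the common face has the same standard position. *)
Lemma face_isometryP t t' i j k l i' j' k' l' x y :
  uniq [:: i; j; k; l] -> uniq [:: i'; j'; k'; l'] ->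
  ell t i j = ell t' i' j' -> ell t i k = ell t' i' k' -> ell t j k = ell t' j' k' ->
  face_isometry (ideal_tet t) (i, j, k) (ideal_tet t') (i', j', k') x y <->
  [/\ hyp_tet (ideal_tet t) x, bary t x 0 l = 0, bary t' y 0 l' = 0 &
   [/\ bary t' y 0 i' = bary t x 0 i, bary t' y 0 j' = bary t x 0 j &
    bary t' y 0 k' = bary t x 0 k]].
Proof.
move=> u u' eij eik ejk.
pose f : flag := (t, (i, j, k, l)); pose f' : flag := (t', (i', j', k', l')).
have uf : funiq f by []. have uf' : funiq f' by [].
have [[n1 n2 n3] [n4 n5 n6]] := funiq_neq uf.
have [[n1' n2' n3'] [n4' n5' n6']] := funiq_neq uf'.
have comb t1 i1 j1 k1 l1 z : uniq [:: i1; j1; k1; l1] -> bary t1 z 0 l1 = 0 ->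
    z = bary t1 z 0 i1 *: row i1 (ideal_tet t1) + bary t1 z 0 j1 *: row j1 (ideal_tet t1)
      + bary t1 z 0 k1 *: row k1 (ideal_tet t1).
  move=> u1 z0; rewrite -[LHS](baryK t1) mulmx_sum_row (big_ord4 _ u1) z0.
  by rewrite scale0r addr0.
have combK t1 i1 j1 k1 l1 a b c : uniq [:: i1; j1; k1; l1] ->
    let z := a *: row i1 (ideal_tet t1) + b *: row j1 (ideal_tet t1)
      + c *: row k1 (ideal_tet t1) in
    [/\ bary t1 z 0 i1 = a, bary t1 z 0 j1 = b, bary t1 z 0 k1 = c & bary t1 z 0 l1 = 0].
  move=> u1 z; have [[m1 m2 m3] [m4 m5 m6]] := @funiq_neq (t1, (i1, j1, k1, l1)) u1.
  have -> : z = (a *: delta_mx 0 i1 + b *: delta_mx 0 j1 + c *: delta_mx 0 k1) *m ideal_tet t1.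
    by rewrite !mulmxDl -!scalemxAl -!rowE.
  rewrite !mulK_bary !mxE /= !eqxx [j1 == i1]eq_sym [k1 == i1]eq_sym [k1 == j1]eq_sym.
  rewrite [l1 == i1]eq_sym [l1 == j1]eq_sym [l1 == k1]eq_sym.
  move: m1 m2 m3 m4 m5 m6; rewrite /fv0 /fv1 /fv2 /fv3 /= => m1 m2 m3 m4 m5 m6.
  rewrite (negbTE m1) (negbTE m2) (negbTE m3) (negbTE m4) (negbTE m5) (negbTE m6) /=.
  by rewrite !(mulr0, mulr1, addr0, add0r).
split.
- move=> [[hx [a [b [c [a0 b0 c0 ex]]]]] [hy _] [g [[giso gh] [ci ci0 ei] [cj cj0 ej] [ck ck0 ek] ey]]].
  have := combK t i j k l a b c u; rewrite /= -ex => -[bi bj bk bl].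
  have gram i1 j1 c1 d1 i2 j2 : i1 != j1 -> ell t i1 j1 = ell t' i2 j2 -> i2 != j2 ->
      row i2 (ideal_tet t') = c1 *: (row i1 (ideal_tet t) *m g) ->
      row j2 (ideal_tet t') = d1 *: (row j1 (ideal_tet t) *m g) -> c1 * d1 = 1.
    move=> h1 e1 h2 r1 r2; have := fmx_gram 0 i2 j2 (funiq0 t').
    rewrite (negbTE h2) r1 r2 lorentzZl lorentzZr giso fmx_gram // (negbTE h1) /= -e1 => E.
    have p : 2 * ell t i1 j1 ^+ 2 != 0 by rewrite mulf_neq0 // expf_neq0 // gt_eqF.
    apply: (mulIf p); apply: oppr_inj; rewrite mul1r -mulNr.
    by move: E; rewrite !mulNr !mulrN mulrA => <-; ring.
  have cij := gram _ _ _ _ _ _ n1 eij n1' ei ej.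
  have cik := gram _ _ _ _ _ _ n2 eik n2' ei ek.
  have cjk := gram _ _ _ _ _ _ n4 ejk n4' ej ek.
  have ejk' : cj = ck by apply: (mulfI (lt0r_neq0 ci0)); rewrite cij cik.
  have ck1 : ck = 1.
    have : ck ^+ 2 == 1 by rewrite expr2 -{1}ejk' cjk.
    by rewrite sqrf_eq1 => /orP[/eqP //|/eqP e]; move: ck0; rewrite e ltr0N1.
  have cj1 : cj = 1 by rewrite ejk'.
  have ci1 : ci = 1 by rewrite -cij cj1 mulr1.
  rewrite ci1 cj1 ck1 !scale1r in ei ej ek.
  have ey' : y = a *: row i' (ideal_tet t') + b *: row j' (ideal_tet t') + c *: row k' (ideal_tet t').
    by rewrite ey ex !mulmxDl -!scalemxAl ei ej ek.
  have := combK t' i' j' k' l' a b c u'; rewrite /= -ey' => -[bi' bj' bk' bl'].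
  rewrite bi bj bk bl bi' bj' bk' bl'; split=> //; split=> //.
  exists (a *: delta_mx 0 i + b *: delta_mx 0 j + c *: delta_mx 0 k).
    by move=> m; rewrite !mxE !addr_ge0 ?mulr_ge0 ?ler0n.
  by rewrite ex !mulmxDl -!scalemxAl -!rowE.
- move=> [/hyp_tetP[hx x0] xl yl [yi yj yk]].
  pose g := (invmx (ideal_tet t) *m fmx f 0) *m (invmx (fmx f' 0) *m ideal_tet t').
  have [iso1 hyp1] := fmx_isometry 0 uf; have [iso2 hyp2] := undev_isometry 0 uf'.
  have giso : hyp_isometry g.
    by split=> [z w|z hz]; rewrite /g !(mulmxA _ _ (invmx (fmx f' 0) *m _)) ?iso2 ?iso1 //;
      apply/hyp2/hyp1.
  have ef : fell f = fell f' by exact: eij.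
  have ep : fpol2 f 0 = fpol2 f' 0 by rewrite /fpol2 ef /fv0 /fv1 /fv2 /= eik ejk.
  have rowg m m' : row m (fmx f 0) = row m' (fmx f' 0) ->
      row m (ideal_tet t) *m g = row m' (ideal_tet t').
    move=> e; rewrite /g !mulmxA [row m _]rowE mulmxK ?fmx_unit // -rowE e [row m' _]rowE.
    by rewrite mulmxK ?fmx_unit // -rowE.
  have [r0 r1 r2 _] := row_fmx 0 uf; have [r0' r1' r2' _] := row_fmx 0 uf'.
  have gi : row i (ideal_tet t) *m g = row i' (ideal_tet t') by apply: rowg; rewrite r0 r0' ef.
  have gj : row j (ideal_tet t) *m g = row j' (ideal_tet t') by apply: rowg; rewrite r1 r1' ef.
  have gk : row k (ideal_tet t) *m g = row k' (ideal_tet t') by apply: rowg; rewrite r2 r2' ep.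
  have ex := comb t i j k l x u xl; have ey := comb t' i' j' k' l' y u' yl.
  have eg : y = x *m g by rewrite ey ex !mulmxDl -!scalemxAl gi gj gk yi yj yk.
  split.
  + by split=> //; exists (bary t x 0 i), (bary t x 0 j), (bary t x 0 k).
  + split; first by rewrite eg; apply: giso.2.
    by exists (bary t x 0 i), (bary t x 0 j), (bary t x 0 k); split=> //; rewrite -yi -yj -yk.
  + by exists g; split=> //; exists 1; rewrite ?scale1r.
Qed.

(** [glue t l] is the tetrahedron across the face opposite to [l], with the permutation of labels
    that extends the face pairing to the opposite vertices. *)
Variable glue : tet T -> 'I_4 -> tet T * ('I_4 -> 'I_4).
Hypothesis glueK : forall t l, let g := glue t l in
  (glue g.1 (g.2 l)).1 = t /\ forall i, (glue g.1 (g.2 l)).2 (g.2 i) = i.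
Hypothesis glue_ell : forall t l i j, i != l -> j != l ->
  ell (glue t l).1 ((glue t l).2 i) ((glue t l).2 j) = ell t i j.
Hypothesis glue_pairing : forall t i j k t' i' j' k',
  ((t, (i, j, k)), (t', (i', j', k'))) \in pairings T ->
  exists2 l, uniq [:: i; j; k; l] & let g := glue t l in
    [/\ t' = g.1, i' = g.2 i, j' = g.2 j & k' = g.2 k].
Hypothesis pairing_glue : forall t l, let g := glue t l in
  exists i j k, uniq [:: i; j; k; l] /\
   (((t, (i, j, k)), (g.1, (g.2 i, g.2 j, g.2 k))) \in pairings T \/
    ((g.1, (g.2 i, g.2 j, g.2 k)), (t, (i, j, k))) \in pairings T).
Hypothesis glue_nofix : forall t l, (glue t l).1 = t -> (glue t l).2 l != l.

Local Notation X := (tet T * 'rV[R]_4)%type.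

Lemma glue_inj t l : injective (glue t l).2.
Proof. by have [_ H] := glueK t l; exact: can_inj H. Qed.

Lemma glue_surj t l j : exists i, (glue t l).2 i = j.
Proof.
have [g' _ H] := injF_bij (@glue_inj t l).
by exists (g' j).
Qed.

Definition adjacent_via l (a b : X) :=
  [/\ tet_point ideal_tet a, b.1 = (glue a.1 l).1, bary a.1 a.2 0 l = 0 &
   forall i, bary b.1 b.2 0 ((glue a.1 l).2 i) = bary a.1 a.2 0 i].

Lemma uniq_glue t l i j k l' : uniq [:: i; j; k; l'] ->
  uniq [:: (glue t l).2 i; (glue t l).2 j; (glue t l).2 k; (glue t l).2 l'].
Proof. by rewrite -(map_inj_uniq (@glue_inj t l)). Qed.

Lemma adjacent_via_step l a b : adjacent_via l a b ->
  face_step ideal_tet a b \/ face_step ideal_tet b a.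
Proof.
case: a b => [t x] [t' y] [hx /= et xl H]; subst t'.
have [i [j [k [u [h|h]]]]] := pairing_glue t l; [left|right].
all: have u' := uniq_glue t l u; have [[n1 n2 n3] [n4 n5 n6]] := @funiq_neq (t, (i, j, k, l)) u.
all: move: n1 n2 n3 n4 n5 n6; rewrite /fv0 /fv1 /fv2 /fv3 /= => n1 n2 n3 n4 n5 n6.
  exists (i, j, k), ((glue t l).2 i, (glue t l).2 j, (glue t l).2 k); split=> //=.
  apply/(face_isometryP _ _ u u'); rewrite ?glue_ell //.
  by split; [exact: hx|exact: xl|exact: etrans (H l) xl|split; exact: H].
exists ((glue t l).2 i, (glue t l).2 j, (glue t l).2 k), (i, j, k); split=> //=.
apply/(face_isometryP _ _ u' u); rewrite ?glue_ell //.
have [_ hy _] : face_isometry (ideal_tet t) (i, j, k) (ideal_tet (glue t l).1)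
    ((glue t l).2 i, (glue t l).2 j, (glue t l).2 k) x y.
  apply/(face_isometryP _ _ u u'); rewrite ?glue_ell //.
  by split; [exact: hx|exact: xl|exact: etrans (H l) xl|split; exact: H].
split; [exact: hyp_face_tet hy|exact: etrans (H l) xl|exact: xl|].
by split; exact/esym/H.
Qed.

Lemma adjacent_via_sym l a b : adjacent_via l a b ->
  adjacent_via ((glue a.1 l).2 l) b a.
Proof.
move=> h; have [_ hb] : tet_point ideal_tet a /\ tet_point ideal_tet b.
  by case: (adjacent_via_step h) => /face_step_point[].
move: h => [ha eb al H]; have [K1 K2] := glueK a.1 l.
split; rewrite ?eb //; first by rewrite -eb H.
move=> i; have [j <-] := glue_surj (a.1) l i.
by rewrite K2 -eb H.
Qed.

Lemma face_step_adjacent a b : face_step ideal_tet a b ->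
  exists l, adjacent_via l a b.
Proof.
case: a b => [t x] [t' y] [[[i j] k] [[[i' j'] k'] [/= h hf]]].
have [l u [et ei ej ek]] := glue_pairing h; exists l; subst t' i' j' k'.
have u' := uniq_glue t l u; have [[n1 n2 n3] [n4 n5 n6]] := @funiq_neq (t, (i, j, k, l)) u.
move: n1 n2 n3 n4 n5 n6; rewrite /fv0 /fv1 /fv2 /fv3 /= => n1 n2 n3 n4 n5 n6.
move: hf => /(face_isometryP _ _ u u'); rewrite ?glue_ell // => /(_ erefl erefl erefl).
move=> [hx xl yl [yi yj yk]]; split=> // m.
by have := ord4_cases m u; case/or4P => /eqP -> //=; rewrite xl.
Qed.

Lemma face_step_adjacentE a b : face_step ideal_tet a b \/ face_step ideal_tet b a ->
  exists l, adjacent_via l a b.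
Proof.
case=> /face_step_adjacent[l h]; first by exists l.
by eexists; apply: adjacent_via_sym h.
Qed.

(** * Turning around an edge *)

Definition nextf (f : flag) : flag := let g := glue f.1 (fv2 f) in
  (g.1, (g.2 (fv0 f), g.2 (fv1 f), g.2 (fv3 f), g.2 (fv2 f))).

Lemma funiq_next f : funiq f -> funiq (nextf f).
Proof.
move=> u; apply: (@uniq_glue f.1 (fv2 f) (fv0 f) (fv1 f) (fv3 f) (fv2 f)).
have [[n1 n2 n3] [n4 n5 n6]] := funiq_neq u.
by rewrite /= !inE !negb_or n1 n2 n3 n4 n5 (eq_sym (fv3 f)) n6.
Qed.

Lemma fell_next f : funiq f -> fell (nextf f) = fell f.
Proof. by move=> /funiq_neq[[n1 n2 n3] [n4 n5 n6]]; apply: glue_ell. Qed.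

Lemma fpol_next f phi : funiq f -> fpol2 (nextf f) phi = fpol3 f phi.
Proof.
move=> u; have [[n1 n2 n3] [n4 n5 n6]] := funiq_neq u.
by rewrite /fpol2 /fpol3 fell_next //; congr lpolar; apply: glue_ell => //; rewrite eq_sym.
Qed.

(** Consecutive placements share the vertices of the common face. *)
Lemma fcoord_next f phi h i : funiq f -> fcoord f phi h 0 (fv2 f) = 0 ->
  fcoord (nextf f) (phi + fth f) h 0 ((glue f.1 (fv2 f)).2 i) = fcoord f phi h 0 i.
Proof.
move=> u h2; have u' := funiq_next u.
have [g' gK g'K] := injF_bij (@glue_inj f.1 (fv2 f)).
pose b : 'rV[R]_4 := \row_j fcoord f phi h 0 (g' j).
have bE j : b 0 ((glue f.1 (fv2 f)).2 j) = fcoord f phi h 0 j by rewrite mxE gK.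
have e : b *m fmx (nextf f) (phi + fth f) = h.
  rewrite mul_fmx // -[RHS](fcoordK phi h u) mul_fmx // !bE h2 fell_next // fpol_next //.
  by rewrite !scale0r !addr0.
by rewrite -{1}e fmxK // bE.
Qed.

Lemma adjacent_next f phi h : funiq f -> hyp3 h -> (forall i, 0 <= fcoord f phi h 0 i) ->
  fcoord f phi h 0 (fv2 f) = 0 ->
  adjacent_via (fv2 f) (f.1, undev f phi h) ((nextf f).1, undev (nextf f) (phi + fth f) h).
Proof.
move=> u hh h0 h2; split=> //=.
- by apply/hyp_tetP; rewrite bary_undev; split=> //; apply: undev_hyp3.
- by rewrite bary_undev.
- by move=> i; rewrite (bary_undev (nextf f)) bary_undev fcoord_next.
Qed.

Lemma dev_next f phi x y : funiq f -> adjacent_via (fv2 f) (f.1, x) ((nextf f).1, y) ->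
  dev (nextf f) (phi + fth f) y = dev f phi x.
Proof.
move=> u [/= hx _ x2 H]; rewrite /dev !mul_fmx ?funiq_next // fell_next // fpol_next //.
have e0 : bary (nextf f).1 y 0 (fv0 (nextf f)) = bary f.1 x 0 (fv0 f) by exact: H.
have e1 : bary (nextf f).1 y 0 (fv1 (nextf f)) = bary f.1 x 0 (fv1 f) by exact: H.
have e2 : bary (nextf f).1 y 0 (fv2 (nextf f)) = bary f.1 x 0 (fv3 f) by exact: H.
have e3 : bary (nextf f).1 y 0 (fv3 (nextf f)) = bary f.1 x 0 (fv2 f) by exact: H.
by rewrite e0 e1 e2 e3 x2 !scale0r !addr0.
Qed.

(** * The chart given by the open star of an edge *)

Lemma fmx_2pi f phi : fmx f (phi + 2 * pi) = fmx f phi.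
Proof.
have E psi : psi + 2 * pi = psi + pi *+ 2 by rewrite mulr_natl.
have H L a b psi : lpolar L a b (psi + 2 * pi) = lpolar L a b psi :> 'rV[R]_4.
  by rewrite E /lpolar cosD2pi sinD2pi.
by apply/row_matrixP => i; rewrite !rowK addrAC /fpol2 /fpol3 !H.
Qed.

Section EdgeChart.
Variables (f0 : flag) (x0 : 'rV[R]_4) (n : nat).
Hypothesis uf0 : funiq f0.
Hypothesis hx0 : hyp_tet (ideal_tet f0.1) x0.
Hypothesis x0_pos : 0 < bary f0.1 x0 0 (fv0 f0) /\ 0 < bary f0.1 x0 0 (fv1 f0).
Local Notation F k := (iter k nextf f0).
Hypothesis n_gt0 : (0 < n)%N.
Hypothesis F_n : F n = f0.
Hypothesis angle_sum : \sum_(k < n) fth (F k) = 2 * pi.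
Hypothesis edge_inj : forall k k', (k < n)%N -> (k' < n)%N -> (F k).1 = (F k').1 ->
  fv0 (F k') \in [:: fv0 (F k); fv1 (F k)] ->
  fv1 (F k') \in [:: fv0 (F k); fv1 (F k)] -> k = k'.

Local Notation ph := (psum (fun k => fth (F k))).
Definition ecoord k (h : 'rV[R]_4) := fcoord (F k) (ph k) h.
Definition in_tet k h := forall i, 0 <= ecoord k h 0 i.
Definition epoint k h : X := ((F k).1, undev (F k) (ph k) h).
Definition follows k k' := k' = k.+1 \/ k.+1 = n /\ k' = 0.

Lemma uF k : funiq (F k).
Proof. by elim: k => // k IH; exact: funiq_next. Qed.

Lemma followsP k k' : follows k k' -> F k' = nextf (F k) /\
  fmx (F k') (ph k') = fmx (nextf (F k)) (ph k + fth (F k)).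
Proof.
case=> [->|[e ->]]; first by rewrite psumS.
have E : F 0 = nextf (F k) by rewrite -iterS e F_n.
split=> //; rewrite -E psum0 -psumS e -[psum _ _]/(\sum_(k < n) fth (F k)) angle_sum.
by rewrite -{1}[2 * pi]add0r fmx_2pi.
Qed.

Lemma ecoord_follows k k' h i : follows k k' -> ecoord k h 0 (fv2 (F k)) = 0 ->
  ecoord k' h 0 ((glue (F k).1 (fv2 (F k))).2 i) = ecoord k h 0 i.
Proof.
move=> /followsP[_ e] h2; rewrite /ecoord {1}/fcoord e -/(fcoord _ _ h).
by apply: fcoord_next => //; exact: uF.
Qed.

Lemma ecoord_follows4 k k' h : follows k k' -> ecoord k h 0 (fv2 (F k)) = 0 ->
  [/\ ecoord k' h 0 (fv0 (F k')) = ecoord k h 0 (fv0 (F k)),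
      ecoord k' h 0 (fv1 (F k')) = ecoord k h 0 (fv1 (F k)),
      ecoord k' h 0 (fv2 (F k')) = ecoord k h 0 (fv3 (F k)) &
      ecoord k' h 0 (fv3 (F k')) = 0].
Proof.
move=> fo h2; have [e _] := followsP fo.
by split; rewrite {1}e /= ecoord_follows.
Qed.

Lemma epoint_tet k h : hyp3 h -> in_tet k h -> tet_point ideal_tet (epoint k h).
Proof.
move=> hh hk; apply/hyp_tetP; split; first by apply: undev_hyp3 => //; exact: uF.
by move=> i; rewrite bary_undev; exact: hk.
Qed.

Lemma epoint_in_tet k h : tet_point ideal_tet (epoint k h) -> in_tet k h.
Proof. by move=> /hyp_tetP[_ H] i; have := H i; rewrite bary_undev. Qed.

Lemma epoint_eq k t x h : t = (F k).1 -> dev (F k) (ph k) x = h -> epoint k h = (t, x).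
Proof. by move=> -> <-; rewrite /epoint devK //; exact: uF. Qed.

Lemma hdist_epoint k h h' : hdist (epoint k h).2 (epoint k h').2 = hdist h h'.
Proof. by rewrite -(hdist_dev (ph k) _ _ (uF k)) !undevK ?uF. Qed.

Lemma epoint_follows k k' h : hyp3 h -> in_tet k h -> follows k k' ->
  ecoord k h 0 (fv2 (F k)) = 0 -> adjacent_via (fv2 (F k)) (epoint k h) (epoint k' h).
Proof.
move=> hh hk fo h2; have [e1 e2] := followsP fo.
have -> : epoint k' h = ((nextf (F k)).1, undev (nextf (F k)) (ph k + fth (F k)) h).
  by rewrite /epoint /undev /fcoord e2 e1.
by apply: adjacent_next => //; exact: uF.
Qed.

(** The signs of the coordinates off the edge become signs of sines, so that questions about
    overlaps reduce to sectors of a plane. *)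
Lemma ecoord_polar h : exists r psi, [/\ 0 <= r, 0 <= psi < 2 * pi &
  forall k, exists A B, [/\ 0 < A, 0 < B,
   ecoord k h 0 (fv2 (F k)) = A * (r * sin (ph k.+1 - psi)) &
   ecoord k h 0 (fv3 (F k)) = B * (r * sin (psi - ph k))]].
Proof.
have [r [psi [r0 p0 p2 [e2 e3]]]] := polar (h 0 2) (h 0 3).
exists r, psi; split=> //; first by rewrite p0.
move=> k; have u := uF k; have sp := fth_sin (F k).
have pos a b : 0 < ell (F k).1 a b := ell_gt0 _ _ _.
have lp : 0 < fell (F k) := ell_gt0 _ _ _.
exists (2 * ell (F k).1 (fv0 (F k)) (fv2 (F k)) * ell (F k).1 (fv1 (F k)) (fv2 (F k))
   / fell (F k) * sin (fth (F k)))^-1.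
exists (2 * ell (F k).1 (fv0 (F k)) (fv3 (F k)) * ell (F k).1 (fv1 (F k)) (fv3 (F k))
   / fell (F k) * sin (fth (F k)))^-1.
split; [by rewrite invr_gt0 !mulr_gt0 ?invr_gt0 | by rewrite invr_gt0 !mulr_gt0 ?invr_gt0 | |].
- by rewrite /ecoord fcoord2 // /fsec_s /sec_s e2 e3 mulrC psumS sinB; congr (_ * _); ring.
- by rewrite /ecoord fcoord3 // /fsec_r /sec_r e2 e3 mulrC sinB; congr (_ * _); ring.
Qed.

Let fth_gt0 k : 0 < fth (F k) := th_gt0 _ _ _.
Let fth_ltpi k : fth (F k) < pi := th_ltpi _ _ _.

(** The whole wedge between the two faces at the edge. It agrees with the tetrahedron where the
    coordinates at the ends of the edge are positive. *)
Definition in_sec k h := 0 <= ecoord k h 0 (fv2 (F k)) /\ 0 <= ecoord k h 0 (fv3 (F k)).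

Lemma in_tet_sec k h : in_tet k h -> in_sec k h.
Proof. by move=> H; split; apply: H. Qed.

Lemma in_sec_tet k h : in_sec k h -> 0 < ecoord k h 0 (fv0 (F k)) ->
  0 < ecoord k h 0 (fv1 (F k)) -> in_tet k h.
Proof.
move=> [h2 h3] h0 h1 i; have := ord4_cases i (uF k).
by case/or4P => /eqP -> //; exact: ltW.
Qed.

Lemma ecoord_cover h : exists2 k, (k < n)%N & in_sec k h.
Proof.
have [r [psi [r0 pr H]]] := ecoord_polar h.
have [k kn [s1 s2]] := sector_cover fth_ltpi angle_sum pr.
exists k => //; have [A [B [A0 B0 e2 e3]]] := H k.
by split; rewrite ?e2 ?e3 !mulr_ge0 // ltW.
Qed.

(** Radius 0 is the edge itself; off it, distinct sectors share at most a ray, which is the common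
    face of neighbours. *)
Lemma ecoord_overlap h k k' : (k < n)%N -> (k' < n)%N -> k <> k' -> in_sec k h ->
  in_sec k' h ->
  [\/ forall j, ecoord j h 0 (fv2 (F j)) = 0 /\ ecoord j h 0 (fv3 (F j)) = 0,
      follows k k' /\ ecoord k h 0 (fv2 (F k)) = 0 |
      follows k' k /\ ecoord k' h 0 (fv2 (F k')) = 0].
Proof.
move=> kn kn' kk hk hk'.
have [r [psi [r0 pr H]]] := ecoord_polar h.
have [e|rn] := eqVneq r 0.
  apply: Or31 => j; have [A [B [A0 B0 -> ->]]] := H j.
  by rewrite e !mul0r !mulr0.
have rp : 0 < r by rewrite lt_def rn.
have sec j : in_sec j h -> in_sector (fun k => fth (F k)) psi j.
  have [A [B [A0 B0 e2 e3]]] := H j.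
  by rewrite /in_sec e2 e3 !pmulr_rge0.
have main j j' : (j < j')%N -> (j' < n)%N -> in_sec j h -> in_sec j' h ->
    (follows j j' /\ ecoord j h 0 (fv2 (F j)) = 0) \/
    (follows j' j /\ ecoord j' h 0 (fv2 (F j')) = 0).
  move=> jj jn /sec s /sec s'.
  have [[-> e]|[-> e1 e]] := in_sector2 fth_gt0 fth_ltpi angle_sum pr jj jn s s'.
    left; split; first by left.
    by have [A [B [_ _ -> _]]] := H j; rewrite e subrr sin0 !mulr0.
  right; split; first by right.
  have [A [B [_ _ -> _]]] := H j'; rewrite e1 e subr0.
  by rewrite -[psum _ _]/(\sum_(k < n) fth (F k)) angle_sum mulr_natl sin2pi !mulr0.
case: (ltngtP k k') kk => // kk _.
  by have [] := main _ _ kk kn' hk hk'; [apply: Or32 | apply: Or33].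
by have [] := main _ _ kk kn hk' hk; [apply: Or33 | apply: Or32].
Qed.

Lemma ecoord_axis h : (forall j, ecoord j h 0 (fv2 (F j)) = 0 /\ ecoord j h 0 (fv3 (F j)) = 0) ->
  forall j, ecoord j h 0 (fv0 (F j)) = ecoord 0 h 0 (fv0 f0) /\
            ecoord j h 0 (fv1 (F j)) = ecoord 0 h 0 (fv1 f0).
Proof.
move=> H; elim=> [//|j [IH0 IH1]].
have [] := @ecoord_follows4 j j.+1 h (or_introl erefl) (H j).1.
by move=> -> -> _ _.
Qed.

Let o := dev f0 0 x0.

Lemma ho : hyp3 o.
Proof. by apply: dev_hyp3 => //; case: hx0. Qed.

Lemma ecoord0_o : ecoord 0 o = bary f0.1 x0.
Proof. by rewrite /ecoord psum0 fcoord_dev. Qed.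

Lemma epoint0_o : epoint 0 o = (f0.1, x0).
Proof. by rewrite /epoint psum0 devK. Qed.

Lemma in_tet0_o : in_tet 0 o.
Proof. by move=> i; rewrite ecoord0_o; case/hyp_tetP: hx0. Qed.

(** Any placement whose wedge contains [o] is reached from the first one across a face or along the
    edge, which keeps the coordinates at the two ends. *)
Lemma ecoord_o_pos k : (k < n)%N -> in_sec k o ->
  0 < ecoord k o 0 (fv0 (F k)) /\ 0 < ecoord k o 0 (fv1 (F k)).
Proof.
move=> kn hk; have [p0 p1] := x0_pos; rewrite -ecoord0_o in p0 p1.
have [->//|/eqP k0] := eqVneq k 0%N.
have [ax|[fo h2]|[fo h2]] := ecoord_overlap n_gt0 kn (nesym k0) (in_tet_sec in_tet0_o) hk.
- by have [-> ->] := ecoord_axis ax k.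
- by have [-> -> _ _] := ecoord_follows4 fo h2.
- by have [<- <- _ _] := ecoord_follows4 fo h2.
Qed.

(** Finitely many open conditions of two kinds: near [o] the wedges coincide with the tetrahedra,
    and [h] is nearer to [o] than half the distance between different copies of [o] in one
    tetrahedron. The second kind is there because a tetrahedron may occur several times around the
    edge. *)
Lemma chart_radius : exists2 r, 0 < r & forall h, hyp3 h -> hdist o h < r ->
  (forall k, (k < n)%N -> in_sec k h -> in_tet k h /\ in_tet k o /\
     (0 < ecoord k h 0 (fv0 (F k)) /\ 0 < ecoord k h 0 (fv1 (F k)))) /\
  (forall k k', (k < n)%N -> (k' < n)%N -> (F k).1 = (F k').1 -> in_tet k o ->
     in_tet k' o -> (epoint k o).2 <> (epoint k' o).2 ->
     2 * hdist o h < hdist (epoint k o).2 (epoint k' o).2).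
Proof.
have ho := ho.
pose P1 k h := in_sec k h -> in_tet k h /\ in_tet k o /\
     (0 < ecoord k h 0 (fv0 (F k)) /\ 0 < ecoord k h 0 (fv1 (F k))).
have N1 k : (k < n)%N -> hnear o (P1 k).
  move=> kn; have hl i : hlin (fun h => ecoord k h 0 i) by exact: fcoord_hlin.
  have [s2|s2] := ltP (ecoord k o 0 (fv2 (F k))) 0.
    apply: (hnearW (hnear_lt0 ho (hl _) s2)) => h _ h2 [h2' _].
    by move: h2'; rewrite leNgt h2.
  have [s3|s3] := ltP (ecoord k o 0 (fv3 (F k))) 0.
    apply: (hnearW (hnear_lt0 ho (hl _) s3)) => h _ h3 [_ h3'].
    by move: h3'; rewrite leNgt h3.
  have [p0 p1] := ecoord_o_pos kn (conj s2 s3).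
  apply: (hnearW (hnearI (hnear_gt0 ho (hl _) p0) (hnear_gt0 ho (hl _) p1))) => h _ [q0 q1] hk.
  by split; [exact: in_sec_tet | split=> //; apply: in_sec_tet].
pose P2 k k' h := (F k).1 = (F k').1 -> in_tet k o ->
     in_tet k' o -> (epoint k o).2 <> (epoint k' o).2 ->
     2 * hdist o h < hdist (epoint k o).2 (epoint k' o).2.
have N2 k : (k < n)%N -> hnear o (fun h => forall k', (k' < n)%N -> P2 k k' h).
  move=> kn; apply: hnear_all => k' kn'.
  have [[e1 e2 e3 e4]|ne] := pselect [/\ (F k).1 = (F k').1, in_tet k o, in_tet k' o &
     (epoint k o).2 <> (epoint k' o).2]; last first.
    by apply: hnear_true => h hh h1 h2 h3 h4; case: ne.
  have z1 := tet_point_hyp (epoint_tet ho e2); have z2 := tet_point_hyp (epoint_tet ho e3).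
  have d0 : 0 < hdist (epoint k o).2 (epoint k' o).2.
    rewrite lt_def hdist_ge0 // andbT; apply/eqP => e; apply: e4.
    exact: (hdist_eq0 z1 z2 e).
  exists (hdist (epoint k o).2 (epoint k' o).2 / 2); first by lra.
  by move=> h hh hr _ _ _ _; lra.
have [r r0 H] := hnearI (hnear_all N1) (hnear_all N2).
exists r => // h hh hr; have [H1 H2] := H h hh hr.
split; first exact: H1.
by move=> k k' kn kn'; apply: H2.
Qed.

(** A relation rather than a map, because a tetrahedron that occurs several times around the edge is
    developed to several places. *)
Definition edge_rel (y : X) (h : 'rV[R]_4) :=
  [/\ tet_point ideal_tet y, hyp3 h & exists2 k, (k < n)%N & y = epoint k h].

Lemma glued_axis h : hyp3 h -> (forall k, in_tet k h) ->
  (forall j, ecoord j h 0 (fv2 (F j)) = 0 /\ ecoord j h 0 (fv3 (F j)) = 0) ->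
  forall k, glued ideal_tet (epoint 0 h) (epoint k h).
Proof.
move=> hh hk ax; elim=> [|k IH]; first exact: rst_refl.
apply: rst_trans IH _; have fo : follows k k.+1 by left.
by case: (adjacent_via_step (epoint_follows hh (hk k) fo (ax k).1)) => st;
  [exact: rst_step | exact/rst_sym/rst_step].
Qed.

Lemma glued_follows h k k' : hyp3 h -> in_tet k h -> follows k k' ->
  ecoord k h 0 (fv2 (F k)) = 0 -> glued ideal_tet (epoint k h) (epoint k' h).
Proof.
move=> hh hk fo h2.
by case: (adjacent_via_step (epoint_follows hh hk fo h2)) => st;
  [exact: rst_step | exact/rst_sym/rst_step].
Qed.

Lemma follows_pred k : (k < n)%N -> exists2 k', (k' < n)%N & follows k' k.
Proof.
case: k => [_|k kn]; last by exists k; [exact: ltnW | left].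
by exists n.-1; [rewrite ltn_predL | right; rewrite prednK].
Qed.

Lemma follows_succ k : (k < n)%N -> exists2 k', (k' < n)%N & follows k k'.
Proof.
rewrite leq_eqVlt => /orP[/eqP kn|kn]; first by exists 0; [| right].
by exists k.+1; [| left].
Qed.

(** The coordinates at the ends of the edge are positive, so the face that is crossed contains the
    edge and leads to the next or the previous placement. *)
Lemma edge_step y z h k l : (k < n)%N -> y = epoint k h -> hyp3 h -> in_tet k h ->
  0 < ecoord k h 0 (fv0 (F k)) -> 0 < ecoord k h 0 (fv1 (F k)) ->
  adjacent_via l y z -> edge_rel z h.
Proof.
move=> kn ey hh hk p0 p1 H; have u := uF k.
have [_ hz] : tet_point ideal_tet y /\ tet_point ideal_tet z.
  by case: (adjacent_via_step H) => /face_step_point[].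
split=> //.
have yl : ecoord k h 0 l = 0 by case: H => _ _ + _; rewrite ey bary_undev.
have : (l == fv2 (F k)) || (l == fv3 (F k)).
  have := ord4_cases l u; case/or4P => /eqP e; move: p0 p1; rewrite e ?eqxx ?orbT // -e yl ltxx //.
case/orP => /eqP el; subst l.
  have [k' kn' fo] := follows_succ kn; exists k' => //.
  have [e1 e2] := followsP fo.
  have ez : z.1 = (nextf (F k)).1 by case: H => _ -> _ _; rewrite ey.
  have H2 : adjacent_via (fv2 (F k)) (epoint k h) ((nextf (F k)).1, z.2).
    by rewrite -ez -surjective_pairing -ey.
  rewrite [LHS]surjective_pairing; apply/esym/epoint_eq; first by rewrite ez e1.
  by rewrite /dev e2 e1 -/(dev (nextf (F k)) _ _) (dev_next (ph k) u H2) undevK.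
have [k' kn' fo] := follows_pred kn; exists k' => //.
have [e1 e2] := followsP fo.
have H' := adjacent_via_sym H; case: H => _ ez _ Hz.
have [K1 K2] := glueK (F k').1 (fv2 (F k')).
have ez' : z.1 = (F k').1 by rewrite ez ey /= e1 /= K1.
have eg : (glue y.1 (fv3 (F k))).2 (fv3 (F k)) = fv2 (F k') by rewrite ey /= e1 /= K2.
rewrite eg in H'.
have H2 : adjacent_via (fv2 (F k')) ((F k').1, z.2) ((nextf (F k')).1, undev (F k) (ph k) h).
  by rewrite -ez' -surjective_pairing -e1 -[((F k).1, _)]/(epoint k h) -ey.
rewrite [LHS]surjective_pairing; apply/esym/epoint_eq => //.
by rewrite -(dev_next (ph k') (uF k') H2) /dev -e2 -e1 -/(dev (F k) _ _) undevK.
Qed.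

Lemma double_lt_absurd (a b d : R) : 2 * a < d -> 2 * b < d -> d <= a + b -> False.
Proof. lra. Qed.

Lemma edge_chart : exists p C r, chart ideal_tet (f0.1, x0) p C r.
Proof.
have [r r0 Hr] := chart_radius.
exists o, edge_rel, r; have ho := ho.
have near_tet k h : hyp3 h -> hdist o h < r -> (k < n)%N -> in_sec k h -> in_tet k h.
  by move=> hh hr kn /((Hr h hh hr).1 k kn)[].
have near_rel y h : edge_rel y h -> hdist o h < r -> exists k,
    [/\ (k < n)%N, y = epoint k h, in_tet k h, in_tet k o &
      (0 < ecoord k h 0 (fv0 (F k)) /\ 0 < ecoord k h 0 (fv1 (F k)))].
  move=> [hy hh [k kn ey]] hr; exists k.
  have hk : in_tet k h by apply: epoint_in_tet; rewrite -ey.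
  by have [_ [? ?]] := (Hr h hh hr).1 k kn (in_tet_sec hk).
have glu y y' h : edge_rel y h -> edge_rel y' h -> hdist o h < r -> glued ideal_tet y y'.
  move=> H H' hr; have [_ hh _] := H.
  have [k [kn -> hk _ _]] := near_rel y h H hr.
  have [k' [kn' -> hk' _ _]] := near_rel y' h H' hr.
  have [->|/eqP kk] := eqVneq k k'; first exact: rst_refl.
  have [ax|[fo h2]|[fo h2]] := ecoord_overlap kn kn' kk (in_tet_sec hk) (in_tet_sec hk').
  - have hj j : in_tet j h.
      have [a0 a1] := ecoord_axis ax j; have [b0 b1] := ecoord_axis ax k.
      have [c2 c3] := ax j.
      move=> i; have := ord4_cases i (uF j); case/or4P => /eqP ->; rewrite ?c2 ?c3 //.
        by rewrite a0 -b0; apply: hk.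
      by rewrite a1 -b1; apply: hk.
    apply: rst_trans (glued_axis hh hj ax k'); apply: rst_sym.
    exact: (glued_axis hh hj ax k).
  - exact: glued_follows.
  - by apply: rst_sym; exact: glued_follows.
split=> //.
- split=> //; exists 0 => //; by rewrite epoint0_o.
- by move=> y h [].
- move=> y z h H hr st; have [_ hh _] := H.
  have [k [kn ey hk _ [p0 p1]]] := near_rel y h H hr.
  have [l hl] := face_step_adjacentE st; exact: (edge_step kn ey hh hk p0 p1 hl).
- move=> t y z h [hy hh [k kn [et ey]]] hz.
  exists (dev (F k) (ph k) z); last first.
    by rewrite -(undevK (ph k) h (uF k)) -ey hdist_dev //; exact: uF.
  split=> //; first by apply: dev_hyp3; [exact: uF | case: hz].
  by exists k => //; apply/esym/epoint_eq.
- move=> h hh hr; have [k kn hk] := ecoord_cover h.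
  have hk' := near_tet k h hh hr kn hk.
  by exists (epoint k h); split=> //; [exact: epoint_tet | exists k].
(* Segments: the geodesic has length below r/2 and starts within r/4 of [o], so it stays in the
   chart and can be cut along the placed tetrahedra, which are closed. *)
- move=> y y' h h' Hy Hy' hr hr'; have [_ hh _] := Hy; have [_ hh' _] := Hy'.
  have [w [g0 gL gd]] := geodesic hh hh'.
  pose g s := cosh s *: h + sinh s *: w.
  have L0 := hdist_ge0 hh hh'.
  have Lr : hdist h h' < r / 2.
    by have := hdist_triangle hh ho hh'; rewrite (hdistC h o); lra.
  have gh s : 0 <= s <= hdist h h' -> hyp3 (g s) by case/andP => a b; case: (gd s s a (lexx _) b).
  have go s : 0 <= s <= hdist h h' -> hdist o (g s) < r.
    move=> hs; have [a b] := andP hs; have [_ e] := gd 0 s (lexx _) a b.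
    have := hdist_triangle ho hh (gh s hs); rewrite -{2}g0 e; lra.
  have gdist s t : 0 <= s <= hdist h h' -> 0 <= t <= hdist h h' -> hdist (g s) (g t) = `|s - t|.
    move=> hs ht; have [a b] := andP hs; have [c d] := andP ht.
    have [st|ts] := leP s t; first by have [_ ->] := gd s t a st d; rewrite distrC ger0_norm ?subr_ge0.
    by rewrite hdistC; have [_ ->] := gd t s c (ltW ts) b; rewrite ger0_norm ?subr_ge0 // ltW.
  pose rng s := 0 <= s <= hdist h h'.
  pose Q s t := [/\ rng s, rng t & forall z z', edge_rel z (g s) -> edge_rel z' (g t) ->
    reach ideal_tet z z' (t - s)].
  have cov s : rng s -> exists2 k, (k < n)%N & in_tet k (g s).
    move=> hs; have [k kn hk] := ecoord_cover (g s); exists k => //.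
    by apply: near_tet => //; [exact: gh | exact: go].
  suff [_ _ H] : Q 0 (hdist h h') by rewrite -[hdist h h']subr0; apply: H; rewrite /g ?g0 ?gL.
  apply: (@closed_cover_chain R (hdist h h') n (fun k s => rng s /\ in_tet k (g s)) Q L0).
  + move=> k t kn ht nt; have [i hi] : exists i, ecoord k (g t) 0 i < 0.
      apply: contrapT => H; apply: nt; split=> // i; rewrite leNgt; apply/negP => hi.
      by apply: H; exists i.
    have [e e0 He] := hnear_lt0 (gh t ht) (fcoord_hlin (F k) (ph k) i) hi.
    exists e => // s hs st [_ /(_ i)]; rewrite leNgt => /negP; apply.
    by apply: He; [exact: gh | rewrite gdist // distrC].
  + by move=> s hs; have [k kn hk] := cov s hs; exists k.
  + move=> k s t kn s0 st tL [hs ks] [ht kt]; split=> // z z' Hz Hz'.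
    have P1 : edge_rel (epoint k (g s)) (g s).
      by split; [exact: epoint_tet (gh s hs) ks | exact: gh | exists k].
    have P2 : edge_rel (epoint k (g t)) (g t).
      by split; [exact: epoint_tet (gh t ht) kt | exact: gh | exists k].
    apply/(glued_reach _ _ (glu _ _ _ Hz' P2 (go t ht))); apply: reach_sym.
    apply/(glued_reach _ _ (glu _ _ _ Hz P1 (go s hs))); apply: reach_sym.
    have <- : hdist (epoint k (g s)).2 (epoint k (g t)).2 = t - s.
      by rewrite hdist_epoint gdist // distrC ger0_norm // subr_ge0.
    by apply: reach_move1; [exact: epoint_tet (gh s hs) ks | exact: epoint_tet (gh t ht) kt].
  + move=> s t u [hs ht H1] [_ hu H2]; split=> // z z' Hz Hz'.
    have [k kn hk] := cov t ht.
    have P : edge_rel (epoint k (g t)) (g t).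
      by split; [exact: epoint_tet (gh t ht) hk | exact: gh | exists k].
    have -> : u - s = (t - s) + (u - t) by ring.
    exact: reach_trans (H1 _ _ Hz P) (H2 _ _ P Hz').
(* Injectivity: the case to exclude is that [y] is developed through two different placements of its
   tetrahedron. *)
- move=> y h h' Hy Hy' hr hr'; have [_ hh _] := Hy; have [_ hh' _] := Hy'.
  have [k [kn ey hk hko [p0 p1]]] := near_rel y h Hy hr.
  have [k' [kn' ey' hk' hko' [p0' p1']]] := near_rel y h' Hy' hr'.
  have [e|/eqP kk] := eqVneq k k'.
    subst k'; rewrite -(undevK (ph k) h (uF k)) -(undevK (ph k) h' (uF k)).
    by move: ey'; rewrite ey /epoint => -[->].
  exfalso.
  have et : (F k).1 = (F k').1 by move: ey'; rewrite ey /epoint => -[].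
  (* Different copies of [o] in this tetrahedron are at most as far apart as the sum of the
     distances from [o] to [h] and to [h'], which the radius forbids. *)
  have [eo|ne] := pselect ((epoint k o).2 = (epoint k' o).2); last first.
    have r1 := (Hr h hh hr).2 k k' kn kn' et hko hko' ne.
    have r2 := (Hr h' hh' hr').2 k k' kn kn' et hko hko' ne.
    have d1 := hdist_epoint k o h; have d2 := hdist_epoint k' o h'.
    rewrite -ey in d1; rewrite -ey' in d2.
    have [hy _ _] := Hy.
    have := hdist_triangle (tet_point_hyp (epoint_tet ho hko)) (tet_point_hyp hy)
      (tet_point_hyp (epoint_tet ho hko')).
    rewrite (hdistC y.2) d1 d2; move: r1 r2.
    exact: double_lt_absurd.
  have eb i : ecoord k o 0 i = ecoord k' o 0 i.
    have := bary_undev (F k) (ph k) o; have := bary_undev (F k') (ph k') o.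
    by rewrite -et -[undev (F k') _ _]/(epoint k' o).2 -eo => -> e; rewrite /ecoord -e.
  (* If [o] lies on the edge, its positive coordinates determine the ends of the edge in both
     placements, against [edge_inj]. *)
  have axis j j' : (j < n)%N -> (j' < n)%N -> (F j).1 = (F j').1 -> j <> j' ->
      in_tet j' o -> (forall i, ecoord j o 0 i = ecoord j' o 0 i) ->
      ecoord j o 0 (fv2 (F j)) = 0 -> ecoord j o 0 (fv3 (F j)) = 0 -> False.
    move=> jn jn' ej jj hj' E a2 a3; apply: jj.
    have [q0' q1'] := ecoord_o_pos jn' (in_tet_sec hj').
    have H i : 0 < ecoord j' o 0 i -> i \in [:: fv0 (F j); fv1 (F j)].
      rewrite -E; have := ord4_cases i (uF j); case/or4P => /eqP ->; rewrite !inE ?eqxx ?orbT //.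
        by rewrite a2 ltxx.
      by rewrite a3 ltxx.
    by apply: edge_inj => //; apply: H.
  (* If [o] lies on a face between consecutive placements, [glue_nofix] keeps the two labels
     opposite to this face apart, so a second coordinate vanishes and [o] is on the edge. *)
  have main j j' : (j < n)%N -> (j' < n)%N -> (F j).1 = (F j').1 -> j <> j' ->
      in_tet j o -> in_tet j' o -> (forall i, ecoord j o 0 i = ecoord j' o 0 i) ->
      follows j j' -> ecoord j o 0 (fv2 (F j)) = 0 -> False.
    move=> jn jn' ej jj hj hj' E fo h2.
    have [q0 q1] := ecoord_o_pos jn (in_tet_sec hj).
    have [_ _ _ b3] := ecoord_follows4 fo h2; have [e1 _] := followsP fo.
    have ne : fv3 (F j') != fv2 (F j).
      rewrite e1; apply: glue_nofix; rewrite -[LHS]/((nextf (F j)).1) -e1; exact/esym.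
    rewrite -E in b3; have := ord4_cases (fv3 (F j')) (uF j); case/or4P => /eqP e.
    - by move: q0; rewrite -e b3 ltxx.
    - by move: q1; rewrite -e b3 ltxx.
    - by rewrite e eqxx in ne.
    - by apply: (axis j j') => //; rewrite -e.
  have [ax|[fo h2]|[fo h2]] := ecoord_overlap kn kn' kk (in_tet_sec hko) (in_tet_sec hko').
  + by have [a2 a3] := ax k; apply: (axis k k').
  + exact: (main k k').
  + by apply: (main k' k) => // e; apply: kk.
(* Placements without [o] get the given point as a filler. *)
- exists n, (fun k => if `[< in_tet k o >] then epoint k o else (f0.1, x0)); split.
    move=> k kn; case: asboolP => [hk|_]; last by split=> //; exact: rst_refl.
    split; first exact: epoint_tet.
    apply: (glu _ _ o); last by rewrite hdistxx.
      by split=> //; exists 0 => //; rewrite epoint0_o.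
    by split=> //; [exact: epoint_tet | exists k].
  move=> y h Hy hr; have [k [kn ey hk hko _]] := near_rel y h Hy hr.
  exists k; case: asboolP => // _; split=> //; first by rewrite ey.
  by rewrite ey hdist_epoint.
Qed.

End EdgeChart.

(** * Completeness and connectedness *)

Lemma lorentz_bary t x : lorentz x x =
  \sum_i \sum_j bary t x 0 i * bary t x 0 j * (if i == j then 0 else - 2 * ell t i j ^+ 2).
Proof.
rewrite -{1 2}(baryK t x) lorentz_sum; apply: eq_bigr => i _; apply: eq_bigr => j _.
by rewrite fmx_gram.
Qed.

(** Otherwise all products of distinct coordinates vanish and the point is null. Hence every point
    is in the open star of an edge. *)
Lemma two_positive t x : hyp_tet (ideal_tet t) x -> exists i j,
  [/\ i != j, 0 < bary t x 0 i & 0 < bary t x 0 j].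
Proof.
move=> /hyp_tetP[[e _] b0]; apply: contrapT => H.
suff : lorentz x x = 0 by rewrite e => /eqP; rewrite oppr_eq0 oner_eq0.
rewrite (lorentz_bary t) big1 // => i _; rewrite big1 // => j _.
have [->|ij] := eqVneq i j; first by rewrite mulr0.
have [bi|bi] := eqVneq (bary t x 0 i) 0; first by rewrite bi !mul0r.
have [bj|bj] := eqVneq (bary t x 0 j) 0; first by rewrite bj mulr0 mul0r.
by case: H; exists i, j; rewrite !lt_def !b0 !andbT.
Qed.

Definition weight (a : X) : R := \sum_i bary a.1 a.2 0 i.

Lemma weight_step a b : face_step ideal_tet a b -> weight a = weight b.
Proof.
move=> /face_step_adjacent[l [_ eb al H]]; rewrite /weight.
by rewrite [RHS](reindex_inj (@glue_inj a.1 l)); apply: eq_bigr => i _.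
Qed.

Lemma weight_hlin t : hlin (fun x => weight (t, x)).
Proof.
have : hlin (fun x => bary t x 0 0 + bary t x 0 1 + bary t x 0 2 + bary t x 0 3).
  by do 3! [apply: hlinD; last exact: fcoord_hlin]; exact: fcoord_hlin.
by move=> [w H]; exists w => x; rewrite -H /weight (big_ord4 _ (funiq0 t)).
Qed.

(** 1 = -<x,x> is a quadratic form in the nonnegative barycentric coordinates, hence at most a
    constant times the square of their sum. *)
Lemma weight_lb t : exists2 s, 0 < s & forall x, hyp_tet (ideal_tet t) x -> s <= weight (t, x).
Proof.
pose E := 1 + \sum_i \sum_j 2 * ell t i j ^+ 2.
have p2 i j : 0 <= 2 * ell t i j ^+ 2 by rewrite mulr_ge0 // sqr_ge0.
have E0 : 0 < E by rewrite ltr_pwDl // sumr_ge0 // => i _; rewrite sumr_ge0.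
have EE i j : 2 * ell t i j ^+ 2 <= E.
  rewrite /E (bigD1 i) //= (bigD1 j) //=.
  have : 0 <= \sum_(i0 | i0 != j) 2 * ell t i i0 ^+ 2 by rewrite sumr_ge0.
  have : 0 <= \sum_(i0 | i0 != i) \sum_j0 2 * ell t i0 j0 ^+ 2.
    by rewrite sumr_ge0 // => i0 _; rewrite sumr_ge0.
  by lra.
exists (Num.sqrt E^-1); first by rewrite sqrtr_gt0 invr_gt0.
move=> x /hyp_tetP[[e _] b0].
have w0 : 0 <= weight (t, x) by rewrite sumr_ge0.
rewrite -[X in _ <= X]ger0_norm // -sqrtr_sqr; apply: ler_wsqrtr.
rewrite -[X in X <= _]mul1r ler_pdivrMr //.
have l1 : 1 = - lorentz x x by rewrite e opprK.
rewrite l1 (lorentz_bary t) -sumrN expr2 /weight mulr_suml mulr_suml.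
apply: ler_sum => i _; rewrite mulr_sumr mulr_suml -sumrN; apply: ler_sum => j _.
have bb : 0 <= bary t x 0 i * bary t x 0 j by rewrite mulr_ge0.
rewrite /=; case: eqP => _; first by rewrite mulr0 oppr0 mulr_ge0 // ltW.
by rewrite -mulrN ler_wpM2l // mulNr opprK.
Qed.

Lemma weight_growth : exists K : nat, forall t x y, hyp_tet (ideal_tet t) x ->
  hyp_tet (ideal_tet t) y -> weight (t, y) <= expR (K%:R * hdist x y) * weight (t, x).
Proof.
have H t : exists K : nat, forall x y, hyp_tet (ideal_tet t) x ->
    hyp_tet (ideal_tet t) y -> weight (t, y) <= expR (K%:R * hdist x y) * weight (t, x).
  have [s s0 Hs] := weight_lb t; have [K HK] := hlin_growth (weight_hlin t) s0.
  by exists K => x y hx hy; apply: HK; [case: hx|case: hy|exact: Hs].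
have [K HK] := choice H.
exists (\sum_t K t)%N => t x y hx hy; apply: le_trans (HK t x y hx hy) _.
have w0 : 0 <= weight (t, x) by have [s s0 /(_ x hx)] := weight_lb t; lra.
rewrite ler_wpM2r // ler_expR ler_wpM2r ?hdist_ge0 //; [by case: hx|by case: hy|].
by rewrite ler_nat (bigD1 t) //= leq_addr.
Qed.

(** Nonnegative coordinates with bounded sum are bounded. The closed condition 0 <= x_0 may replace
    the strict one, as <x,x> = -1 excludes x_0 = 0. *)
Lemma weight_compact t (r : R) :
  compact [set x | hyp_tet (ideal_tet t) x /\ weight (t, x) <= r].
Proof.
have lcont (l : 'rV[R]_4 -> R) : hlin l -> continuous l.
  move=> [w lw] x; have C i : (fun y : 'rV[R]_4 => y 0 i * w 0 i) @ x --> x 0 i * w 0 i.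
    by exact: (cvgM (@coord_continuous R 1 4 0 i x) (cvg_cst _)).
  have -> : l = (fun x => - (x 0 0 * w 0 0) + (x 0 1 * w 0 1 + x 0 2 * w 0 2 + x 0 3 * w 0 3)).
    by apply/funext => y; rewrite lw lorentzE.
  exact: (cvgD (cvgN (C 0)) (cvgD (cvgD (C 1) (C 2)) (C 3))).
have qcont : continuous (fun x : 'rV[R]_4 => lorentz x x).
  move=> x; have C i : (fun y : 'rV[R]_4 => y 0 i * y 0 i) @ x --> x 0 i * x 0 i.
    by exact: (cvgM (@coord_continuous R 1 4 0 i x) (@coord_continuous R 1 4 0 i x)).
  have -> : (fun x : 'rV[R]_4 => lorentz x x) = (fun x => - (x 0 0 * x 0 0) +
      (x 0 1 * x 0 1 + x 0 2 * x 0 2 + x 0 3 * x 0 3)).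
    by apply/funext => y; rewrite lorentzE.
  exact: (cvgD (cvgN (C 0)) (cvgD (cvgD (C 1) (C 2)) (C 3))).
have -> : [set x | hyp_tet (ideal_tet t) x /\ weight (t, x) <= r] =
  [set x | lorentz x x = -1] `&` [set x : 'rV[R]_4 | 0 <= x 0 0] `&`
  \bigcap_i [set x | 0 <= bary t x 0 i] `&` [set x | weight (t, x) <= r].
  apply/seteqP; split=> x /=.
    by move=> [/hyp_tetP[[e x0] b0] wr]; split=> //; split; [split=> //; exact: ltW | move=> i _; exact: b0].
  move=> [[[e x0] b0] wr]; split=> //; apply/hyp_tetP; split; last by move=> i; exact: b0.
  split=> //; rewrite lt_def x0 andbT; apply/eqP => x00; move: e.
  rewrite lorentzE x00; have := sqr_ge0 (x 0 1); have := sqr_ge0 (x 0 2).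
  by have := sqr_ge0 (x 0 3); rewrite !expr2; lra.
apply: bounded_closed_compact.
  pose B := \sum_i \sum_j `|ideal_tet t i j|.
  exists (`|r| * B); split; first by rewrite num_real.
  move=> M rM x /= [[[e x0] b0] wr]; apply: le_trans (ltW rM).
  have w0 : 0 <= weight (t, x) by rewrite sumr_ge0 // => i _; exact: b0.
  have B0 : 0 <= B by rewrite sumr_ge0 // => i _; rewrite sumr_ge0.
  change (mx_norm x <= `|r| * B); rewrite mx_normrE; apply: bigmax_le => [|[i c] _ /=].
    by rewrite mulr_ge0.
  rewrite -[x](baryK t) mxE; apply: le_trans (ler_norm_sum _ _ _) _.
  rewrite mulr_sumr; apply: ler_sum => j _; rewrite normrM.
  have bj : bary t x i j <= `|r|.
    apply: le_trans (ler_norm r); apply: le_trans wr.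
    rewrite /weight (bigD1 j) //= (ord1 i) lerDl sumr_ge0 // => k _; exact: b0.
  rewrite (ord1 i) in bj *; rewrite ger0_norm; last exact: b0.
  apply: ler_pM => //; first exact: b0.
  by rewrite (bigD1 c) //= lerDl sumr_ge0.
have cl (l : 'rV[R]_4 -> R) (D : set R) : continuous l -> closed D -> closed (l @^-1` D).
  by move=> lc Dc; apply: preimage_closed => //; exact: Dc.
apply: closedI; first apply: closedI; first apply: closedI.
- exact: (cl _ [set y : R | y = -1] qcont (@closed_eq _ _)).
- exact: (cl _ [set y : R | 0 <= y] (@coord_continuous R 1 4 0 0) (@closed_ge _ _)).
- apply: closed_bigI => i _.
  exact: (cl _ [set y : R | 0 <= y] (lcont _ (fcoord_hlin _ _ i)) (@closed_ge _ _)).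
- exact: (cl _ [set y : R | y <= r] (lcont _ (weight_hlin t)) (@closed_le _ _)).
Qed.

Lemma bary_face_exists t l x : hyp_tet (ideal_tet t) x -> bary t x 0 l = 0 ->
  exists y, adjacent_via l (t, x) ((glue t l).1, y).
Proof.
move=> hx xl.
have [i [j [k u]]] : exists i j k, uniq [:: i; j; l; k].
  have [i [j [k [u _]]]] := pairing_glue t l; exists i, j, k.
  by rewrite -(perm_uniq (_ : perm_eq [:: i; j; k; l] _)) //; apply/permP => P /=; lia.
have uf : funiq (t, (i, j, l, k)) by [].
have := @adjacent_next (t, (i, j, l, k)) 0 (dev (t, (i, j, l, k)) 0 x) uf.
rewrite fcoord_dev // devK // => H; eexists; apply: H => //.
  by apply: dev_hyp3 => //; case: hx.
by move=> i'; case/hyp_tetP: hx.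
Qed.

(** The sum of the three vertices of the face is time-like; it is rescaled to the hyperboloid. *)
Lemma face_point t l : exists2 x, hyp_tet (ideal_tet t) x & bary t x 0 l = 0.
Proof.
have [i0 [j0 [k0 [u _]]]] := pairing_glue t l.
have [[n1 n2 n3] [n4 n5 n6]] := @funiq_neq (t, (i0, j0, k0, l)) u.
rewrite /fv0 /fv1 /fv2 /fv3 /= in n1 n2 n3 n4 n5 n6.
pose b0 : 'rV[R]_4 := \row_i (i != l)%:R.
pose y := b0 *m ideal_tet t.
have by0 : bary t y = b0 by rewrite mulK_bary.
have yp : 0 < y 0 0.
  rewrite /y mulmx_sum_row summxE (bigD1 i0) //= ltr_pwDl //.
    by rewrite mxE [b0 0 i0]mxE n3 mul1r; have [_] := row_fmx_light 0 i0 (funiq0 t).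
  rewrite sumr_ge0 // => i _; rewrite mxE [b0 0 i]mxE mulr_ge0 ?ler0n // ltW //.
  by have [_] := row_fmx_light 0 i (funiq0 t).
have N0 : 0 < - lorentz y y.
  rewrite (lorentz_bary t) by0 -sumrN (bigD1 i0) //= ltr_pwDl //.
    rewrite -sumrN (bigD1 j0) //= ltr_pwDl //.
      by rewrite !mxE n3 n5 (negbTE n1) !mul1r mulNr opprK mulr_gt0 // exprn_gt0.
    rewrite sumr_ge0 // => j _; rewrite !mxE; case: ifP => _; first by rewrite mulr0 oppr0.
    by rewrite mulNr mulrN opprK !mulr_ge0 ?ler0n // ltW.
  rewrite sumr_ge0 // => i _; rewrite -sumrN sumr_ge0 // => j _; rewrite !mxE.
  case: ifP => _; first by rewrite mulr0 oppr0.
  by rewrite mulNr mulrN opprK !mulr_ge0 ?ler0n // ltW.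
pose s := (Num.sqrt (- lorentz y y))^-1.
have s0 : 0 < s by rewrite invr_gt0 sqrtr_gt0.
have s2 : s ^+ 2 * - lorentz y y = 1.
  by rewrite exprVn sqr_sqrtr ?ltW // mulVf // gt_eqF.
have bsy : bary t (s *: y) = s *: b0 by rewrite /y scalemxAl mulK_bary.
exists (s *: y); last by rewrite bsy !mxE eqxx mulr0.
apply/hyp_tetP; split; last by move=> i; rewrite bsy !mxE mulr_ge0 ?ler0n // ltW.
split; last by rewrite mxE mulr_gt0.
by rewrite !lorentz_lin mulrA -expr2; apply: oppr_inj; rewrite -mulrN s2 opprK.
Qed.

(** Connectedness as an induction principle over the tetrahedra. *)
Hypothesis tets_connected : exists t0, forall P : tet T -> Prop, P t0 ->
  (forall t l, P t -> P (glue t l).1) -> forall t, P t.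

Lemma reach_connected a b : tet_point ideal_tet a -> tet_point ideal_tet b ->
  exists r, reach ideal_tet a b r.
Proof.
have [t0 Ht0] := tets_connected; have [x0 hx0 _] := face_point t0 0.
have H : forall t x, hyp_tet (ideal_tet t) x -> exists r, reach ideal_tet (t0, x0) (t, x) r.
  apply: Ht0 => [x hx|t l IH x hx]; first by eexists; apply: reach_move1.
  have [y hy yl] := face_point t l; have [z yz] := bary_face_exists hy yl.
  have [r Hr] := IH y hy.
  exists (r + hdist z x); apply: reach_move => //; apply: reach_step Hr _.
  exact: adjacent_via_step yz.
case: a b => [t x] [t' x'] /H[r /reach_sym hr] /H[r' hr'].
by exists (r + r'); apply: reach_trans hr hr'.
Qed.

Hypothesis edge_cycles : forall t i j, i != j -> exists f n,
  [/\ funiq f, f.1 = t, (fv0 f = i /\ fv1 f = j) \/ (fv0 f = j /\ fv1 f = i) &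
   [/\ (0 < n)%N, iter n nextf f = f, \sum_(k < n) fth (iter k nextf f) = 2 * pi &
    forall k k', (k < n)%N -> (k' < n)%N -> (iter k nextf f).1 = (iter k' nextf f).1 ->
     fv0 (iter k' nextf f) \in [:: fv0 (iter k nextf f); fv1 (iter k nextf f)] ->
     fv1 (iter k' nextf f) \in [:: fv0 (iter k nextf f); fv1 (iter k nextf f)] -> k = k']].

Lemma tet_charts a : tet_point ideal_tet a -> exists p C r, chart ideal_tet a p C r.
Proof.
case: a => t x hx; have [i [j [ij bi bj]]] := two_positive hx.
have [f [n [u ft fij [n0 Fn Fs Fi]]]] := edge_cycles t ij; subst t.
have [] := @edge_chart f x n u hx _ n0 Fn Fs Fi; last by move=> p [C [r H]]; exists p, C, r.
by case: fij => -[-> ->].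
Qed.

(** The geometric criterion: what remains is to supply lengths, angles, a gluing map and closed edge
    cycles. *)
Theorem geometric_of_edge_cycles : geometric_triangulation R T.
Proof.
have [t0 _] := tets_connected; have [x0 hx0 _] := face_point t0 0.
have ha0 : tet_point ideal_tet (t0, x0) by [].
have [K HK] := weight_growth.
exists ideal_tet, (gspace reach_connected tet_charts), (gproj reach_connected tet_charts ha0).
split.
- exact: ideal_tet_pos.
- exact: (gspace_hyperbolic ha0).
- apply: (gspace_complete ha0 weight_step HK) => t r; exact: weight_compact.
- exact: (gspace_obtained _ _ ha0).
Qed.

End Decorated.

(** * The log-sine integral *)

Section LogSine.
Variable R : realType.
Notation mu := (@lebesgue_measure R).

Lemma sinc_near0 (e : R) : 0 < e -> exists2 d, 0 < d & forall x : R, x != 0 -> `|x| < d ->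
  `|sin x / x - 1| < e.
Proof.
move=> e0; have := ex_derive (is_derive := is_derive_sin (0 : R)).
have := derive_val (is_derive := is_derive_sin (0 : R)).
rewrite /derive cos0 => lim_eq cv.
have /cvgrPdist_lt/(_ e e0) : ((fun h : R => h^-1 *: ((sin \o shift 0) (h *: 1) - sin 0)) @ 0^') --> (1 : R).
  by move: (cv); rewrite /derivable => cv'; rewrite -[X in _ --> X]lim_eq; exact: cv'.
rewrite near_withinE => /nbhs_ballP[d /= d0 H]; exists d => // x x0 xd.
have /H/(_ x0) : ball (0 : R) d x by rewrite /ball /= sub0r normrN.
by rewrite /= sin0 subr0 addr0 /GRing.scale /= mulr1 distrC mulrC.
Qed.

Definition tcot (t : R) := if t == 0 then 1 else t * cos t / sin t.

Lemma sin_neq0 (x : R) : - pi < x -> x < pi -> x != 0 -> sin x != 0.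
Proof.
move=> x1 x2 xn; case: (ltrgt0P x) xn => // x0 _.
  by rewrite gt_eqF // sin_gt0_pi // x0.
have : 0 < sin (- x) by apply: sin_gt0_pi; lra.
by rewrite sinN oppr_gt0 => /lt_eqF ->.
Qed.

Lemma tcot_continuous (x : R) : - pi < x -> x < pi -> {for x, continuous tcot}.
Proof.
move=> x1 x2; have [->|xn] := eqVneq x 0.
  apply/cvgrPdist_lt => /= e e0; rewrite /tcot eqxx.
  pose e1 := Num.min (1 / 2) (e / 4).
  have e10 : 0 < e1 by rewrite lt_min; apply/andP; split; lra.
  have e1h : e1 <= 1 / 2 by rewrite ge_min lexx.
  have e1e : e1 <= e / 4 by rewrite ge_min lexx orbT.
  have [d d0 Hd] := sinc_near0 e10.
  have := @continuous_cos R 0; move=> /cvgrPdist_lt/(_ (e / 4)).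
  rewrite cos0 => /(_ ltac:(lra)); rewrite near_simpl => Hc.
  near=> t; case: eqP => [//|/eqP tn]; first by rewrite subrr normr0.
  have td : `|t| < d by near: t; apply/nbhs_ballP; exists d => //= y; rewrite /ball /= sub0r normrN.
  have c1 : `|1 - cos t| < e / 4 by near: t.
  have s1 := Hd t tn td; pose s := sin t / t; rewrite -/s in s1.
  have s2 : 1 / 2 < s by move: s1; rewrite ltr_norml; lra.
  have -> : t * cos t / sin t = cos t / s.
    by rewrite /s invf_div mulrA [cos t * t]mulrC.
  have -> : 1 - cos t / s = ((s - 1) + (1 - cos t)) / s.
    by field; rewrite gt_eqF //; lra.
  rewrite normrM normfV (gtr0_norm (_ : 0 < s)); last lra.
  rewrite ltr_pdivrMr; last lra.
  apply: le_lt_trans (ler_normD _ _) _.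
  have : e / 2 < e * s by rewrite -(ltr_pM2l e0) in s2; lra.
  lra.
have sn := sin_neq0 x1 x2 xn.
have H : (fun t => t * cos t / sin t) @ x --> x * cos x / sin x.
  apply: cvgM; first by apply: cvgM; [exact: cvg_id | exact: continuous_cos].
  by apply: cvgV => //; exact: continuous_sin.
have tx : tcot x = x * cos x / sin x by rewrite /tcot (negbTE xn).
change (tcot @ x --> tcot x); rewrite tx.
apply: cvg_trans H; apply: near_eq_cvg.
near=> t; rewrite /tcot ifN //; near: t.
exact: open_neq.
Unshelve. all: by end_near.
Qed.

Definition itcot (x : R) := parameterized_integral mu 0 x tcot.

Lemma tcot_integrable (u : R) : u < pi -> mu.-integrable `[0, u] (EFin \o tcot).
Proof.
move=> u1; apply: continuous_compact_integrable; first exact: segment_compact.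
apply: continuous_in_subspaceT => x; rewrite inE /= in_itv /= => /andP[x0 xu].
by apply: tcot_continuous; have := @pi_gt0 R; lra.
Qed.

Lemma itcot_derive (x : R) : 0 < x -> x < pi -> is_derive x 1 itcot (tcot x).
Proof.
move=> x0 x1; have pi0 := @pi_gt0 R.
have xu : x < (x + pi) / 2 by lra.
have up : (x + pi) / 2 < pi by lra.
have xc : {for x, continuous tcot} by apply: tcot_continuous => //; lra.
have [H1 H2] := continuous_FTC1_closed xu (tcot_integrable up) x0 xc.
by apply: DeriveDef; [exact: H1 | rewrite -derive1E].
Qed.

Lemma itcot_cvg0 : itcot x @[x --> (0 : R)] --> (0 : R).
Proof.
have pi0 := @pi_gt0 R.
by apply: (@parameterized_integral_cvg_left _ 0 (pi / 2)); [lra | apply: tcot_integrable; lra].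
Qed.

(** Integration by parts of -ln sin: the remaining integrand t cot t extends continuously to 0,
    which avoids an improper integral. *)
Definition lob1 (x : R) := - (x * ln (sin x)) + itcot x.

Lemma lob1_derive (x : R) : 0 < x -> x < pi -> is_derive x 1 lob1 (- ln (sin x)).
Proof.
move=> x0 x1; have sp : 0 < sin x by apply: sin_gt0_pi; rewrite x0.
have d1 := itcot_derive x0 x1; have d2 := is_derive1_ln sp.
apply: is_derive_eq.
rewrite /tcot gt_eqF // /GRing.scale /=.
by field; rewrite gt_eqF.
Qed.

Lemma xlnsin0 (e : R) : 0 < e -> exists2 d, 0 < d & forall x, 0 < x -> x < d ->
  `|x * ln (sin x)| < e.
Proof.
move=> e0; have h2 : 0 < 1 / 2 :> R by lra.
have [d d0 Hd] := sinc_near0 h2; have pi0 := @pi_gt0 R.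
(* |x ln (sin x)| is bounded by 4 sqrt (x / 2), using sin x >= x / 2 and ln y < y at y = (x /
   2)^(-1/2); this is less than [e] for x < e^2 / 8. *)
exists (Num.min (Num.min d (pi / 2)) (e ^+ 2 / 8)).
  by rewrite !lt_min d0 /=; apply/andP; split; [lra | rewrite divr_gt0 ?exprn_gt0].
move=> x x0; rewrite !lt_min => /andP[/andP[xd xp] xe].
have s0 : 0 < sin x by apply: sin_gt0_pi; lra.
have s1 := sin_le1 x.
have sx : x / 2 <= sin x.
  have := Hd x (lt0r_neq0 x0); rewrite gtr0_norm // => /(_ xd).
  rewrite ltr_norml => /andP[h _].
  have : 1 / 2 < sin x / x by lra.
  by rewrite ltr_pdivlMr //; lra.
have x20 : 0 < x / 2 by lra.
have q0 : 0 < Num.sqrt (x / 2) by rewrite sqrtr_gt0.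
have q2 : Num.sqrt (x / 2) ^+ 2 = x / 2 by rewrite sqr_sqrtr // ltW.
have l0 : ln (sin x) <= 0 by exact: ln_le0.
rewrite normrM (gtr0_norm x0) (ler0_norm l0).
have l1 : - ln (sin x) <= - ln (x / 2) by rewrite lerN2 ler_ln ?posrE.
have l2 : - ln (x / 2) = 2 * ln (Num.sqrt (x / 2))^-1.
  by rewrite -{1}q2 lnXn // lnV ?posrE // mulr2n; lra.
have l3 : ln (Num.sqrt (x / 2))^-1 < (Num.sqrt (x / 2))^-1 by apply: ln_sublinear; rewrite invr_gt0.
apply: (@lt_le_trans _ _ (x * (2 * (Num.sqrt (x / 2))^-1))).
  by rewrite ltr_pM2l //; lra.
have -> : x * (2 / Num.sqrt (x / 2)) = 4 * Num.sqrt (x / 2).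
  have -> : x = 2 * Num.sqrt (x / 2) ^+ 2 by rewrite q2; lra.
  rewrite (_ : 2 * Num.sqrt (x / 2) ^+ 2 / 2 = Num.sqrt (x / 2) ^+ 2); last by lra.
  by rewrite sqrtr_sqr (gtr0_norm q0); field; rewrite gt_eqF.
have : Num.sqrt (x / 2) <= e / 4.
  rewrite -[X in _ <= X]ger0_norm; last lra.
  rewrite -sqrtr_sqr; apply: ler_wsqrtr; rewrite expr_div_n.
  have -> : (4 : R) ^+ 2 = 16 by rewrite expr2; lra.
  lra.
lra.
Qed.

Lemma lob1_near0 (e : R) : 0 < e -> exists2 d, 0 < d & forall x, 0 < x -> x < d -> `|lob1 x| < e.
Proof.
move=> e0; have e2 : 0 < e / 2 by lra.
have [d d0 Hd] := xlnsin0 e2.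
have := itcot_cvg0; move=> /cvgrPdist_lt/(_ _ e2)/nbhs_ballP[d' /= d'0 Hd'].
exists (Num.min d d'); first by rewrite lt_min d0.
move=> x x0; rewrite lt_min => /andP[xd xd'].
have := Hd x x0 xd; have /Hd' : ball (0 : R) d' x by rewrite /ball /= sub0r normrN gtr0_norm.
rewrite /= sub0r normrN /lob1 => h1 h2.
by apply: le_lt_trans (ler_normD _ _) _; rewrite normrN; lra.
Qed.

(** The integral of -ln sin over [0, pi], as twice that over [0, pi/2]; it equals pi ln 2. *)
Definition lob_top := 2 * lob1 (pi / 2).

(** lob1 t + lob1 (pi - t) has derivative 0, and its value is read off at pi / 2. *)
Lemma lob1_sym (x : R) : 0 < x -> x < pi -> lob1 (pi - x) = lob_top - lob1 x.
Proof.
move=> x0 x1; have pi0 := @pi_gt0 R.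
pose f (t : R) := lob1 t + lob1 (pi - t).
have df t : 0 < t -> t < pi -> is_derive t 1 f 0.
  move=> t0 t1.
  have d1 := lob1_derive t0 t1.
  have d2 : is_derive (pi - t) 1 lob1 (- ln (sin (pi - t))) by apply: lob1_derive; lra.
  have d3 : is_derive t 1 (fun t : R => pi - t) (-1).
    by apply: is_derive_eq; rewrite add0r mul1r.
  have d4 : is_derive t 1 (lob1 \o (fun t : R => pi - t)) (-1 * - ln (sin (pi - t))).
    by rewrite mulrC; exact: is_derive1_comp.
  have -> : f = lob1 + (lob1 \o (fun t : R => pi - t)) by [].
  apply: is_derive_eq.
  by rewrite sinB sinpi cospi mul0r sub0r mulN1r opprK mulN1r opprK addNr.
have fc t : 0 < t -> t < pi -> {for t, continuous f}.
  move=> t0 t1; have dft := df t t0 t1.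
  exact/differentiable_continuous/derivable1_diffP.
have cst a b : 0 < a -> a < b -> b < pi -> f a = f b.
  move=> a0 ab b1.
  have [| |c _] := @MVT R f (fun=> 0) a b ab.
  - by move=> y; rewrite in_itv /= => /andP[ya yb]; apply: df; lra.
  - apply: continuous_in_subspaceT => y; rewrite inE /= in_itv /= => /andP[ya yb].
    by apply: fc; lra.
  - by rewrite mul0r => /eqP; rewrite subr_eq0 => /eqP.
have fpi : f (pi / 2) = lob_top.
  by rewrite /f /lob_top (_ : pi - pi / 2 = pi / 2); lra.
have : f x = lob_top.
  rewrite -fpi; have [xp|xp|->//] := ltgtP x (pi / 2).
    by apply: cst => //; lra.
  by apply/esym/cst; lra.
by rewrite /f; lra.
Qed.

(* An antiderivative of - ln sin on [0, pi], constant outside.  Up to a linear term,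
   which is immaterial under the constraint a + b + c = pi, it is the Lobachevsky function. *)
Definition lob (x : R) := if x <= 0 then 0 else if x < pi then lob1 x else lob_top.

Lemma lob_lt0 x : x <= 0 -> lob x = 0.
Proof. by rewrite /lob => ->. Qed.

Lemma lob_in x : 0 < x -> x < pi -> lob x = lob1 x.
Proof. by rewrite /lob => x0 ->; rewrite leNgt x0. Qed.

Lemma lob_ge x : pi <= x -> lob x = lob_top.
Proof.
move=> xp; have pi0 := @pi_gt0 R.
by rewrite /lob leNgt (lt_le_trans pi0 xp) /= ltNge xp.
Qed.

Lemma lob_sym x : lob (pi - x) = lob_top - lob x.
Proof.
have pi0 := @pi_gt0 R.
have [x0|x0] := leP x 0; first by rewrite (lob_lt0 x0) subr0 lob_ge //; lra.
have [x1|x1] := leP pi x; first by rewrite (lob_ge x1) subrr lob_lt0 //; lra.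
by rewrite !lob_in ?lob1_sym //; lra.
Qed.

Lemma lob_derive x : 0 < x -> x < pi -> is_derive x 1 lob (- ln (sin x)).
Proof.
move=> x0 x1; apply: (near_eq_is_derive _ (lob1_derive x0 x1)).
near=> t; apply/esym/lob_in.
  by near: t; apply: lt_nbhsr.
by near: t; apply: lt_nbhsl.
Unshelve. all: by end_near.
Qed.

Lemma lob_continuous : continuous lob.
Proof.
have pi0 := @pi_gt0 R.
have c0 : {for 0, continuous lob}.
  apply/cvgrPdist_lt => /= e e0; rewrite (lob_lt0 (lexx _)).
  have [d d0 Hd] := lob1_near0 e0.
  near=> t; rewrite sub0r normrN.
  have [t0|t0] := leP t 0; first by rewrite lob_lt0 ?normr0.
  have td : t < Num.min d pi by near: t; apply: lt_nbhsl; rewrite lt_min d0.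
  by move: td; rewrite lt_min => /andP[td tp]; rewrite lob_in //; apply: Hd.
have cpi : {for pi, continuous lob}.
  have -> : lob = (fun x => lob_top - lob (pi - x)).
    by apply/funext => x; rewrite lob_sym subKr.
  apply: cvgB; first exact: cvg_cst.
  have E : (fun x : R => pi - x) @ pi --> (0 : R).
    by rewrite -[X in _ --> X](subrr pi); apply: cvgB; [exact: cvg_cst|exact: cvg_id].
  apply: (@cvg_comp _ _ _ (fun x : R => pi - x) lob _ (nbhs (0 : R))) => //.
  by rewrite subrr; exact: c0.
move=> x; case: (ltgtP x 0) => [x0|x0|->//].
  apply/cvgrPdist_lt => /= e e0; near=> t.
  have t0 : t < 0 by near: t; apply: lt_nbhsl.
  by rewrite !lob_lt0 ?subrr ?normr0 ?(ltW x0) ?(ltW t0).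
case: (ltgtP x pi) => [x1|x1|->//].
  by have d := lob_derive x0 x1; exact/differentiable_continuous/derivable1_diffP.
apply/cvgrPdist_lt => /= e e0; near=> t.
have t0 : pi < t by near: t; apply: lt_nbhsr.
by rewrite !lob_ge ?subrr ?normr0 ?(ltW x1) ?(ltW t0).
Unshelve. all: by end_near.
Qed.

(** * The volume of an ideal triangle of angles *)

Lemma lob_flat a b c : a + b + c = pi -> 0 <= a -> 0 <= b -> 0 <= c ->
  [|| a == pi, b == pi | c == pi] -> lob a + lob b + lob c = lob_top.
Proof.
have pi0 := @pi_gt0 R.
have l0 := lob_lt0 (lexx (0 : R)); have lpi := lob_ge (lexx (pi : R)).
move=> abc a0 b0 c0 /or3P[] /eqP e.
- have eb : b = 0 by lra.
  have ec : c = 0 by lra.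
  by rewrite e eb ec lpi l0 !addr0.
- have ea : a = 0 by lra.
  have ec : c = 0 by lra.
  by rewrite e ea ec lpi l0 addr0 add0r.
- have ea : a = 0 by lra.
  have eb : b = 0 by lra.
  by rewrite e ea eb lpi l0 !add0r.
Qed.

(** With s = a + b and a <= b, the sum lob t + lob (s - t) increases for t from 0 to a, because sin
    t < sin (s - t). *)
Lemma lob_subadd a b : 0 < a -> 0 < b -> a + b < pi -> lob (a + b) < lob a + lob b.
Proof.
have pi0 := @pi_gt0 R.
wlog ab : a b / a <= b.
  move=> W a0 b0 abp; have [ab|ba] := leP a b; first exact: W.
  by rewrite addrC [lob a + _]addrC; apply: W => //; [exact: ltW | rewrite addrC].
move=> a0 b0 abp; pose s := a + b.
pose f (t : R) := lob t + lob (s - t).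
have df t : 0 < t -> t < s -> is_derive t 1 f (- ln (sin t) + ln (sin (s - t))).
  move=> t0 t1.
  have d1 : is_derive t 1 lob (- ln (sin t)) by apply: lob_derive; rewrite /s in t1 *; lra.
  have d2 : is_derive (s - t) 1 lob (- ln (sin (s - t))) by apply: lob_derive; rewrite /s in t1 *; lra.
  have d3 : is_derive t 1 (fun t : R => s - t) (-1).
    by apply: is_derive_eq; rewrite add0r mul1r.
  have d4 : is_derive t 1 (lob \o (fun t : R => s - t)) (-1 * - ln (sin (s - t))).
    by rewrite mulrC; exact: is_derive1_comp.
  have -> : f = lob + (lob \o (fun t : R => s - t)) by [].
  by apply: is_derive_eq; rewrite mulN1r opprK.
have fc : {within `[0, a], continuous f}.
  apply: continuous_subspaceT => t; apply: cvgD; first exact: lob_continuous.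
  apply: (@cvg_comp _ _ _ (fun x : R => s - x) lob _ (nbhs (s - t))); last exact: lob_continuous.
  by apply: cvgB; [exact: cvg_cst|exact: cvg_id].
have [|c] := @MVT R f (fun t => - ln (sin t) + ln (sin (s - t))) 0 a a0 _ fc.
  by move=> t; rewrite in_itv /= => /andP[t0 ta]; apply: df => //; rewrite /s; lra.
rewrite in_itv /= => /andP[c0 ca] e.
have lt : 0 < ln (sin (s - c)) - ln (sin c).
  have sc : 0 < sin c by apply: sin_gt0_pi; rewrite /s in e *; lra.
  have ssc : 0 < sin (s - c) by apply: sin_gt0_pi; rewrite /s; lra.
  rewrite subr_gt0 ltr_ln ?posrE //.
  have m x y : 0 <= x -> x < y -> y <= pi / 2 -> sin x < sin y.
    move=> x0 xy yp; rewrite ltr_sin ?in_itv //=; apply/andP; split; lra.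
  have [h|h] := leP (s - c) (pi / 2); first by apply: m => //; rewrite /s; lra.
  have -> : sin (s - c) = sin (pi - (s - c)) by rewrite [RHS]sinB sinpi cospi; ring.
  by apply: m; rewrite /s in h *; lra.
have : 0 < f a - f 0 by rewrite e subr0 mulr_gt0 //; lra.
rewrite /f subr0 (lob_lt0 (lexx 0)) add0r /s (_ : a + b - a = b); last by ring.
by lra.
Qed.

(** Strict subadditivity combined with the symmetry. The excess over [lob_top] is the volume of the
    ideal tetrahedron with these angles. *)
Lemma lob_nonflat a b c : 0 < a -> 0 < b -> 0 < c -> a + b + c = pi ->
  lob_top < lob a + lob b + lob c.
Proof.
move=> a0 b0 c0 abc; have := lob_subadd a0 b0; rewrite -abc ltrDl => /(_ c0).
have -> : c = pi - (a + b) by rewrite -abc; ring.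
by rewrite lob_sym; lra.
Qed.

End LogSine.

(** * One-sided growth of the log-sine integral along lines *)

Section LobGrowth.
Variable R : realType.

Lemma lob_line_derive (a v s : R) : 0 < a + s * v -> a + s * v < pi ->
  is_derive s 1 (fun s => lob (a + s * v)) (- ln (sin (a + s * v)) * v).
Proof.
move=> h0 h1; have d1 := lob_derive h0 h1.
have d2 : is_derive s 1 (fun s : R => a + s * v) v.
  by apply: is_derive_eq; rewrite scaler0 !add0r mul1r; exact: mulr1.
exact: (is_derive1_comp (f := @lob R) (g := fun s => a + s * v) d1 d2).
Qed.

(** Moving an angle away from an interior value costs at most linearly in [s]; the infinite slope at
    0 will outweigh this. *)
Lemma lob_lipschitz_right (a v : R) : 0 < a -> a < pi ->
  exists C, \forall s \near 0^'+, - (C * s) <= lob (a + s * v) - lob a.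
Proof.
move=> a0 a1.
have d : is_derive (0 : R) 1 (fun s : R => lob (a + s * v)) (- ln (sin (a + 0 * v)) * v).
  by apply: lob_line_derive; rewrite mul0r addr0.
move: (- _ * v) d => L d.
exists (1 - L).
have := ex_derive (is_derive := d); have := derive_val (is_derive := d).
rewrite /derive => lim_eq cv.
have /cvgrPdist_lt/(_ 1 ltr01) :
    ((fun h : R => h^-1 *: (((fun s => lob (a + s * v)) \o shift 0) (h *: 1) - lob (a + 0 * v))) @ 0^') --> L.
  by move: (cv); rewrite /derivable => cv'; rewrite -[X in _ --> X]lim_eq; exact: cv'.
rewrite near_withinE => /nbhs_ballP[e /= e0 H].
near=> s.
have s0 : 0 < s by near: s; exact: nbhs_right_gt.
have se : s < e by near: s; exact: nbhs_right_lt.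
have /H/(_ (lt0r_neq0 s0)) : ball (0 : R) e s by rewrite /ball /= sub0r normrN gtr0_norm.
rewrite /= addr0 mul0r addr0 /GRing.scale /= mulr1 ltr_norml => /andP[_ h].
have : L - 1 <= s^-1 * (lob (a + s * v) - lob a) by lra.
by rewrite [s^-1 * _]mulrC ler_pdivlMr //; lra.
Unshelve. all: by end_near.
Qed.

(* [lob] has an infinite derivative at 0. *)
Lemma lob_steep_right (v M : R) : 0 < v -> \forall s \near 0^'+, M * s <= lob (s * v).
Proof.
move=> v0; have pi0 := @pi_gt0 R.
pose e := expR (- (M / v)).
have e0 : 0 < e by exact: expR_gt0.
have := @continuous_sin R 0; move=> /cvgrPdist_lt/(_ _ e0)/nbhs_ballP[d /= d0 H].
have d1 : 0 < Num.min d pi / v by rewrite divr_gt0 // lt_min d0.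
near=> s.
have s0 : 0 < s by near: s; exact: nbhs_right_gt.
have : s < Num.min d pi / v by near: s; exact: nbhs_right_lt.
rewrite ltr_pdivlMr // lt_min => /andP[sd sp].
have sv0 : 0 < s * v by exact: mulr_gt0.
have [|c] := @MVT R (@lob R) (fun t => - ln (sin t)) 0 (s * v) sv0 _ (continuous_subspaceT (@lob_continuous R)).
  by move=> t; rewrite in_itv /= => /andP[t0 ta]; apply: lob_derive => //; exact: lt_trans sp.
rewrite in_itv /= => /andP[c0 ca]; rewrite subr0 (lob_lt0 (lexx 0)) subr0 => ->.
have sc : 0 < sin c by apply: sin_gt0_pi; rewrite c0 (lt_trans ca).
have : sin c < e.
  have /H : ball (0 : R) d c by rewrite /ball /= sub0r normrN gtr0_norm // (lt_trans ca).
  by rewrite /= sin0 sub0r normrN gtr0_norm.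
rewrite -ltr_ln ?posrE // /e expRK => h.
have -> : M * s = (M / v) * (s * v) by field; rewrite gt_eqF.
by rewrite ler_pM2r //; lra.
Unshelve. all: by end_near.
Qed.

Lemma is_derive_bigsum (I : Type) (r : seq I) (f : I -> R -> R) (df : I -> R) (x : R) :
  (forall i, is_derive x 1 (f i) (df i)) ->
  is_derive x 1 (fun s => \sum_(i <- r) f i s) (\sum_(i <- r) df i).
Proof.
move=> H; elim: r => [|i r IH].
  have -> : (fun s => \sum_(i <- [::]) f i s) = cst 0 by apply/funext => s; rewrite big_nil.
  by rewrite big_nil; exact: is_derive_cst.
have -> : (fun s => \sum_(j <- i :: r) f j s) = f i + (fun s => \sum_(j <- r) f j s).
  by apply/funext => s; rewrite big_cons.
by rewrite big_cons; exact: is_deriveD.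
Qed.
End LobGrowth.

(** * Maximal volume *)

(** A linear form that vanishes on the kernel of a matrix is a combination of its rows; the columns
    of the cokernel matrix serve as test vectors. *)
Lemma lagrange_multipliers (F : fieldType) (J K : finType) (N : K -> J -> F) (g : J -> F) :
  (forall v : J -> F, (forall k, \sum_j N k j * v j = 0) -> \sum_j g j * v j = 0) ->
  exists nu : K -> F, forall j, g j = \sum_k nu k * N k j.
Proof.
move=> H.
have E (I : finType) (f : I -> F) : \sum_i f i = \sum_(a < #|I|) f (enum_val a).
  rewrite (reindex (enum_val : 'I_#|I| -> I)) //; apply: onW_bij; exact: enum_val_bij.
pose M : 'M[F]_(#|K|, #|J|) := \matrix_(a, b) N (enum_val a) (enum_val b).
pose r : 'rV[F]_(#|J|) := \row_b g (enum_val b).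
have [D HD] : exists D, r = D *m M.
  apply/submxP; rewrite submxE; apply/eqP/rowP => c; rewrite [RHS]mxE [LHS]mxE.
  have {}H := H (fun j => cokermx M (enum_rank j) c).
  rewrite -[RHS]H; first by rewrite [RHS]E; apply: eq_bigr => j _; rewrite [r _ _]mxE enum_valK.
  move=> k; have := mulmx_coker M => /matrixP/(_ (enum_rank k) c); rewrite mxE [RHS]mxE => e0; rewrite -[RHS]e0.
  by rewrite [LHS]E; apply: eq_bigr => j _; rewrite [M _ _]mxE enum_rankK enum_valK.
exists (fun k => D 0 (enum_rank k)) => j.
have /rowP/(_ (enum_rank j)) := HD; rewrite mxE [RHS]mxE enum_rankK => ->.
by rewrite [RHS]E; apply: eq_bigr => k _; rewrite [M _ _]mxE enum_valK enum_rankK.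
Qed.

Section Variational.
Variables (R : realType) (T E : finType) (w : T -> R) (N : E -> T -> 'I_3 -> R) (b : E -> R).
Hypothesis w_gt0 : forall t, 0 < w t.
Implicit Types (th v : T -> 'I_3 -> R).

Definition feasible th := [/\ forall t k, 0 <= th t k, forall t, \sum_k th t k = pi &
  forall e, \sum_t \sum_k N e t k * th t k = b e].

(** Up to an additive constant, the volume of the angle structure when [t] stands for [w t]
    tetrahedra. *)
Definition volume th := \sum_t w t * \sum_k lob (th t k).

Definition tangent v := (forall t, \sum_k v t k = 0) /\
  forall e, \sum_t \sum_k N e t k * v t k = 0.

Lemma feasible_le_pi th t k : feasible th -> th t k <= pi.
Proof.
move=> [h0 hs _]; rewrite -(hs t) (bigD1 k) //= lerDl sumr_ge0 // => i _; exact: h0.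
Qed.

Lemma volume_max : (exists th, feasible th) -> exists2 th, feasible th &
  forall th', feasible th' -> volume th' <= volume th.
Proof.
move=> [th0 h0].
pose J := (T * 'I_3)%type.
pose un (x : 'rV[R]_#|{: J}|) : T -> 'I_3 -> R := fun t k => x 0 (enum_rank (t, k)).
pose mk th : 'rV[R]_#|{: J}| := \row_j th (enum_val j).1 (enum_val j).2.
have unK th : un (mk th) = th.
  by apply/funext => t; apply/funext => k; rewrite /un mxE enum_rankK.
pose A := [set x | feasible (un x)].
have unc t k : continuous (fun x => un x t k) by exact: coord_continuous.
have sumc (I : Type) (s : seq I) (f : I -> 'rV[R]_#|{: J}| -> R) :
    (forall i, continuous (f i)) -> continuous (fun x => \sum_(i <- s) f i x).
  move=> fc; elim: s => [|i s IH].
    have -> : (fun x => \sum_(i <- [::]) f i x) = (fun=> 0).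
      by apply/funext => x; rewrite big_nil.
    exact: cst_continuous.
  have -> : (fun x => \sum_(j <- i :: s) f j x) = (fun x => f i x + \sum_(j <- s) f j x).
    by apply/funext => x; rewrite big_cons.
  by move=> x; exact: (cvgD (fc i x) (IH x)).
have cA : compact A.
  apply: bounded_closed_compact.
    exists pi; split; first by rewrite num_real.
    move=> M piM x Ax; apply: le_trans (ltW piM).
    change (mx_norm x <= pi); rewrite mx_normrE; apply: bigmax_le => [|[i c] _ /=].
      by apply: ltW; exact: pi_gt0.
    rewrite (ord1 i); have -> : x 0 c = un x (enum_val c).1 (enum_val c).2.
      by rewrite /un -surjective_pairing enum_valK.
    by rewrite ger0_norm ?feasible_le_pi //; case: Ax => + _ _; apply.
  have cl (l : 'rV[R]_#|{: J}| -> R) (D : set R) : continuous l -> closed D -> closed (l @^-1` D).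
    by move=> lc Dc; apply: preimage_closed => //; exact: Dc.
  have -> : A = (\bigcap_t \bigcap_k [set x | 0 <= un x t k]) `&`
      (\bigcap_t [set x | \sum_k un x t k = pi]) `&`
      (\bigcap_e [set x | \sum_t \sum_k N e t k * un x t k = b e]).
    apply/seteqP; split=> x /=.
      by move=> [H1 H2 H3]; split; [split|]; do ?move=> ? _ /=; [exact: H1|exact: H2|exact: H3].
    by move=> [[H1 H2] H3]; split=> [t k|t|e]; [exact: H1|exact: H2|exact: H3].
  apply: closedI; first apply: closedI.
  - apply: closed_bigI => t _; apply: closed_bigI => k _.
    exact: (cl _ [set y : R | 0 <= y] (unc t k) (@closed_ge _ _)).
  - apply: closed_bigI => t _.
    exact: (cl _ [set y : R | y = pi] (sumc _ _ _ (unc t)) (@closed_eq _ _)).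
  - apply: closed_bigI => e _.
    apply: (cl _ [set y : R | y = b e] _ (@closed_eq _ _)).
    apply: (sumc) => t; apply: (sumc) => k x.
    by exact: (cvgM (cvg_cst _) (unc t k x)).
have fc : continuous (fun x => volume (un x)).
  apply: (sumc) => t x; have lc : continuous (fun x => \sum_k lob (un x t k)).
    apply: (sumc) => k y.
    exact: (@cvg_comp _ _ _ (fun x => un x t k) (@lob R) _ _ _ (unc t k y) (@lob_continuous R _)).
  exact: (cvgM (cvg_cst _) (lc x)).
have [|c cA' cmax] := EVT_max_rV _ cA (continuous_subspaceT fc).
  by exists (mk th0); rewrite /A /= unK.
exists (un c); first by move: cA'; rewrite inE.
by move=> th' h'; rewrite -(unK th'); apply: cmax; rewrite inE /A /= unK.
Qed.

Lemma ord3_cases (i : 'I_3) : i = 0 \/ i = 1 \/ i = 2%:R.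
Proof. by case: i => [[|[|[|//]]] h]; [left|right; left|right; right]; apply: val_inj. Qed.

Lemma big_ord3 (V : nmodType) (f : 'I_3 -> V) : \sum_k f k = f 0 + f 1 + f 2%:R.
Proof.
rewrite !big_ord_recl big_ord0 addr0 addrA.
by congr (f _ + f _ + f _); apply: val_inj.
Qed.

Lemma feasible_shift th v s : feasible th -> tangent v ->
  (forall t k, 0 <= th t k + s * v t k) -> feasible (fun t k => th t k + s * v t k).
Proof.
move=> [_ h1 h2] [v1 v2] h0; split=> [//|t|e].
  by rewrite big_split /= h1 -mulr_sumr v1 mulr0 addr0.
have -> : b e = \sum_t \sum_k N e t k * th t k + s * (\sum_t \sum_k N e t k * v t k).
  by rewrite h2 v2 mulr0 addr0.
rewrite mulr_sumr -big_split /=; apply: eq_bigr => t _; rewrite mulr_sumr -big_split /=; apply: eq_bigr => k _; ring.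
Qed.

Lemma tangent_diff th th' : feasible th -> feasible th' ->
  tangent (fun t k => th' t k - th t k).
Proof.
move=> [_ h1 h2] [_ h1' h2']; split=> [t|e].
  by rewrite sumrB h1 h1' subrr.
rewrite -[RHS](subrr (b e)) -{1}(h2' e) -(h2 e) -sumrB; apply: eq_bigr => t _.
by rewrite -sumrB; apply: eq_bigr => k _; rewrite mulrBr.
Qed.

Lemma feasible_lt_pi th t k : feasible th -> (forall k, 0 < th t k) -> th t k < pi.
Proof.
move=> [_ hs _] h0; have [k' kk'] : exists k' : 'I_3, k' != k.
  by exists (if k == ord0 then ord_max else ord0); case: (eqVneq k ord0) => [->|h] //; rewrite eq_sym.
rewrite -(hs t) (bigD1 k) //= (bigD1 k') //= ltrDl ltr_pwDl ?h0 // sumr_ge0 // => i _.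
exact/ltW/h0.
Qed.

Lemma stationary th v : feasible th -> (forall t k, 0 < th t k) ->
  (forall th', feasible th' -> volume th' <= volume th) -> tangent v ->
  \sum_t w t * \sum_k ln (sin (th t k)) * v t k = 0.
Proof.
move=> fth th0 thmax tv.
have : \forall s \near (0 : R), forall t k, 0 < th t k + s * v t k.
  apply: (@filter_forall _ _ (fun t s => forall k, 0 < th t k + s * v t k) (nbhs (0 : R)) _) => t.
  apply: (@filter_forall _ _ (fun k s => 0 < th t k + s * v t k) (nbhs (0 : R)) _) => k.
  have : (fun s : R => th t k + s * v t k) @ (0 : R) --> th t k + 0 * v t k.
    by apply: cvgD; [exact: cvg_cst|exact: (cvgM cvg_id (cvg_cst _))].
  by move=> /cvgr_gt; apply; rewrite mul0r addr0.
move=> /nbhs_ballP[d /= d0 H].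
have feas s : s \in `]- d, d[ -> forall t k, 0 < th t k + s * v t k.
  by rewrite in_itv /= => hs; apply: H; rewrite /ball /= sub0r normrN ltr_norml.
have feas' s (hs : s \in `]- d, d[) : feasible (fun t k => th t k + s * v t k).
  by apply: feasible_shift => // t k; exact/ltW/feas.
pose f (s : R) := volume (fun t k => th t k + s * v t k).
have df s : s \in `]- d, d[ ->
    is_derive s 1 f (\sum_t w t * \sum_k - ln (sin (th t k + s * v t k)) * v t k).
  move=> hs; apply: is_derive_bigsum => t.
  have D : is_derive s 1 (fun s => \sum_k lob (th t k + s * v t k))
      (\sum_k - ln (sin (th t k + s * v t k)) * v t k).
    apply: is_derive_bigsum => k; apply: lob_line_derive; first exact: feas.
    exact: (@feasible_lt_pi _ t k (feas' _ hs) (feas _ hs t)).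
  exact: (is_deriveZ (w t) D).
have zd : (0 : R) \in `]- d, d[ by rewrite in_itv /= oppr_lt0 d0.
have D0 : is_derive (0 : R) 1 f 0.
  apply: (@derive1_at_max R f (- d) d 0) => //.
  - by apply: ltW; apply: lt_trans (_ : 0 < d); rewrite ?oppr_lt0.
  - by move=> s hs; have := df s hs => -[].
  - move=> s hs; rewrite /f; have -> : (fun t k => th t k + 0 * v t k) = th.
      by apply/funext => t; apply/funext => k; rewrite mul0r addr0.
    exact/thmax/feas'.
have e1 := derive_val (is_derive := D0).
have e2 := derive_val (is_derive := df 0 zd).
apply: oppr_inj; rewrite oppr0 -[RHS]e1 e2 -sumrN; apply: eq_bigr => t _.
rewrite -mulrN -sumrN; congr (_ * _); apply: eq_bigr => k _.
by rewrite mul0r addr0 mulNr.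
Qed.

(** Move from [th] towards the positive structure [thp]. A tetrahedron with an angle 0 but no angle
    pi gains faster than linearly, and every other one loses at most linearly, against
    maximality. *)
Lemma max_dichotomy th thp : feasible th -> feasible thp -> (forall t k, 0 < thp t k) ->
  (forall th', feasible th' -> volume th' <= volume th) ->
  forall t, (forall k, 0 < th t k) \/ exists k, th t k = pi.
Proof.
move=> fth fthp thp0 thmax t0.
have [|nz] := pselect (forall k, 0 < th t0 k); first by left.
have [|npi] := pselect (exists k, th t0 k = pi); first by right.
exfalso; have [fth0 fths _] := fth; have [_ fthps _] := fthp.
have [k0 k00] : exists k, th t0 k = 0.
  apply: contra_notP nz => h k; rewrite lt_neqAle fth0 andbT eq_sym; apply/eqP => e.
  by apply: h; exists k.
pose D t k := thp t k - th t k.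
have tD : tangent D by exact: tangent_diff.
have feas s : 0 < s < 1 -> feasible (fun t k => th t k + s * D t k).
  move=> /andP[s0 s1]; apply: feasible_shift => // t k; rewrite /D.
  have -> : th t k + s * (thp t k - th t k) = (1 - s) * th t k + s * thp t k by ring.
  by apply: addr_ge0; apply: mulr_ge0; rewrite ?subr_ge0 ?fth0 //; apply: ltW.
have step t k : th t k < pi -> exists C, \forall s \near 0^'+,
    - (C * s) <= lob (th t k + s * D t k) - lob (th t k).
  move=> hp; have := fth0 t k; rewrite le_eqVlt => /predU1P[e|h]; last exact: lob_lipschitz_right.
  exists 0; rewrite /D -e; have := lob_steep_right 0 (thp0 t k).
  by apply: filterS => s; rewrite mul0r (lob_lt0 (lexx 0)) add0r !subr0 oppr0.
have gr t : exists C, \forall s \near 0^'+,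
    - (C * s) <= \sum_k lob (th t k + s * D t k) - \sum_k lob (th t k).
  (* At an angle pi the slope is infinite as well, but in the wrong direction; the three angles
     together still lose nothing, by [lob_nonflat]. *)
  have [[k e]|h] := pselect (exists k, th t k = pi).
    exists 0; near=> s; rewrite mul0r oppr0 subr_ge0.
    have s01 : 0 < s < 1.
      by apply/andP; split; near: s; [exact: nbhs_right_gt|exact: nbhs_right_lt].
    have [g0 gs _] := feas s s01.
    have gp k' : 0 < th t k' + s * D t k'.
      move/andP: s01 => [s0 s1]; rewrite /D.
      have -> : th t k' + s * (thp t k' - th t k') = (1 - s) * th t k' + s * thp t k' by ring.
      by rewrite ltr_wpDl ?mulr_gt0 // mulr_ge0 ?fth0 // subr_ge0 ltW.
    move: (gs t) (fths t); rewrite !big_ord3 => e1 e2.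
    rewrite lob_flat //; first exact/ltW/lob_nonflat.
    by move: e; case: (ord3_cases k) => [|[|]] -> ->; rewrite eqxx ?orbT.
  have hlt k : th t k < pi.
    by rewrite lt_neqAle feasible_le_pi // andbT; apply/eqP => e; apply: h; exists k.
  have [C HC] := choice (fun k => step t k (hlt k)).
  exists (\sum_k C k); have {}HC := @filter_forall _ _ _ (at_right (0 : R)) _ HC; near=> s.
  have Hs : forall k, - (C k * s) <= lob (th t k + s * D t k) - lob (th t k) by near: s; exact: HC.
  by rewrite mulr_suml -sumrN -sumrB; apply: ler_sum => k _; exact: Hs.
have [C HC] := choice gr; have {}HC := @filter_forall _ _ _ (at_right (0 : R)) _ HC.
have hlt k : th t0 k < pi.
  by rewrite lt_neqAle feasible_le_pi // andbT; apply/eqP => e; apply: npi; exists k.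
have [C0 HC0] := choice (fun k => step t0 k (hlt k)).
have {}HC0 := @filter_forall _ _ _ (at_right (0 : R)) _ HC0.
(* The slope at the vanishing angle [k0] that makes up for all linear losses and leaves a surplus of
   [s]. *)
pose M := (\sum_(t | t != t0) w t * C t + 1) / w t0 + \sum_(k | k != k0) C0 k.
have st := lob_steep_right M (thp0 t0 k0).
near (at_right (0 : R)) => s.
have s0 : 0 < s by near: s; exact: nbhs_right_gt.
have s01 : 0 < s < 1 by rewrite s0 /=; near: s; exact: nbhs_right_lt.
have h1 : forall t, - (C t * s) <= \sum_k lob (th t k + s * D t k) - \sum_k lob (th t k).
  by near: s; exact: HC.
have h2 : forall k, - (C0 k * s) <= lob (th t0 k + s * D t0 k) - lob (th t0 k).
  by near: s; exact: HC0.
have h3 : M * s <= lob (s * thp t0 k0) by near: s.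
have := thmax _ (feas s s01); rewrite -subr_le0 /volume -sumrB (bigD1 t0) //= leNgt => /negP; apply.
have b1 : (M - \sum_(k | k != k0) C0 k) * s <=
    \sum_k lob (th t0 k + s * D t0 k) - \sum_k lob (th t0 k).
  rewrite -sumrB [leRHS](bigD1 k0) //= mulrBl; apply: lerD.
    by rewrite /D k00 subr0 add0r (lob_lt0 (lexx 0)) subr0.
  by rewrite mulr_suml -sumrN; apply: ler_sum => k _; exact: h2.
have b2 : - (\sum_(t | t != t0) w t * C t * s) <= \sum_(t | t != t0)
    (w t * (\sum_k lob (th t k + s * D t k)) - w t * (\sum_k lob (th t k))).
  rewrite -sumrN; apply: ler_sum => t _; rewrite -mulrBr -mulrA -mulrN.
  by rewrite ler_pM2l.
have b3 := ler_wpM2l (ltW (w_gt0 t0)) b1.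
rewrite -mulrBr; apply: lt_le_trans (lerD b3 b2).
have -> : w t0 * ((M - \sum_(k | k != k0) C0 k) * s) = (\sum_(t | t != t0) w t * C t + 1) * s.
  rewrite /M; have := w_gt0 t0; move: (\sum_(t | t != t0) _) (\sum_(k | k != k0) _) => x y wp.
  by field; rewrite gt_eqF.
by rewrite -mulr_suml; move: (\sum_(t | t != t0) _) => x; lra.
Unshelve. all: by end_near.
Qed.

(* A maximum of the volume can only lie on the boundary of the angle polytope if
   each tetrahedron is either nondegenerate or flat, with angles 0, 0, pi. *)
Lemma critical_angles (t0 : T) thp : feasible thp -> (forall t k, 0 < thp t k) ->
  (forall th, feasible th ->
    (forall t, (forall k, 0 < th t k) \/ exists k, th t k = pi) ->
    (forall t k, 0 < th t k) \/ (forall t, exists k, th t k = pi)) ->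
  exists th mu nu, [/\ feasible th, forall t k, 0 < th t k &
    forall t k, w t * ln (sin (th t k)) = mu t + \sum_e nu e * N e t k].
Proof.
move=> fthp thp0 dich.
have [th fth thmax] := volume_max (ex_intro _ thp fthp).
have [fth0 fths _] := fth; have [_ fthps _] := fthp.
have [th0|flat] := dich th fth (max_dichotomy fth fthp thp0 thmax); last first.
  have [k e] := flat t0.
  exfalso; have := thmax _ fthp; rewrite leNgt => /negP; apply.
  rewrite /volume; apply: ltr_sum => [|t _]; last first.
    rewrite ltr_pM2l //; move: (fths t) (fthps t); rewrite !big_ord3 => e1 e2.
    rewrite lob_flat //; first exact/lob_nonflat.
    have [k' e'] := flat t.
    by move: e'; case: (ord3_cases k') => [|[|]] -> ->; rewrite eqxx ?orbT.
  by apply/hasP; exists t0; rewrite ?mem_index_enum.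
exists th.
(* The angle sums of the tetrahedra are constraints too; their multipliers become [mu]. *)
pose N' (x : T + E) (j : T * 'I_3) : R :=
  match x with inl t => (j.1 == t)%:R | inr e => N e j.1 j.2 end.
have [|nu Hnu] := @lagrange_multipliers _ _ _ N' (fun j => w j.1 * ln (sin (th j.1 j.2))).
  move=> v Hv; have tv : tangent (fun t k => v (t, k)).
    split=> [t|e].
      rewrite -[RHS](Hv (inl t)); transitivity (\sum_t' \sum_k (t' == t)%:R * v (t', k)); last first.
        by rewrite pair_bigA; apply: eq_bigr => -[].
      rewrite (bigD1 t) //= [X in _ + X]big1 ?addr0 => [|t' /negbTE ->]; last first.
        by rewrite big1 // => k _; rewrite mul0r.
      by apply: eq_bigr => k _; rewrite eqxx mul1r.
    by rewrite -[RHS](Hv (inr e)) pair_bigA; apply: eq_bigr => -[].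
  rewrite -[RHS](stationary fth th0 thmax tv).
  under [RHS]eq_bigr do rewrite mulr_sumr.
  by rewrite pair_bigA /=; apply: eq_bigr => -[t k] _ /=; rewrite mulrA.
exists (fun t => nu (inl t)), (fun e => nu (inr e)); split=> // t k.
rewrite (Hnu (t, k)) /= big_sumType /= (bigD1 t) //= eqxx mulr1; congr (_ + _).
by rewrite big1 ?addr0 // => t' /negbTE; rewrite eq_sym => ->; rewrite mulr0.
Qed.

End Variational.

(** [z k] is half a second difference of [X], so the sum leaves only the last and the first of the
    first differences. *)
Lemma telescope2 (R : numFieldType) (X z : nat -> R) (n : nat) :
  (forall k, (k < n)%N -> z k = (X k + X k.+2) / 2 - X k.+1) ->
  2 * \sum_(k < n) z k = X n.+1 - X n - X 1%N + X 0%N.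
Proof.
elim: n => [|n IH] H; first by rewrite big_ord0; ring.
rewrite big_ord_recr /= mulrDr IH => [|k kn]; last by apply: H; rewrite ltnW.
by rewrite H //; field.
Qed.

(** * Angles in a layered solid torus *)

Section Convex.
Variables (R : realFieldType) (n : nat) (X : nat -> R).
Hypothesis X_end : X n.+1 = 0.
Hypothesis X_ge0 : forall k, 0 <= X k.
Hypothesis X_convex : forall k, (k < n)%N -> 2 * X k.+1 <= X k + X k.+2.

(** Backward induction: the last difference is at most 0 because [X] is nonnegative and ends with 0,
    and convexity passes this on to the earlier ones. *)
Lemma convex_nonincr k : (k <= n)%N -> X k.+1 <= X k.
Proof.
move=> kn; have [m e] : exists m, n = (m + k)%N by exists (n - k)%N; lia.
elim: m k e kn => [|m IH] k e kn; first by have -> : k = n; [lia | rewrite X_end].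
have kn' : (k < n)%N by lia.
have h : X k.+2 <= X k.+1 by apply: IH; lia.
by have := X_convex kn'; lra.
Qed.

(** The differences increase and are at most 0, so after a zero difference the sequence stays
    constant up to its end value 0. *)
Lemma convex_const k : (k <= n)%N -> X k.+1 = X k -> X k = 0.
Proof.
move=> kn; have [m e] : exists m, n = (m + k)%N by exists (n - k)%N; lia.
elim: m k e kn => [|m IH] k e kn h; first by rewrite -h -X_end; congr (X _); lia.
have kn' : (k < n)%N by lia.
rewrite -h; apply: IH; [lia|lia|].
by have := X_convex kn'; have := convex_nonincr kn'; lra.
Qed.

End Convex.

(* The layers of one solid torus, with angles x_k, y_k, z_k; b0, d0, d1, d2 are angles of the
   core.  The edge equations make X convex, hence nonincreasing since it ends with 0. *)
Section LayeredSide.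
Variables (R : realType) (n : nat) (x y z : nat -> R) (b0 d0 d1 d2 : R).
Notation X := (fun k => if k is j.+1 then x j else b0 + 2 * d1).
Hypotheses (b00 : 0 <= b0) (b0pi : b0 <= pi) (d00 : 0 <= d0) (d10 : 0 <= d1) (d20 : 0 <= d2).
Hypothesis d_sum : d0 + d1 + d2 = pi.
Hypotheses (x0 : forall k, 0 <= x k) (y0 : forall k, 0 <= y k) (z0 : forall k, 0 <= z k).
Hypothesis x_end : forall k, (n <= k)%N -> x k = 0.
Hypothesis t_sum : forall k, (k < n)%N -> x k + y k + z k = pi.
Hypothesis inner : forall k, (k < n)%N -> X k + 2 * y k + X k.+2 = 2 * pi.
Hypothesis outer : 2 * d2 + 2 * (\sum_(k < n) z k) + X n = 2 * pi.

Lemma layer_z k : (k < n)%N -> z k = (X k + X k.+2) / 2 - X k.+1.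
Proof. by move=> kn; have := inner kn; have := t_sum kn => /=; lra. Qed.

(** The sum of the [z k] telescopes in the outer equation, which leaves only [x 0] and core
    angles. *)
Lemma layer_x0 : x 0%N = b0 - 2 * d0.
Proof.
have := outer; rewrite (telescope2 layer_z) (x_end (leqnn n)).
by have := d_sum; move: (X n) => a; lra.
Qed.

Let Xe : X n.+1 = 0. Proof. exact: x_end. Qed.
Let X0 k : 0 <= X k. Proof. by case: k => [|k] /=; [move: b00 d10; lra | exact: x0]. Qed.
Let Xc k : (k < n)%N -> 2 * X k.+1 <= X k + X k.+2.
Proof. by move=> kn; have := layer_z kn; have := z0 k => /=; lra. Qed.

Let nonincr k : (k <= n)%N -> X k.+1 <= X k.
Proof. exact: (convex_nonincr (X := X) Xe X0 Xc). Qed.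
Let const k : (k <= n)%N -> X k.+1 = X k -> X k = 0.
Proof. exact: (convex_const (X := X) Xe X0 Xc). Qed.

(** The angle d0 = pi would make [x 0] negative. For d1 = pi the first inner equation, or [n = 0],
    gives b0 = 0; for d2 = pi the first difference vanishes, so convexity does. Then [x] starts at 0
    and does not increase. *)
Lemma side_flat : d0 = pi \/ d1 = pi \/ d2 = pi ->
  [/\ b0 = 0, d0 = 0 & forall k, x k = 0].
Proof.
have pi0 := @pi_gt0 R; move: b00 b0pi d00 d10 d20 d_sum => b0' b0pi' d0' d1' d2' ds H.
have [e1 e2] : b0 = 0 /\ d0 = 0.
  have hx := layer_x0; have := x0 0%N; case: H => [h|[h|h]] hx0.
  - by exfalso; lra.
  - have hd : d0 = 0 by lra.
    split=> //; case: (posnP n) => [e|npos].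
      by have h0 : x 0%N = 0 by [apply: x_end; rewrite e]; lra.
    by have := inner npos => /=; have := y0 0%N; have := x0 1%N; lra.
  - have hd : d0 = 0 by lra.
    split=> //; have := @const 0%N isT => /= h2; have h3 : b0 + 2 * d1 = 0 by apply: h2; lra.
    by lra.
split=> //; elim=> [|k IH]; first by rewrite layer_x0; lra.
have [kn|kn] := leqP n k.+1; first exact: x_end.
by have := nonincr (ltnW kn) => /=; rewrite IH; have := x0 k.+1; lra.
Qed.

(** If [X] dropped to 0 right after X j > 0, layer j would have z = pi and X j = 2 pi, too large for
    an angle, or for the core when j = 0. A layer with x = pi would make the previous x equal to pi
    and hence, by convexity, 0; for the first layer [layer_x0] excludes it. *)
Lemma side_pos : 0 < d0 -> 0 < d1 -> 0 < d2 ->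
  (forall k, (k < n)%N -> [/\ 0 < x k, 0 < y k & 0 < z k] \/ x k = pi \/ y k = pi \/ z k = pi) ->
  0 < b0 /\ forall k, (k < n)%N -> [/\ 0 < x k, 0 < y k & 0 < z k].
Proof.
have pi0 := @pi_gt0 R; move: b00 b0pi d_sum => b0' b0pi' ds p0 p1 p2 dich.
have hx := layer_x0; have hx0 := x0 0%N.
split=> [|k kn]; first lra.
have Xpos j : (j <= n)%N -> 0 < X j.
  elim: j => [|j IH] jn; first lra.
  have Xj := IH (ltnW jn); have i := inner jn; have ts := t_sum jn; have ni := nonincr jn.
  rewrite lt_neqAle x0 andbT; apply/eqP => /esym e; have := X0 j.+2.
  case: (dich _ jn) => [[h _ _]|[h|[h|h]]]; move: i ni Xj => /=; rewrite ?e => i ni Xj x2; [lra|lra|lra|].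
  have x20 : x j.+1 = 0 by lra.
  case: j => [|j] in jn Xj IH i ts e h ni x2 x20 *; first by have := y0 0%N; lra.
  by have := y0 j.+1; have := t_sum (ltnW jn); have := y0 j; have := z0 j; lra.
have xk : 0 < x k by exact: (Xpos k.+1 kn).
case: (dich k kn) => // h; have ts := t_sum kn; have yk := y0 k; have zk := z0 k.
have xpi : x k = pi by lra.
have yk0 : y k = 0 by lra.
exfalso; have i := inner kn; rewrite yk0 in i.
case: k => [|k] in kn xk h ts yk zk xpi yk0 i *; first by rewrite xpi in hx; lra.
have kn' : (k < n)%N by exact: ltnW.
have xk' : x k <= pi by have := t_sum kn'; have := y0 k; have := z0 k; lra.
have := nonincr kn => /=; rewrite /= in i; rewrite xpi => h2.
have := @const k.+1 (ltnW kn) => /= h3; have h4 : x k = 0 by apply: h3; lra.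
lra.
Qed.

End LayeredSide.

(** * The reduced angle equations *)

Section Reduced.
Variables (R : realType) (n : bool -> nat).

(* The triangulation T_K(p,q) up to the symmetries that exchange Delta_1 and Delta_2, and
   Delta_4 and Delta_5.  For the torus 1 (s = true) and the torus 2 (s = false), [n s] is the
   number of layers; [inl (false, s)] is Delta_3 resp. Delta_0, [inl (true, s)] is the pair
   Delta_4, Delta_5 resp. Delta_1, Delta_2, counted with weight 2.  The edge [Some (s, k)] is
   O_k, with P = O_(n s + 1), and [None] stands for the two edge classes off the tori. *)
Definition rtet := ((bool * bool) + {s : bool & 'I_(n s)})%type.
Definition rlabel := option (bool * nat).
Definition redge := option {s : bool & 'I_(n s).+2}.

Definition rcode (e : redge) : rlabel := omap (fun e : {s : bool & 'I_(n s).+2} => (tag e, nat_of_ord (tagged e))) e.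

Definition rtail s j : rtet := inr (Tagged (fun s => 'I_(n s)) (j : 'I_(n s))).

(* The edges of the three pairs of opposite edges of a tetrahedron. *)
Definition rlab (t : rtet) (k : 'I_3) : rlabel * rlabel :=
  match t with
  | inl (b, s) => match b, val k with
    | false, 0 => (Some (s, 0), Some (s, 1))
    | false, 1 => (Some (~~ s, 0), Some (~~ s, 0))
    | true, 0 => (Some (s, 0), Some (~~ s, 0))
    | true, 1 => (Some (~~ s, 0), Some (s, 1))
    | true, _ => (Some (s, (n s).+1), None)
    | _, _ => (None, None) end
  | inr (existT s j) => match val k with
    | 0 => (Some (s, val j), Some (s, j.+2))
    | 1 => (Some (s, j.+1), Some (s, j.+1))
    | _ => (Some (s, (n s).+1), Some (s, (n s).+1)) end
  end%N.

Definition rweight (t : rtet) : R := if t is inl (true, _) then 2 else 1.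

Definition rinc (e : rlabel) t k : R :=
  rweight t * (((rlab t k).1 == e)%:R + ((rlab t k).2 == e)%:R).

(** The two classes behind [None] have equal angle sums, so 4 pi in total means 2 pi for each. *)
Definition rangle (e : redge) : R := if e is Some _ then 2 * pi else 4 * pi.

Variable th : rtet -> 'I_3 -> R.

(** Extended by 0 beyond the last layer, where the convex sequence ends. *)
Definition tl s (k : nat) (i : 'I_3) : R :=
  if insub k is Some j then th (rtail (j : 'I_(n s))) i else 0.

Lemma tl_ord s (j : 'I_(n s)) i : tl s j i = th (rtail j) i.
Proof. by rewrite /tl valK. Qed.

Lemma tl_ge s k i : (n s <= k)%N -> tl s k i = 0.
Proof. by move=> h; rewrite /tl insubF // ltnNge h. Qed.

Lemma sum_rtet (F : rtet -> R) s :
  \sum_t F t = F (inl (false, s)) + F (inl (false, ~~ s)) + F (inl (true, s)) + F (inl (true, ~~ s))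
    + \sum_(j < n s) F (rtail j) + \sum_(j < n (~~ s)) F (rtail j).
Proof.
have B (G : bool -> R) : \sum_b G b = G s + G (~~ s).
  by rewrite big_bool; case: s => //=; rewrite addrC.
have E1 : \sum_p F (inl p) = \sum_b \sum_s F (inl (b, s)).
  by rewrite pair_bigA; apply: eq_bigr => -[].
have E2 : \sum_p F (inr p) = \sum_s \sum_(j < n s) F (rtail j).
  rewrite (@sig_big_dep _ _ _ _ (fun s => 'I_(n s)) xpredT (fun _ => xpredT) (fun s j => F (rtail j))).
  by apply: eq_bigr => -[].
by rewrite big_sumType /= E1 E2 big_bool /= !B; ring.
Qed.

Lemma tl_sum_at s a i k : \sum_(j < n s) (j + a == k)%N%:R * th (rtail j) i =
  if (a <= k)%N then tl s (k - a) i else 0.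
Proof.
case: (leqP a k) => ak; last first.
  by apply: big1 => j _; rewrite (_ : (_ == _) = false) ?mul0r //; lia.
have [kn|kn] := ltnP (k - a) (n s); last first.
  rewrite tl_ge //; apply: big1 => j _; rewrite (_ : (_ == _) = false) ?mul0r //.
  by have := ltn_ord j; lia.
rewrite (bigD1 (Ordinal kn)) //= (_ : (_ == _) = true) ?mul1r; last lia.
rewrite big1 ?addr0 => [|j /eqP jk]; last first.
  rewrite (_ : (_ == _) = false) ?mul0r //; apply/eqP => h; apply: jk; apply: val_inj => /=; lia.
by rewrite -tl_ord.
Qed.

Lemma edge_sum_layered s k : \sum_t \sum_i rinc (Some (s, k)) t i * th t i =
  (0 == k)%N%:R * (th (inl (false, s)) 0 + 2 * th (inl (false, ~~ s)) 1 + 2 * th (inl (true, s)) 0 +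
    2 * th (inl (true, ~~ s)) 0 + 2 * th (inl (true, ~~ s)) 1) +
  (1 == k)%N%:R * (th (inl (false, s)) 0 + 2 * th (inl (true, s)) 1) +
  ((n s).+1 == k)%N%:R * (2 * th (inl (true, s)) 2%:R + 2 * \sum_(j < n s) tl s j 2%:R) +
  (tl s k 0 + (if (2 <= k)%N then tl s (k - 2) 0 else 0) +
   2 * (if (1 <= k)%N then tl s (k - 1) 1 else 0)).
Proof.
have e1 a : ((Some (s, a) : rlabel) == Some (s, k)) = (a == k).
  by rewrite (inj_eq Some_inj) xpair_eqE eqxx.
have e2 a : ((Some (~~ s, a) : rlabel) == Some (s, k))%:R = 0 :> R.
  by rewrite (inj_eq Some_inj) xpair_eqE; case: s {e1}.
have e3 : ((None : rlabel) == Some (s, k)) = false by [].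
rewrite (sum_rtet _ s) !big_ord3 /rinc /= !negbK !e1 !e2 ?e3 ?eqxx.
rewrite [X in _ + X]big1 => [|j _]; last by rewrite big_ord3 /= !e2 /=; ring.
have -> : \sum_(j < n s) \sum_i rinc (Some (s, k)) (rtail j) i * th (rtail j) i =
  \sum_(j < n s) (j + 0 == k)%N%:R * th (rtail j) 0 + \sum_(j < n s) (j + 2 == k)%N%:R * th (rtail j) 0
  + 2 * (\sum_(j < n s) (j + 1 == k)%N%:R * th (rtail j) 1)
  + ((n s).+1 == k)%N%:R * (2 * \sum_(j < n s) tl s j 2%:R).
  rewrite !mulr_sumr -!big_split /=; apply: eq_bigr => j _.
  by rewrite big_ord3 /rinc /= !e1 tl_ord addn0 addn2 addn1; ring.
by rewrite !tl_sum_at leq0n subn0; ring.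
Qed.

Lemma edge_sum_core : \sum_t \sum_i rinc None t i * th t i =
  2 * \sum_s (th (inl (false, s)) 2%:R + th (inl (true, s)) 2%:R).
Proof.
rewrite (sum_rtet _ false) big_bool !big_ord3 /rinc /=.
rewrite !big1 => [|j _|j _]; rewrite ?big_ord3 /=; ring.
Qed.

Notation rfeasible := (feasible (fun e => rinc (rcode e)) rangle th).

(** The convex sequence of the solid torus; index 0 holds what the core contributes to O_1. *)
Definition layerX s k := if k is j.+1 then tl s j 0
  else th (inl (false, s)) 0 + 2 * th (inl (true, s)) 1.

Lemma edge_sum_inner s k : (k < n s)%N -> \sum_t \sum_i rinc (Some (s, k.+1)) t i * th t i =
  layerX s k + 2 * tl s k 1 + layerX s k.+2.
Proof.
move=> kn; rewrite edge_sum_layered [((n s).+1 == _)%N]eqSS (gtn_eqF kn).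
by case: k {kn} => [|k] /=; rewrite ?subSS ?subn0; ring.
Qed.

Lemma edge_sum_outer s : \sum_t \sum_i rinc (Some (s, (n s).+1)) t i * th t i =
  2 * th (inl (true, s)) 2%:R + 2 * (\sum_(j < n s) tl s j 2%:R) + layerX s (n s).
Proof.
rewrite edge_sum_layered eqxx !subSS subn0 (tl_ge _ (leqnSn _)) (tl_ge _ (leqnn _)) ltnS.
by case: (n s) (\sum_(j < _) _) => [|k] S /=; rewrite ?subSS ?subn0; ring.
Qed.

Lemma edge_sum_first s : \sum_t \sum_i rinc (Some (s, 0%N)) t i * th t i =
  th (inl (false, s)) 0 + 2 * th (inl (false, ~~ s)) 1 + 2 * th (inl (true, s)) 0 +
    2 * th (inl (true, ~~ s)) 0 + 2 * th (inl (true, ~~ s)) 1 + layerX s 1.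
Proof. by rewrite edge_sum_layered /=; ring. Qed.

Hypothesis fth : rfeasible.

Lemma rfeasible_edge s k : (k <= (n s).+1)%N ->
  \sum_t \sum_i rinc (Some (s, k)) t i * th t i = 2 * pi.
Proof.
move=> kn; case: fth => _ _ /(_ (Some (Tagged _ (Ordinal (kn : (k < (n s).+2)%N))))).
by [].
Qed.

Lemma rfeasible_sum3 t : th t 0 + th t 1 + th t 2%:R = pi.
Proof. by case: fth => _ + _ => /(_ t); rewrite big_ord3. Qed.

Lemma rfeasible_ge0 t k : 0 <= th t k.
Proof. by case: fth. Qed.

Lemma tl_ge0 s k i : 0 <= tl s k i.
Proof. by rewrite /tl; case: insub => // j; exact: rfeasible_ge0. Qed.

Lemma tl_sum s k : (k < n s)%N -> tl s k 0 + tl s k 1 + tl s k 2%:R = pi.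
Proof. by move=> kn; rewrite -[k]/(val (Ordinal kn)) !tl_ord; exact: rfeasible_sum3. Qed.

Let le_pi t k : th t k <= pi. Proof. exact: feasible_le_pi fth. Qed.

Let inner s k (kn : (k < n s)%N) : layerX s k + 2 * tl s k 1 + layerX s k.+2 = 2 * pi.
Proof. by rewrite -edge_sum_inner // rfeasible_edge // ltnS ltnW. Qed.

Let outer s : 2 * th (inl (true, s)) 2%:R + 2 * (\sum_(j < n s) tl s j 2%:R) + layerX s (n s) = 2 * pi.
Proof. by rewrite -edge_sum_outer rfeasible_edge. Qed.

(** The edge equation of O_0, with the angle of the first layer eliminated by [layer_x0]. *)
Lemma core_relation s :
  th (inl (false, ~~ s)) 1 + th (inl (false, s)) 0 = th (inl (true, ~~ s)) 2%:R.
Proof.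
have x0 := layer_x0 (rfeasible_sum3 _) (@tl_ge s ^~ 0) (@tl_sum s) (@inner s) (@outer s).
have := rfeasible_edge (leq0n (n s).+1); rewrite edge_sum_first /=.
by have := rfeasible_sum3 (inl (true, ~~ s)); lra.
Qed.

Definition flat t := exists k, th t k = pi.

Hypothesis dich : forall t, (forall k, 0 < th t k) \/ flat t.

Let flat3 t : flat t -> th t 0 = pi \/ th t 1 = pi \/ th t 2%:R = pi.
Proof. by case=> k; case: (ord3_cases k) => [|[|]] ->; auto. Qed.

Let flat_of0 t k : th t k = 0 -> flat t.
Proof. by move=> e; case: (dich t) => // /(_ k); rewrite e ltxx. Qed.

Lemma rside_flat s : flat (inl (true, s)) ->
  [/\ th (inl (false, s)) 0 = 0, th (inl (true, s)) 0 = 0 & forall j : 'I_(n s), flat (rtail j)].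
Proof.
move=> /flat3 fl.
have [h1 h2 h3] := side_flat (rfeasible_ge0 _ _) (le_pi _ _) (rfeasible_ge0 _ _) (rfeasible_ge0 _ _)
  (rfeasible_ge0 _ _) (rfeasible_sum3 _) (@tl_ge0 s ^~ 0) (@tl_ge0 s ^~ 1) (@tl_ge0 s ^~ 2%:R)
  (@tl_ge s ^~ 0) (@tl_sum s) (@inner s) (@outer s) fl.
by split=> // j; apply: (@flat_of0 _ 0); rewrite -tl_ord.
Qed.

Lemma rside_pos s : (forall k, 0 < th (inl (true, s)) k) ->
  0 < th (inl (false, s)) 0 /\ forall (j : 'I_(n s)) k, 0 < th (rtail j) k.
Proof.
move=> p; have [|h1 h2] := side_pos (rfeasible_ge0 _ _) (le_pi _ _) (rfeasible_ge0 _ _)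
  (rfeasible_sum3 _) (@tl_ge0 s ^~ 0) (@tl_ge0 s ^~ 1) (@tl_ge0 s ^~ 2%:R)
  (@tl_ge s ^~ 0) (@tl_sum s) (@inner s) (@outer s) (p 0) (p 1) (p 2%:R).
  move=> k kn; rewrite -[k]/(val (Ordinal kn)) !tl_ord.
  by case: (dich (rtail (Ordinal kn))) => [h|/flat3]; [left | right].
split=> // j k; have := h2 j (ltn_ord j); rewrite !tl_ord.
by case: (ord3_cases k) => [|[|]] -> [].
Qed.

(** The tetrahedron [inl (true, s)] decides the layers on its side. By [core_relation] the two sides
    cannot differ, and positive sides make the tetrahedra [inl (false, s)] positive. *)
Lemma rdichotomy : (forall t k, 0 < th t k) \/ (forall t, flat t).
Proof.
have mixed s : flat (inl (true, s)) -> (forall k, 0 < th (inl (true, ~~ s)) k) -> False.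
  move=> fs ps; have [b0 d0 _] := rside_flat fs; have [a0 _] := rside_pos ps.
  have fb := flat3 (flat_of0 b0); have fd := flat3 fs.
  have r1 := core_relation s; have r2 := core_relation (~~ s); rewrite negbK in r2.
  have := ps 2%:R; have := le_pi (inl (false, ~~ s)) 0.
  have := rfeasible_sum3 (inl (false, ~~ s)); have := rfeasible_ge0 (inl (false, ~~ s)) 2%:R.
  have := rfeasible_sum3 (inl (false, s)); have := rfeasible_ge0 (inl (false, s)) 2%:R.
  have := rfeasible_ge0 (inl (false, s)) 1.
  have := rfeasible_sum3 (inl (true, s)); have := rfeasible_ge0 (inl (true, s)) 1.
  have := rfeasible_ge0 (inl (true, s)) 2%:R.
  have pp := @pi_gt0 R.
  by case: fb => [h|[h|h]]; case: fd => [h'|[h'|h']] => *; lra.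
have core_pos s : (forall b k, 0 < th (inl (true, b)) k) -> forall k, 0 < th (inl (false, s)) k.
  move=> p; have [h _] := rside_pos (p s); case: (dich (inl (false, s))) => // /flat3 fb.
  have r1 := core_relation s; have r2 := core_relation (~~ s); rewrite negbK in r2.
  have := rfeasible_sum3 (inl (false, s)).
  have := rfeasible_ge0 (inl (false, s)) 1; have := rfeasible_ge0 (inl (false, s)) 2%:R.
  have := rfeasible_ge0 (inl (false, ~~ s)) 1.
  have := p (~~ s) 0; have := p (~~ s) 1; have := rfeasible_sum3 (inl (true, ~~ s)).
  have pp := @pi_gt0 R.
  by case: fb => [h'|[h'|h']] => *; exfalso; lra.
have core_flat s : (forall b, flat (inl (true, b))) -> flat (inl (false, s)).
  by move=> fl; have [h _ _] := rside_flat (fl s); exact: flat_of0 h.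
case: (dich (inl (true, false))) => h1; case: (dich (inl (true, true))) => h2.
- left; have p b k : 0 < th (inl (true, b)) k by case: b.
  by move=> [[[] b]|[b j]] k; [exact: p|exact: core_pos|have [_] := rside_pos (p b); exact].
- by exfalso; exact: (mixed true).
- by exfalso; exact: (mixed false).
- right; have p b : flat (inl (true, b)) by case: b.
  by move=> [[[] b]|[b j]]; [exact: p|exact: core_flat|have [_ _] := rside_flat (p b); exact].
Qed.

End Reduced.

Section Solution.
Variables (R : realType) (n : bool -> nat).
Notation rtet := (rtet n).
Notation rfeasible := (feasible (fun e => @rinc R n (rcode e)) (@rangle R n)).

(** [xi] is [eps] times a square that vanishes at the end, so its second differences are constant
    and positive; pi / 12 is small enough for the other angles to be positive. For [n s = 0] the
    convention for the inverse of 0 makes [xi] vanish. *)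
Let eps : R := pi / 12.
Let xi s (j : nat) : R := eps * (((n s)%:R - j%:R) / (n s)%:R) ^+ 2.
Let XX s (k : nat) := if k is j.+1 then xi s j else 2 * pi / 3 + xi s 0.

(* The angles x_j of the layers at O_j determine the other ones by the edge equations;
   positivity amounts to the strict convexity of x. *)
Definition interior_angles (t : rtet) (k : 'I_3) : R :=
  match t with
  | inl (false, _) => pi / 3
  | inl (true, s) => match val k with
    | 0%N => (pi / 3 - xi s 0%N) / 2 | 1%N => (pi / 3 + xi s 0%N) / 2 | _ => 2 * pi / 3 end
  | inr (existT s j) => match val k with
    | 0%N => xi s j | 1%N => pi - (XX s j + XX s j.+2) / 2 | _ => (XX s j + XX s j.+2) / 2 - XX s j.+1 end
  end.
Notation th := interior_angles.

Let pi0 := @pi_gt0 R.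

Let xi_bound s j : (j <= n s)%N -> 0 <= xi s j <= eps.
Proof.
move=> jn; have [e|np] := posnP (n s).
  by rewrite /xi e invr0 mulr0 expr0n mulr0 lexx /eps; move: pi0; lra.
have n0 : 0 < (n s)%:R :> R by rewrite ltr0n.
have h1 : 0 <= ((n s)%:R - j%:R) / (n s)%:R :> R by rewrite divr_ge0 ?subr_ge0 ?ler_nat // ltW.
have h2 : ((n s)%:R - j%:R) / (n s)%:R <= 1 :> R by rewrite ler_pdivrMr // mul1r gerBl ler0n.
have e0 : 0 <= eps by rewrite /eps; move: pi0; lra.
rewrite /xi mulr_ge0 ?exprn_ge0 //= -[leRHS]mulr1 ler_wpM2l //.
by rewrite expr_le1.
Qed.

Let xi_gt0 s j : (j < n s)%N -> 0 < xi s j.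
Proof.
move=> jn; have np : (0 < n s)%N by apply: leq_ltn_trans jn.
rewrite /xi mulr_gt0 ?exprn_gt0 ?divr_gt0 ?subr_gt0 ?ltr_nat ?ltr0n //.
Qed.

Let xi_end s : xi s (n s) = 0.
Proof. by rewrite /xi subrr mul0r expr0n mulr0. Qed.

Lemma interior_gt0 t k : 0 < th t k.
Proof.
have e0 : eps = pi / 12 by [].
case: t => [[[] s]|[s j]] /=; last 1 first.
- have jn := ltn_ord j; have n0 : (n s)%:R != 0 :> R by rewrite pnatr_eq0; lia.
  have nj : xi s j > 0 by exact: xi_gt0.
  have /andP[b1 b2] := xi_bound jn; have /andP[b3 b4] := xi_bound (ltnW jn).
  case: (ord3_cases k) => [|[|]] -> /=; first exact: nj.
    move: jn nj b1 b2 b3 b4; case: (nat_of_ord j) => [|i] /= jn; first by move: pi0; lra.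
    by have /andP := xi_bound (ltnW (ltnW jn)); move: pi0 => ? [] *; lra.
  move: jn nj b1 b2 b3 b4; case: (nat_of_ord j) => [|i] /= jn; first by move: pi0; lra.
  move=> _ _ _ _ _.
  have -> : (xi s i + xi s i.+2) / 2 - xi s i.+1 = eps / (n s)%:R ^+ 2.
    by rewrite /xi -[i.+2]addn2 -[i.+1]addn1 !natrD; field.
  by rewrite divr_gt0 ?exprn_gt0 ?lt0r ?n0 //= ?ler0n // /eps; move: pi0; lra.
- have /andP[b1 b2] := xi_bound (leq0n (n s)).
  by case: (ord3_cases k) => [|[|]] -> /=; move: pi0; lra.
- by move: pi0; lra.
Qed.

Let layerX_interior s k : (k <= (n s).+1)%N -> layerX th s k = XX s k.
Proof.
case: k => [|k] kn /=; first by field.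
have [h|h] := ltnP k (n s); first by rewrite -{1}[k]/(val (Ordinal h)) tl_ord.
by rewrite tl_ge // (_ : k = n s) ?xi_end //; lia.
Qed.

Lemma interior_feasible : rfeasible th.
Proof.
split=> [t k|t|]; first exact/ltW/interior_gt0.
  by rewrite big_ord3; case: t => [[[] s]|[s j]] /=; field.
case=> [[s k]|] /=; last by rewrite edge_sum_core big_bool /=; field.
have := ltn_ord k; rewrite /rcode /=; case: (nat_of_ord k) => [|i] ih.
  by rewrite edge_sum_first layerX_interior //=; field.
have [h|h] := ltnP i (n s).
  rewrite edge_sum_inner // !layerX_interior //; try lia.
  by rewrite -{2}[i]/(val (Ordinal h)) tl_ord /=; field.
have -> : i = n s by lia.
rewrite edge_sum_outer layerX_interior // (telescope2 (X := XX s) (z := fun k => tl th s k 2%:R)) => [|j jn].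
  by rewrite [XX s (n s).+1]xi_end /=; move: (XX s (n s)) => a; field.
by rewrite -[X in tl _ _ X _]/(val (Ordinal jn)) tl_ord.
Qed.

(* The critical point equations make the sines of the angles of a tetrahedron
   proportional to products of opposite edge lengths [len], with one length per edge. *)
Lemma reduced_solution : exists (th : rtet -> 'I_3 -> R) (len : rlabel -> R) (r : rtet -> R),
  [/\ rfeasible th, forall t k, 0 < th t k, forall l, 0 < len l, forall t, 0 < r t &
    forall t k, sin (th t k) = r t * (len (rlab t k).1 * len (rlab t k).2)].
Proof.
have w0 (t : rtet) : 0 < rweight R t by case: t => [[[] s]|j] /=; rewrite ?ltr0n ?ltr01.
have [|th [mu [nu [fth th0 crit]]]] :=
    critical_angles w0 (inl (true, true)) interior_feasible interior_gt0.
  by move=> th fth dich; apply: rdichotomy.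
(* The logarithm of a length is a multiplier; a label of no edge gets length 1. The weight is a
   factor of [rinc], so it cancels from the lengths and only divides [mu]. *)
pose lnlen (l : rlabel) := \sum_e nu e * (l == rcode e)%:R.
exists th, (fun l => expR (lnlen l)), (fun t => expR (mu t / rweight R t)); split=> //.
- by move=> l; exact: expR_gt0.
- by move=> t; exact: expR_gt0.
move=> t k; have wt := w0 t; rewrite -!expRD.
have -> : mu t / rweight R t + (lnlen (rlab t k).1 + lnlen (rlab t k).2) = ln (sin (th t k)).
  apply: (mulfI (lt0r_neq0 wt)); rewrite crit mulrDr mulrC divfK ?gt_eqF //; congr (_ + _).
  rewrite -big_split mulr_sumr /=; apply: eq_bigr => e _; rewrite /rinc; ring.
rewrite lnK // posrE sin_gt0_pi // th0 /=; exact: feasible_lt_pi fth (th0 t).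
Qed.

End Solution.

(* Unlike the numerals of the ring 'I_4, these terms reduce. *)
Local Notation v0 := (@Ordinal 4 0 isT).
Local Notation v1 := (@Ordinal 4 1 isT).
Local Notation v2 := (@Ordinal 4 2 isT).
Local Notation v3 := (@Ordinal 4 3 isT).
Local Notation c0 := (@Ordinal 6 0 isT).
Local Notation c1 := (@Ordinal 6 1 isT).
Local Notation c2 := (@Ordinal 6 2 isT).
Local Notation c3 := (@Ordinal 6 3 isT).
Local Notation c4 := (@Ordinal 6 4 isT).
Local Notation c5 := (@Ordinal 6 5 isT).
Local Notation w0 := (@Ordinal 3 0 isT).
Local Notation w1 := (@Ordinal 3 1 isT).
Local Notation w2 := (@Ordinal 3 2 isT).

Lemma ord4E (i : 'I_4) : [\/ i = v0, i = v1, i = v2 | i = v3].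
Proof.
by case: i => [[|[|[|[|//]]]] h]; [apply: Or41|apply: Or42|apply: Or43|apply: Or44]; apply: val_inj.
Qed.

Lemma ord6E (i : 'I_6) : [\/ i = c0, i = c1, i = c2 | i = c3] \/ (i = c4 \/ i = c5).
Proof.
case: i => [[|[|[|[|[|[|//]]]]]] h]; [left; apply: Or41|left; apply: Or42|left; apply: Or43|
  left; apply: Or44|right; left|right; right]; by apply: val_inj.
Qed.

(** * The face pairings of T_K(p,q) *)

Section DoubleTwist.
Variable n : bool -> nat.

Definition ktet : finType := ('I_6 + ('I_(n true) + 'I_(n false)))%type.

Definition torusA (s : bool) : ktet := inl (if s then c4 else c1).
Definition torusB (s : bool) : ktet := inl (if s then c5 else c2).

Definition inlayer s : 'I_(n s) -> ktet :=
  match s with true => fun j => inr (inl j) | false => fun j => inr (inr j) end.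

(** Indexed by natural numbers for arithmetic on the index, with a filler out of range. *)
Definition layer s (k : nat) : ktet :=
  if insub k is Some j then inlayer (j : 'I_(n s)) else torusA s.

Definition vmap (a b c d : 'I_4) (i : 'I_4) : 'I_4 :=
  match val i with 0%N => a | 1%N => b | 2%N => c | _ => d end.

(** The core pairings in both directions, with the opposite vertices added. The face opposite to 1
    of Delta_1, Delta_2, Delta_4 and Delta_5 is on a torus: it meets the first layer, or its partner
    by the fold if there is no layer. *)
Definition core_glue (i : 'I_6) (l : 'I_4) : ktet * ('I_4 -> 'I_4) :=
  match val i, val l with
  | 0%N, 0%N => (inl c5, vmap v0 v2 v1 v3) | 0%N, 1%N => (inl c3, vmap v1 v2 v3 v0)
  | 0%N, 2%N => (inl c1, vmap v2 v0 v3 v1) | 0%N, _ => (inl c2, vmap v0 v2 v1 v3)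
  | 1%N, 0%N => (inl c4, vmap v0 v2 v1 v3)
  | 1%N, 1%N => if n false == 0%N then (inl c2, vmap v0 v1 v3 v2) else (layer false 0, vmap v2 v3 v1 v0)
  | 1%N, 2%N => (inl c2, vmap v3 v1 v2 v0) | 1%N, _ => (inl c0, vmap v1 v3 v0 v2)
  | 2%N, 0%N => (inl c3, vmap v0 v3 v2 v1)
  | 2%N, 1%N => if n false == 0%N then (inl c1, vmap v0 v1 v3 v2) else (layer false 0, vmap v3 v2 v0 v1)
  | 2%N, 2%N => (inl c1, vmap v3 v1 v2 v0) | 2%N, _ => (inl c0, vmap v0 v2 v1 v3)
  | 3%N, 0%N => (inl c2, vmap v0 v3 v2 v1) | 3%N, 1%N => (inl c5, vmap v0 v3 v2 v1)
  | 3%N, 2%N => (inl c0, vmap v3 v0 v1 v2) | 3%N, _ => (inl c4, vmap v2 v1 v0 v3)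
  | 4%N, 0%N => (inl c1, vmap v0 v2 v1 v3)
  | 4%N, 1%N => if n true == 0%N then (inl c5, vmap v0 v1 v3 v2) else (layer true 0, vmap v2 v3 v1 v0)
  | 4%N, 2%N => (inl c5, vmap v3 v1 v2 v0) | 4%N, _ => (inl c3, vmap v2 v1 v0 v3)
  | _, 0%N => (inl c0, vmap v0 v2 v1 v3)
  | _, 1%N => if n true == 0%N then (inl c4, vmap v0 v1 v3 v2) else (layer true 0, vmap v3 v2 v0 v1)
  | _, 2%N => (inl c4, vmap v3 v1 v2 v0) | _, _ => (inl c3, vmap v0 v3 v2 v1)
  end.

(** Faces opposite to 2 and 3 lead back to the core, those opposite to 0 and 1 on to the next layer;
    in the last layer these two are folded together. *)
Definition layer_glue s (k : nat) (l : 'I_4) : ktet * ('I_4 -> 'I_4) :=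
  match val l with
  | 0%N => if (k.+1 < n s)%N then (layer s k.+1, vmap v2 v1 v0 v3) else (layer s k, vmap v1 v3 v0 v2)
  | 1%N => if (k.+1 < n s)%N then (layer s k.+1, vmap v0 v3 v2 v1) else (layer s k, vmap v2 v0 v3 v1)
  | 2%N => if k is j.+1 then (layer s j, vmap v2 v1 v0 v3) else (torusB s, vmap v2 v3 v1 v0)
  | _ => if k is j.+1 then (layer s j, vmap v0 v3 v2 v1) else (torusA s, vmap v3 v2 v0 v1)
  end.

Definition kglue (t : ktet) (l : 'I_4) : ktet * ('I_4 -> 'I_4) :=
  match t with
  | inl i => core_glue i l
  | inr (inl j) => layer_glue true j l
  | inr (inr j) => layer_glue false j l
  end.

Lemma layerE s (j : 'I_(n s)) : layer s j = inlayer j.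
Proof. by rewrite /layer valK. Qed.

Lemma kglue_layer s k l : (k < n s)%N -> kglue (layer s k) l = layer_glue s k l.
Proof. by move=> h; rewrite -[k]/(val (Ordinal h)) layerE; case: s h. Qed.

Lemma ktet_cases (t : ktet) : (exists i, t = inl i) \/ exists s k, (k < n s)%N /\ t = layer s k.
Proof.
case: t => [i|[j|j]]; [by left; exists i|right..].
  by exists true, j; rewrite layerE.
by exists false, j; rewrite layerE.
Qed.

Lemma kglueK t l : let g := kglue t l in
  (kglue g.1 (g.2 l)).1 = t /\ forall i, (kglue g.1 (g.2 l)).2 (g.2 i) = i.
Proof.
case: (ktet_cases t) => [[i ->]|[s [k [kn ->]]]] /=; last first.
  rewrite kglue_layer //; case: (ord4E l) => ->; rewrite /layer_glue /=.
  - case: ifP => h /=; rewrite kglue_layer // /layer_glue /=.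
      by split=> // i; case: (ord4E i) => ->.
    by rewrite h; split=> // i; case: (ord4E i) => ->.
  - case: ifP => h /=; rewrite kglue_layer // /layer_glue /=.
      by split=> // i; case: (ord4E i) => ->.
    by rewrite h; split=> // i; case: (ord4E i) => ->.
  - case: k kn => [|k] kn /=.
      have -> : core_glue (if s then c5 else c2) (vmap v2 v3 v1 v0 v2) = (layer s 0, vmap v3 v2 v0 v1).
        by case: s kn => kn; rewrite /kglue /= /core_glue /= gtn_eqF.
      by split=> // i; case: (ord4E i) => ->.
    rewrite kglue_layer /layer_glue ?(ltnW kn) //= kn.
    by split=> // i; case: (ord4E i) => ->.
  - case: k kn => [|k] kn /=.
      have -> : core_glue (if s then c4 else c1) (vmap v3 v2 v0 v1 v3) = (layer s 0, vmap v2 v3 v1 v0).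
        by case: s kn => kn; rewrite /kglue /= /core_glue /= gtn_eqF.
      by split=> // i; case: (ord4E i) => ->.
    rewrite kglue_layer /layer_glue ?(ltnW kn) //= kn.
    by split=> // i; case: (ord4E i) => ->.
have tor s : (n s == 0)%N = false -> forall l, kglue (layer s 0) l = layer_glue s 0 l.
  by move=> h l'; rewrite kglue_layer // lt0n h.
case: (ord6E i) => [[]|[]] ->; case: (ord4E l) => ->; rewrite /core_glue /=;
  try case: ifP => h /=; rewrite ?tor // /kglue /core_glue /layer_glue /= ?h;
  by split=> // i'; case: (ord4E i') => ->.
Qed.

Lemma kglue_nofix t l : (kglue t l).1 = t -> (kglue t l).2 l != l.
Proof.
have lay0 s k i : (k < n s)%N -> layer s k <> inl i.
  by move=> h; rewrite -[k]/(val (Ordinal h)) layerE; case: s h.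
have layi s k k' : (k < n s)%N -> (k' < n s)%N -> layer s k = layer s k' -> k = k'.
  move=> h h'; rewrite -[k]/(val (Ordinal h)) -[k']/(val (Ordinal h')) !layerE.
  by case: s h h' => h h' [].
case: (ktet_cases t) => [[i ->]|[s [k [kn ->]]]]; last first.
  rewrite kglue_layer //; case: (ord4E l) => ->; rewrite /layer_glue /=.
  - by case: ifP => h //= /layi; lia.
  - by case: ifP => h //= /layi; lia.
  - by case: k kn => [|k] kn /= => [/esym/lay0|/layi]; lia.
  - by case: k kn => [|k] kn /= => [/esym/lay0|/layi]; lia.
case: (ord6E i) => [[]|[]] ->; case: (ord4E l) => -> //=; rewrite /core_glue /=;
  by case: ifP => //= /negbT; rewrite -lt0n => h /lay0; lia.
Qed.

Lemma ktet_connected : exists t0 : ktet, forall P : ktet -> Prop, P t0 ->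
  (forall t l, P t -> P (kglue t l).1) -> forall t, P t.
Proof.
exists (inl c0) => P P0 H.
have P5 : P (inl c5) by exact: (H _ v0 P0).
have P3 : P (inl c3) by exact: (H _ v1 P0).
have P1 : P (inl c1) by exact: (H _ v2 P0).
have P2 : P (inl c2) by exact: (H _ v3 P0).
have P4 : P (inl c4) by exact: (H _ v0 P1).
move=> t; case: (ktet_cases t) => [[i ->]|[s [k [kn ->]]]].
  by case: (ord6E i) => [[]|[]] ->.
elim: k kn => [|k IH] kn.
  have := H (torusA s) v1; case: s kn => kn; rewrite /torusA /kglue /= /core_glue /= gtn_eqF //; exact.
have kn' : (k < n s)%N by exact: ltnW.
by have := H _ v1 (IH kn'); rewrite (kglue_layer _ kn') /layer_glue /= kn.
Qed.

End DoubleTwist.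

(** * Edges of a tetrahedron and their labels *)

Definition edge_index (i j : 'I_4) : nat :=
  match val i, val j with
  | 0, 1 => 0 | 1, 0 => 0 | 0, 2 => 1 | 2, 0 => 1 | 0, 3 => 2 | 3, 0 => 2
  | 1, 2 => 3 | 2, 1 => 3 | 1, 3 => 4 | 3, 1 => 4 | 2, 3 => 5 | 3, 2 => 5 | _, _ => 6
  end%N.

(** Indices of opposite edges add up to 5, hence the palindrome. *)
Definition pair_index (e : nat) : nat := nth 0%N [:: 0; 1; 2; 2; 1; 0]%N e.

Lemma edge_indexC i j : edge_index i j = edge_index j i.
Proof. by case: (ord4E i) => ->; case: (ord4E j) => ->. Qed.

Lemma edge_index_opp i j k l : uniq [:: i; j; k; l] ->
  (edge_index i j < 6)%N /\ edge_index k l = (5 - edge_index i j)%N.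
Proof.
by case: (ord4E i) => ->; case: (ord4E j) => ->; case: (ord4E k) => ->; case: (ord4E l) => ->.
Qed.

Lemma pair_index_perm i j k l : uniq [:: i; j; k; l] ->
  perm_eq [:: pair_index (edge_index i j); pair_index (edge_index i k); pair_index (edge_index i l)]
    [:: 0; 1; 2]%N.
Proof.
by case: (ord4E i) => ->; case: (ord4E j) => ->; case: (ord4E k) => ->; case: (ord4E l) => ->.
Qed.

Section Labels.
Variable n : bool -> nat.
Notation ktet := (ktet n).

(* Lists indexed by the edges 01, 02, 03, 12, 13, 23. *)
Definition core_labels (i : 'I_6) : seq rlabel :=
  match val i with
  | 0 => [:: Some (false, 1); Some (true, 0); None; None; Some (true, 0); Some (false, 0)]
  | 1 | 2 => [:: Some (true, 0); Some (false, 1); Some (false, (n false).+1); None;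
              Some (true, 0); Some (false, 0)]
  | 3 => [:: None; Some (true, 1); Some (false, 0); Some (false, 0); Some (true, 0); None]
  | _ => [:: Some (false, 0); Some (true, 1); Some (true, (n true).+1); None;
              Some (false, 0); Some (true, 0)]
  end%N.

Definition layer_labels s (k : nat) : seq rlabel :=
  [:: Some (s, k); Some (s, (n s).+1); Some (s, k.+1); Some (s, k.+1); Some (s, (n s).+1);
      Some (s, k.+2)].

Definition labels (t : ktet) : seq rlabel :=
  match t with
  | inl i => core_labels i
  | inr (inl j) => layer_labels true j
  | inr (inr j) => layer_labels false j
  end.

Definition label t i j : rlabel := nth None (labels t) (edge_index i j).

Lemma labels_layer s k : (k < n s)%N -> labels (layer n s k) = layer_labels s k.
Proof. by move=> h; rewrite -[k]/(val (Ordinal h)) layerE; case: s h. Qed.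

Definition reduced (t : ktet) : rtet n :=
  match t with
  | inl i => match val i with
    | 0 => inl (false, false) | 1 | 2 => inl (true, false)
    | 3 => inl (false, true) | _ => inl (true, true) end%N
  | inr (inl j) => @rtail n true j
  | inr (inr j) => @rtail n false j
  end.

Lemma reduced_layer s k (h : (k < n s)%N) : reduced (layer n s k) = rtail (Ordinal h).
Proof. by rewrite -[k]/(val (Ordinal h)) layerE; case: s h. Qed.

(* The pairs of opposite edges 01-23, 02-13, 03-12, in the order used for the
   reduced tetrahedra. *)
Definition pair_order (t : ktet) : seq 'I_3 :=
  match t with
  | inl i => if val i == 3%N then [:: w2; w0; w1] else [:: w0; w1; w2]
  | _ => [:: w0; w2; w1]
  end.

Definition kpair t i j : 'I_3 := nth w0 (pair_order t) (pair_index (edge_index i j)).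

Lemma pair_order_layer s k : (k < n s)%N -> pair_order (layer n s k) = [:: w0; w2; w1].
Proof. by move=> h; rewrite -[k]/(val (Ordinal h)) layerE; case: s h. Qed.

(** Carries the sine relation of a reduced tetrahedron over to the edges of an actual one. *)
Lemma label_product (R : comRingType) (len : rlabel -> R) t i j k l : uniq [:: i; j; k; l] ->
  len (label t i j) * len (label t k l) =
  len (rlab (reduced t) (kpair t i j)).1 * len (rlab (reduced t) (kpair t i j)).2.
Proof.
move=> /edge_index_opp[]; rewrite /label /kpair => + ->.
case: (ktet_cases t) => [[c ->]|[s [m [h ->]]]].
  case: (edge_index i j) => [|[|[|[|[|[|//]]]]]] _;
  by case: (ord6E c) => [[]|[]] -> //=; rewrite mulrC.
rewrite labels_layer // (reduced_layer h) pair_order_layer //.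
by case: (edge_index i j) => [|[|[|[|[|[|//]]]]]] _ //=; rewrite mulrC.
Qed.

Lemma kpair_sum (R : nmodType) (f : 'I_3 -> R) t i j k l : uniq [:: i; j; k; l] ->
  f (kpair t i j) + f (kpair t i k) + f (kpair t i l) = \sum_m f m.
Proof.
move=> /pair_index_perm u; pose F m := f (nth w0 (pair_order t) m).
have : \sum_(m <- [:: pair_index (edge_index i j); pair_index (edge_index i k);
    pair_index (edge_index i l)]) F m = \sum_(m <- [:: 0; 1; 2]%N) F m by exact: perm_big.
rewrite /F /kpair !big_cons !big_nil !addr0 !addrA => -> /= {F}.
have e0 : (0 : 'I_3) = w0 by apply: val_inj.
have e1 : (1 : 'I_3) = w1 by apply: val_inj.
have e2 : (2 : 'I_3) = w2 by apply: val_inj.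
rewrite big_ord3 e2 e1 e0.
have h3 : f w0 + f w2 + f w1 = f w0 + f w1 + f w2 by rewrite addrAC.
case: t => [c|[c|c]] /=; rewrite ?h3 //; case: ifP => // _.
by rewrite -addrA addrC.
Qed.

(** Labels are constant on edge classes, so lengths read off from labels are respected by the face
    pairings. *)
Lemma label_glue t l i j : i != l -> j != l ->
  label (kglue t l).1 ((kglue t l).2 i) ((kglue t l).2 j) = label t i j.
Proof.
have lab0 s k : (n s == k)%N = false -> (0 = k)%N -> labels (layer n s 0) = layer_labels s 0.
  by move=> h e; rewrite labels_layer // lt0n e h.
case: (ktet_cases t) => [[c ->]|[s [k [kn ->]]]].
  case: (ord6E c) => [[]|[]] ->; case: (ord4E l) => ->; rewrite /kglue /core_glue /=;
  try (case: ifP => h; [move/eqP: h => h|rewrite /label ?(lab0 _ _ h erefl)]);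
  rewrite /label /=; case: (ord4E i) => ->; case: (ord4E j) => -> //= _ _; by rewrite h.
rewrite kglue_layer // /layer_glue; case: (ord4E l) => -> /=.
- case: ifP => h /=; rewrite /label !labels_layer //.
    by case: (ord4E i) => ->; case: (ord4E j) => ->.
  have e : n s = k.+1 by lia.
  by case: (ord4E i) => ->; case: (ord4E j) => -> //= _ _; rewrite ?e.
- case: ifP => h /=; rewrite /label !labels_layer //.
    by case: (ord4E i) => ->; case: (ord4E j) => ->.
  have e : n s = k.+1 by lia.
  by case: (ord4E i) => ->; case: (ord4E j) => -> //= _ _; rewrite ?e.
- case: k kn => [|k] kn /=; rewrite /label !labels_layer ?(ltnW kn) //.
    by case: s kn => kn; case: (ord4E i) => ->; case: (ord4E j) => ->.
  by case: (ord4E i) => ->; case: (ord4E j) => ->.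
- case: k kn => [|k] kn /=; rewrite /label !labels_layer ?(ltnW kn) //.
    by case: s kn => kn; case: (ord4E i) => ->; case: (ord4E j) => ->.
  by case: (ord4E i) => ->; case: (ord4E j) => ->.
Qed.

End Labels.

(** Identifies, component by component, pairings written with ring numerals and with ordinals that
    compute. *)
Ltac numerals := repeat lazymatch goal with
  | |- _ :: _ = _ :: _ => apply: congr2
  | |- _ ++ _ = _ ++ _ => apply: congr2
  | |- (_, _) = (_, _) => apply: congr2
  | |- inl _ = inl _ => apply: congr1
  | |- _ => first [by [] | by apply: val_inj]
  end.

(** * The list of face pairings and the gluing map *)

Section MemLayered.
Variables (X : eqType) (A B : X) (m : nat) (D : 'I_m -> X) (D' : nat -> X).
Hypothesis D'E : forall j : 'I_m, D' j = D j.
Implicit Types x : face X * face X.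

Definition fold_pairing x := x == ((A, (v0, v2, v3)), (B, (v0, v3, v2))).
Definition first_pairing x :=
  (x == ((D' 0%N, (v0, v1, v2)), (A, (v3, v2, v0)))) ||
  (x == ((D' 0%N, (v0, v1, v3)), (B, (v2, v3, v0)))).
Definition next_pairing j x :=
  (x == ((D' j.+1, (v0, v1, v2)), (D' j, (v0, v3, v2)))) ||
  (x == ((D' j.+1, (v0, v1, v3)), (D' j, (v2, v1, v3)))).
Definition last_pairing x := x == ((D' m.-1, (v0, v2, v3)), (D' m.-1, (v2, v3, v1))).

Lemma mem_layered x : x \in layered_solid_torus A B D <->
  (m = 0%N /\ fold_pairing x) \/ ((0 < m)%N /\ first_pairing x) \/
  (exists2 j, (j.+1 < m)%N & next_pairing j x) \/ ((0 < m)%N /\ last_pairing x).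
Proof.
rewrite /fold_pairing /first_pairing /next_pairing /last_pairing.
case: m D D'E => [|k] d dE.
  have -> : layered_solid_torus A B d = [:: ((A, (v0, v2, v3)), (B, (v0, v3, v2)))].
    by rewrite /layered_solid_torus; numerals.
  rewrite mem_seq1; split=> [h|]; first by left.
  by case=> [[]|[[]|[[]|[]]]].
have -> : layered_solid_torus A B d =
    [:: ((d ord0, (v0, v1, v2)), (A, (v3, v2, v0))); ((d ord0, (v0, v1, v3)), (B, (v2, v3, v0)))]
    ++ flatten [seq [:: ((d (lift ord0 j), (v0, v1, v2)), (d (widen_ord (leqnSn k) j), (v0, v3, v2)));
        ((d (lift ord0 j), (v0, v1, v3)), (d (widen_ord (leqnSn k) j), (v2, v1, v3)))] | j <- enum 'I_k]
    ++ [:: ((d ord_max, (v0, v2, v3)), (d ord_max, (v2, v3, v1)))].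
  rewrite /layered_solid_torus; apply: congr2; first by numerals.
  apply: congr2; last by numerals.
  by congr flatten; apply: eq_map => j; numerals.
have d0 : D' 0%N = d ord0 by rewrite -dE.
have dm : D' k = d ord_max by rewrite -dE.
have dl (j : 'I_k) : D' j.+1 = d (lift ord0 j) by rewrite -dE lift0.
have dw (j : 'I_k) : D' j = d (widen_ord (leqnSn k) j) by rewrite -dE.
rewrite -d0 -dm !in_cons mem_cat mem_seq1; split.
  case/or3P => [e|e|/orP[/flattenP[s /mapP[j _ ->]]|e]].
  - by right; left; rewrite e.
  - by right; left; rewrite e orbT.
  - by rewrite !inE -dl -dw => e; right; right; left; exists j => //; rewrite ltnS.
  - by right; right; right.
case=> [[]|[[_ /orP[]->]|[[j jk e]|[_ ->]]]] //; rewrite ?orbT //.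
rewrite ltnS in jk; apply/or3P; apply: Or33; apply/orP; left; apply/flattenP.
exists [:: ((d (lift ord0 (Ordinal jk)), (v0, v1, v2)), (d (widen_ord (leqnSn k) (Ordinal jk)), (v0, v3, v2)));
  ((d (lift ord0 (Ordinal jk)), (v0, v1, v3)), (d (widen_ord (leqnSn k) (Ordinal jk)), (v2, v1, v3)))].
  by apply/mapP; exists (Ordinal jk); rewrite ?mem_enum.
by rewrite !inE -dl -dw.
Qed.

End MemLayered.

Section Pairings.
Variables p q : nat.
Notation n := (fun s : bool => if s then (p - 2)%N else (q - 2)%N).
Notation ktet := (ktet n).
Notation layer := (layer n).
Notation torusA := (torusA n).
Notation torusB := (torusB n).

Definition core_list : seq (face ktet * face ktet) :=
  [:: ((inl c0, (v0, v1, v2)), (inl c2, (v0, v2, v1)));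
      ((inl c0, (v0, v1, v3)), (inl c1, (v2, v0, v1)));
      ((inl c0, (v0, v2, v3)), (inl c3, (v1, v3, v0)));
      ((inl c0, (v1, v2, v3)), (inl c5, (v2, v1, v3)));
      ((inl c1, (v0, v1, v3)), (inl c2, (v3, v1, v0)));
      ((inl c1, (v1, v2, v3)), (inl c4, (v2, v1, v3)));
      ((inl c2, (v1, v2, v3)), (inl c3, (v3, v2, v1)));
      ((inl c3, (v0, v1, v2)), (inl c4, (v2, v1, v0)));
      ((inl c3, (v0, v2, v3)), (inl c5, (v0, v2, v1)));
      ((inl c4, (v0, v1, v3)), (inl c5, (v3, v1, v0)))].

Definition layered_pairing s (x : face ktet * face ktet) :=
  (n s = 0%N /\ fold_pairing (torusA s) (torusB s) x) \/
  ((0 < n s)%N /\ first_pairing (torusA s) (torusB s) (layer s) x) \/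
  (exists2 j, (j.+1 < n s)%N & next_pairing (layer s) j x) \/
  ((0 < n s)%N /\ last_pairing (n s) (layer s) x).

Lemma mem_pairings x : x \in pairings (T_K p q) <->
  x \in core_list \/ exists s, layered_pairing s x.
Proof.
have H s : x \in layered_solid_torus (torusA s) (torusB s) (@inlayer n s) <-> layered_pairing s x.
  by apply: mem_layered => j; rewrite layerE.
have -> : (x \in pairings (T_K p q)) = [|| x \in core_list,
    x \in layered_solid_torus (torusA true) (torusB true) (@inlayer n true) |
    x \in layered_solid_torus (torusA false) (torusB false) (@inlayer n false)].
  have <- : core_pairings p q = core_list by rewrite /core_pairings /core_list /core; numerals.
  have eA : core p q 4 = torusA true by apply: congr1; apply: val_inj.
  have eB : core p q 5 = torusB true by apply: congr1; apply: val_inj.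
  have eA' : core p q 1 = torusA false by apply: congr1; apply: val_inj.
  have eB' : core p q 2 = torusB false by apply: congr1; apply: val_inj.
  have -> : pairings (T_K p q) = core_pairings p q
    ++ layered_solid_torus (core p q 4) (core p q 5) (@layer1 p q)
    ++ layered_solid_torus (core p q 1) (core p q 2) (@layer2 p q) by [].
  by rewrite eA eB eA' eB' !mem_cat.
split=> [/or3P[]|].
- by left.
- by move/H; right; exists true.
- by move/H; right; exists false.
by case=> [->//|[[] /H ->]]; rewrite !orbT.
Qed.

Definition from_glue (x : face ktet * face ktet) :=
  exists2 l, uniq [:: x.1.2.1.1; x.1.2.1.2; x.1.2.2; l] & let g := kglue x.1.1 l in
  [/\ x.2.1 = g.1, x.2.2.1.1 = g.2 x.1.2.1.1, x.2.2.1.2 = g.2 x.1.2.1.2 & x.2.2.2 = g.2 x.1.2.2].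

Lemma pairings_glue x : x \in pairings (T_K p q) -> from_glue x.
Proof.
move/mem_pairings => [|[s]].
  rewrite !inE; do 9?[case/orP]; move/eqP => ->;
    by [exists v0|exists v1|exists v2|exists v3].
case=> [[e /eqP ->]|[[h /orP[]/eqP ->]|[[j jn /orP[]/eqP ->]|[h /eqP ->]]]].
- by exists v1; case: s e => e; rewrite //= /core_glue /= e.
- by exists v3; rewrite //= kglue_layer.
- by exists v2; rewrite //= kglue_layer.
- by exists v3; rewrite //= kglue_layer.
- by exists v2; rewrite //= kglue_layer.
- have hn : ((n s).-1 < n s)%N by rewrite prednK.
  by exists v1; rewrite //= kglue_layer // /layer_glue /= prednK // ltnn.
Qed.

Definition in_pairings (t : ktet) (l : 'I_4) := let g := kglue t l in
  exists i j k : 'I_4, uniq [:: i; j; k; l] /\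
   (((t, (i, j, k)), (g.1, (g.2 i, g.2 j, g.2 k))) \in pairings (T_K p q) \/
    ((g.1, (g.2 i, g.2 j, g.2 k)), (t, (i, j, k))) \in pairings (T_K p q)).

Lemma glue_in_pairings t l : in_pairings t l.
Proof.
have core x : x \in core_list -> x \in pairings (T_K p q) by move=> h; apply/mem_pairings; left.
have lay s x : layered_pairing s x -> x \in pairings (T_K p q).
  by move=> h; apply/mem_pairings; right; exists s.
case: (ktet_cases t) => [[c ->]|[s [k [kn ->]]]].
  have torA s : in_pairings (torusA s) v1.
    case E : (n s == 0%N).
      exists v0, v2, v3; split=> //; left; apply: (lay s); left; split; first exact/eqP.
      by case: s E => E; rewrite /= /core_glue /= E /fold_pairing /= eqxx.
    exists v3, v2, v0; split=> //; right; apply: (lay s); right; left; rewrite lt0n E; split=> //.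
    by case: s E => E; rewrite /= /core_glue /= E /first_pairing /= eqxx.
  have torB s : in_pairings (torusB s) v1.
    case E : (n s == 0%N).
      exists v0, v3, v2; split=> //; right; apply: (lay s); left; split; first exact/eqP.
      by case: s E => E; rewrite /= /core_glue /= E /fold_pairing /= eqxx.
    exists v2, v3, v0; split=> //; right; apply: (lay s); right; left; rewrite lt0n E; split=> //.
    by case: s E => E; rewrite /= /core_glue /= E /first_pairing /= eqxx orbT.
  have [ta tb ta' tb'] := And4 (torA true) (torB true) (torA false) (torB false).
  case: (ord6E c) => [[]|[]] ->; case: (ord4E l) => -> //.
  - by exists v1, v2, v3; split=> //; left; apply: core.
  - by exists v0, v2, v3; split=> //; left; apply: core.
  - by exists v0, v1, v3; split=> //; left; apply: core.
  - by exists v0, v1, v2; split=> //; left; apply: core.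
  - by exists v1, v2, v3; split=> //; left; apply: core.
  - by exists v0, v1, v3; split=> //; left; apply: core.
  - by exists v2, v0, v1; split=> //; right; apply: core.
  - by exists v1, v2, v3; split=> //; left; apply: core.
  - by exists v3, v1, v0; split=> //; right; apply: core.
  - by exists v0, v2, v1; split=> //; right; apply: core.
  - by exists v3, v2, v1; split=> //; right; apply: core.
  - by exists v0, v2, v3; split=> //; left; apply: core.
  - by exists v1, v3, v0; split=> //; right; apply: core.
  - by exists v0, v1, v2; split=> //; left; apply: core.
  - by exists v2, v1, v3; split=> //; right; apply: core.
  - by exists v0, v1, v3; split=> //; left; apply: core.
  - by exists v2, v1, v0; split=> //; right; apply: core.
  - by exists v2, v1, v3; split=> //; right; apply: core.
  - by exists v3, v1, v0; split=> //; right; apply: core.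
  - by exists v0, v2, v1; split=> //; right; apply: core.
case: (ord4E l) => ->; rewrite /in_pairings kglue_layer // /layer_glue /=.
- case: ifP => h /=.
    exists v2, v1, v3; split=> //; right; apply: (lay s); do 2!right; left; exists k => //.
    by rewrite /next_pairing eqxx orbT.
  exists v2, v3, v1; split=> //; right; apply: (lay s); do 3!right; split; first by lia.
  by have -> : k = (n s).-1 by [lia]; apply/eqP.
- case: ifP => h /=.
    exists v0, v3, v2; split=> //; right; apply: (lay s); do 2!right; left; exists k => //.
    by rewrite /next_pairing eqxx.
  exists v0, v2, v3; split=> //; left; apply: (lay s); do 3!right; split; first by lia.
  by have -> : k = (n s).-1 by [lia]; apply/eqP.
- exists v0, v1, v3; split=> //; left; apply: (lay s).
  case: k kn => [|k] kn /=; first by right; left; split=> //; rewrite /first_pairing eqxx orbT.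
  by do 2!right; left; exists k => //; rewrite /next_pairing eqxx orbT.
- exists v0, v1, v2; split=> //; left; apply: (lay s).
  case: k kn => [|k] kn /=; first by right; left; split=> //; rewrite /first_pairing eqxx.
  by do 2!right; left; exists k => //; rewrite /next_pairing eqxx.
Qed.

End Pairings.

(** * Edge cycles as cyclic lists of flags *)

Section CycleList.
Variables (R : realType) (T : triangulation) (th : tet T -> 'I_4 -> 'I_4 -> R).
Variable glue : tet T -> 'I_4 -> tet T * ('I_4 -> 'I_4).

Definition edge_key (f : flag T) : tet T * nat := (f.1, edge_index (fv0 f) (fv1 f)).

Definition edge_cycle (L : seq (flag T)) := [/\ all (@funiq T) L, fcycle (nextf glue) L,
  uniq (map edge_key L) & \sum_(f <- L) (fth th) f = 2 * pi].

(** Rotated to start at [f], the list is the orbit of [f]; as keys forget the direction of an edge,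
    distinct keys mean that no edge of a tetrahedron is met twice. *)
Lemma edge_cycleP L f : edge_cycle L -> f \in L -> exists n, [/\ (0 < n)%N, iter n (nextf glue) f = f,
  \sum_(k < n) (fth th) (iter k (nextf glue) f) = 2 * pi &
  forall k k', (k < n)%N -> (k' < n)%N -> (iter k (nextf glue) f).1 = (iter k' (nextf glue) f).1 ->
    fv0 (iter k' (nextf glue) f) \in [:: fv0 (iter k (nextf glue) f); fv1 (iter k (nextf glue) f)] ->
    fv1 (iter k' (nextf glue) f) \in [:: fv0 (iter k (nextf glue) f); fv1 (iter k (nextf glue) f)] -> k = k'].
Proof.
move=> [uL cL kL sL] fL; have [i M rotL] := rot_to fL.
have pM : perm_eq L (f :: M) by rewrite -rotL perm_sym perm_rot.
have uM : all (@funiq T) (f :: M) by rewrite -(perm_all _ pM).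
have kM : uniq (map edge_key (f :: M)) by rewrite -(perm_uniq (perm_map edge_key pM)).
have : fcycle (nextf glue) (f :: M) by rewrite -rotL rot_cycle.
move=> /= /fpathP[m]; move=> E.
have sm : m = (size M).+1 by rewrite -(size_traject (nextf glue) ((nextf glue) f) m) -E size_rcons.
have : f :: rcons M f = traject (nextf glue) f m.+1 by rewrite trajectS E.
rewrite sm trajectSr -rcons_cons => /rcons_inj[eM ef].
set n := (size M).+1 in eM ef.
have eM' : f :: M = traject (nextf glue) f n by rewrite /n trajectS -eM.
have itn k : (k < n)%N -> nth f (f :: M) k = iter k (nextf glue) f by move=> kn; rewrite eM' nth_traject.
exists n; split=> // [|k k' kn kn' e1 e2 e3].
  rewrite -sL (perm_big _ pM) /= (big_nth f) big_mkord.
  by apply: eq_bigr => k _; rewrite itn.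
have : funiq (iter k' (nextf glue) f).
  by rewrite -itn //; apply: (allP uM); rewrite mem_nth.
have /= := uniqP (edge_key f) kM k k'; rewrite !inE /= size_map => /(_ kn kn') H.
have nm j : (j < n)%N -> nth (edge_key f) (edge_key f :: map edge_key M) j = edge_key (iter j (nextf glue) f).
  by move=> jn; rewrite -itn // -map_cons (nth_map f).
move=> /funiq_neq[[n1 _ _] _]; apply: H; rewrite !nm // /edge_key e1; congr (_, _).
move: e2 e3 n1; rewrite !inE => /orP[]/eqP-> /orP[]/eqP->; rewrite ?eqxx // => _.
exact: edge_indexC.
Qed.

End CycleList.

Lemma path_iota (X : Type) (e : rel X) (f : nat -> X) x a m : e x (f a) ->
  (forall k, (a <= k)%N -> (k.+1 < a + m)%N -> e (f k) (f k.+1)) -> path e x (map f (iota a m)).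
Proof.
elim: m x a => //= m IH x a exa H; rewrite exa; case: m IH H => // m IH H.
apply: IH => [|k ak km]; first by apply: H; lia.
by apply: H; lia.
Qed.

Lemma path_rev_iota (X : Type) (e : rel X) (f : nat -> X) x m : e x (f m.-1) ->
  (forall k, (k.+1 < m)%N -> e (f k.+1) (f k)) -> path e x (map f (rev (iota 0 m))).
Proof.
elim: m x => // m IH x exa H; rewrite -addn1 iotaD rev_cat /= add0n exa.
case: m IH H exa => // m IH H exa; apply: IH => [|k km]; first exact: H.
by apply: H; lia.
Qed.

(** * Edge cycles *)

Section EdgeCycles.
Variables (R : realType) (n : bool -> nat) (theta : rtet n -> 'I_3 -> R).
Hypothesis theta_feasible : feasible (fun e => @rinc R n (rcode e)) (@rangle R n) theta.

(** Flags and their successors depend only on the tetrahedra and the gluing map, so the list of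
    pairings may be empty here. *)
Let T := @Triangulation (ktet n) [::].
Notation layer := (layer n).
Notation torusA := (torusA n).
Notation torusB := (torusB n).
Notation knext := (@nextf T (@kglue n)).
Notation kth := (fun t i j => theta (reduced t) (kpair t i j)).
Notation kfth := (@fth R T kth).
Notation key := (@edge_key T).
Notation edge_cycle := (@edge_cycle R T kth (@kglue n)).

Definition fl (t : ktet n) a b c d : flag T := (t, (a, b, c, d)).

(** The two edge classes off the tori. *)
Definition core_cycle (b : bool) : seq (flag T) :=
  if b then [:: fl (inl c0) v0 v3 v1 v2; fl (inl c3) v1 v0 v3 v2; fl (inl c4) v1 v2 v0 v3; fl (inl c1) v2 v1 v3 v0]
  else [:: fl (inl c0) v1 v2 v0 v3; fl (inl c5) v2 v1 v3 v0; fl (inl c3) v2 v3 v0 v1; fl (inl c2) v2 v1 v3 v0].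

Definition first_mid (s : bool) : seq (flag T) :=
  if s then [:: fl (inl c1) v3 v1 v2 v0; fl (inl c2) v0 v1 v3 v2; fl (inl c0) v0 v2 v1 v3;
      fl (inl c3) v1 v3 v0 v2; fl (inl c2) v3 v1 v2 v0; fl (inl c1) v0 v1 v3 v2;
      fl (inl c0) v1 v3 v0 v2]
  else [:: fl (inl c4) v3 v1 v2 v0; fl (inl c5) v0 v1 v3 v2; fl (inl c3) v0 v3 v2 v1;
      fl (inl c0) v3 v2 v0 v1; fl (inl c5) v3 v1 v2 v0; fl (inl c4) v0 v1 v3 v2;
      fl (inl c3) v2 v1 v0 v3].

Definition first_core (s : bool) : seq (flag T) :=
  fl (torusA s) v3 v2 v0 v1 :: rcons (first_mid s) (fl (torusB s) v2 v3 v1 v0).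

Definition first_cycle s : seq (flag T) :=
  first_core s ++ if (n s == 0)%N then [::] else [:: fl (layer s 0) v0 v1 v3 v2].

(** The core tetrahedron at O_1 other than the two on the torus. *)
Definition corner s : flag T := if s then fl (inl c3) v0 v2 v1 v3 else fl (inl c0) v0 v1 v3 v2.

(** The cycle around O_(k+1): the previous layer, two edges of layer k and the next layer, if any.
    For k = 0 the core replaces the previous layer. *)
Definition inner_cycle s (k : nat) : seq (flag T) :=
  if k is j.+1 then
    [:: fl (layer s j) v2 v3 v0 v1; fl (layer s k) v0 v3 v1 v2] ++
    (if (k.+1 < n s)%N then [:: fl (layer s k.+1) v0 v1 v2 v3] else [::]) ++
    [:: fl (layer s k) v2 v1 v3 v0]
  else
    [:: corner s; fl (torusB s) v0 v2 v1 v3; fl (layer s 0) v3 v0 v1 v2] ++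
    (if (1 < n s)%N then [:: fl (layer s 1) v1 v0 v2 v3] else [::]) ++
    [:: fl (layer s 0) v1 v2 v3 v0; fl (torusA s) v2 v0 v3 v1].

(** The cycle around P: up the layers along their edges 02, through the fold, and back along 13.
    Without layers P is O_1. *)
Definition outer_cycle s : seq (flag T) :=
  if (n s == 0)%N then
    [:: corner s; fl (torusB s) v0 v2 v1 v3; fl (torusA s) v0 v3 v2 v1; fl (torusB s) v3 v0 v1 v2;
        fl (torusA s) v2 v0 v3 v1]
  else fl (torusA s) v0 v3 v1 v2 ::
    ([seq fl (layer s k) v2 v0 v1 v3 | k <- iota 0 (n s)] ++ fl (layer s (n s).-1) v3 v2 v1 v0 ::
     [seq fl (layer s k) v1 v3 v2 v0 | k <- rev (iota 0 (n s))] ++ [:: fl (torusB s) v3 v0 v2 v1]).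

Lemma layer_core s k i : (k < n s)%N -> (layer s k == inl i) = false.
Proof. by move=> h; rewrite -[k]/(val (Ordinal h)) layerE; case: s h. Qed.

Lemma core_layer s k i : (k < n s)%N -> (inl i == layer s k) = false.
Proof. by move=> h; rewrite eq_sym layer_core. Qed.

Lemma layer_eq s k k' : (k < n s)%N -> (k' < n s)%N -> (layer s k == layer s k') = (k == k').
Proof.
move=> h h'; rewrite -{1}[k]/(val (Ordinal h)) -{1}[k']/(val (Ordinal h')) !layerE.
by case: s h h'.
Qed.

Lemma nextf_layer s k a b c d : (k < n s)%N -> knext (fl (layer s k) a b c d) =
  let g := layer_glue n s k c in (g.1, (g.2 a, g.2 b, g.2 d, g.2 c)).
Proof. by move=> h; rewrite /nextf /fl /fv2 /= kglue_layer. Qed.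

Lemma nextf_torusA s a b d : (0 < n s)%N -> knext (fl (torusA s) a b v1 d) =
  let m := vmap v2 v3 v1 v0 in (layer s 0, (m a, m b, m d, m v1)).
Proof. by case: s => h; rewrite /nextf /fl /fv2 /= /core_glue /= gtn_eqF. Qed.

Lemma nextf_torusB s a b d : (0 < n s)%N -> knext (fl (torusB s) a b v1 d) =
  let m := vmap v3 v2 v0 v1 in (layer s 0, (m a, m b, m d, m v1)).
Proof. by case: s => h; rewrite /nextf /fl /fv2 /= /core_glue /= gtn_eqF. Qed.

Lemma nextf_torusA_B s : knext (fl (torusA s) v0 v3 v2 v1) = fl (torusB s) v3 v0 v1 v2.
Proof. by case: s. Qed.

Lemma nextf_torusB0 s a b d : (n s == 0)%N -> knext (fl (torusB s) a b v1 d) =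
  let m := vmap v0 v1 v3 v2 in fl (torusA s) (m a) (m b) (m d) (m v1).
Proof. by case: s => h; rewrite /nextf /fl /fv2 /= /core_glue /= h. Qed.

Lemma nextf_corner s : knext (corner s) = fl (torusB s) v0 v2 v1 v3.
Proof. by case: s. Qed.

Lemma nextf_torusA_corner s : knext (fl (torusA s) v2 v0 v3 v1) = corner s.
Proof. by case: s. Qed.

Lemma fth_layer s k a b c d : (k < n s)%N -> kfth (fl (layer s k) a b c d) =
  tl theta s k (nth w0 [:: w0; w2; w1] (pair_index (edge_index a b))).
Proof.
move=> h; rewrite -[k in RHS]/(val (Ordinal h)) tl_ord /fth /fl /fv0 /fv1 /= /kpair.
by rewrite (reduced_layer h) pair_order_layer.
Qed.

Lemma core_cycleP b : edge_cycle (core_cycle b).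
Proof.
split; [by case: b|by case: b|by case: b|].
have [_ _ /(_ None)] := theta_feasible; rewrite /= edge_sum_core big_bool => E.
have e0 : (2%:R : 'I_3) = w2 by apply: val_inj.
by rewrite e0 /= in E; case: b; rewrite /= !big_cons big_nil /fth /kpair /fl /fv0 /fv1 /=; lra.
Qed.

Let e012 : ((2%:R : 'I_3) = w2) * ((1 : 'I_3) = w1) * ((0 : 'I_3) = w0).
Proof. by do ![split]; apply: val_inj. Qed.

Lemma tl0 s (k : nat) i : (n s == 0)%N -> tl theta s k i = 0.
Proof. by move=> /eqP e; rewrite tl_ge // e. Qed.

Lemma first_core_path s : path (frel knext) (fl (torusA s) v3 v2 v0 v1)
  (rcons (first_mid s) (fl (torusB s) v2 v3 v1 v0)).
Proof. by case: s. Qed.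

Lemma first_core_sum s : \sum_(f <- first_core s) kfth f = theta (inl (false, s)) w0 +
  2 * theta (inl (false, ~~ s)) w1 + 2 * theta (inl (true, s)) w0 +
    2 * theta (inl (true, ~~ s)) w0 + 2 * theta (inl (true, ~~ s)) w1.
Proof. by case: s; rewrite !big_cons big_nil /fth /kpair /fl /fv0 /fv1 /=; ring. Qed.

Lemma first_cycleP s : edge_cycle (first_cycle s).
Proof.
have E := rfeasible_edge theta_feasible (leq0n (n s).+1).
rewrite edge_sum_first /= !e012 -first_core_sum in E; rewrite /first_cycle; case: ifP => h.
  rewrite cats0 (tl0 _ _ h) addr0 in E *; split=> //; try by case: s {h E}.
  by rewrite /= rcons_path last_rcons first_core_path /= nextf_torusB0 // eqxx.
have n0 : (0 < n s)%N by rewrite lt0n h.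
split.
- by case: s {E h n0}.
- rewrite /= rcons_cat cat_path last_rcons first_core_path /=.
  by rewrite nextf_torusB // nextf_layer //= !eqxx.
- rewrite map_cat cat_uniq; apply/and3P; split; [by case: s {E h n0}| |by []].
  by case: s {E h} n0 => n0; rewrite /= orbF !inE /edge_key /= !xpair_eqE !layer_core.
- by rewrite big_cat big_seq1 fth_layer.
Qed.

Lemma inner_cycleP s k : (k < n s)%N -> edge_cycle (inner_cycle s k).
Proof.
move=> kn; have kn' : (k < (n s).+1)%N by exact: ltnW.
have E := rfeasible_edge theta_feasible kn'.
rewrite edge_sum_inner // /layerX !e012 in E.
case: k kn {kn'} E => [|k] kn E; rewrite /inner_cycle.
- case: ifP => h; split.
  + by case: s {E kn h}.
  + rewrite /= nextf_corner nextf_torusA_corner nextf_torusB // !nextf_layer // /layer_glue /= h.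
    by rewrite !eqxx.
  + by case: s {E} kn h => kn h; rewrite /= !inE /edge_key /= !xpair_eqE ?layer_core ?core_layer ?layer_eq.
  + rewrite !big_cat big_seq1 !big_cons !big_nil !fth_layer //=.
    by case: s kn h E => kn h /= E; rewrite /fth /kpair /fl /fv0 /fv1 /=; lra.
  + by case: s {E kn h}.
  + rewrite /= nextf_corner nextf_torusA_corner nextf_torusB // !nextf_layer // /layer_glue /= h.
    by rewrite !eqxx.
  + by case: s {E} kn h => kn h; rewrite /= !inE /edge_key /= !xpair_eqE ?layer_core ?core_layer ?layer_eq.
  + rewrite !big_cat big_nil !big_cons !big_nil !fth_layer //=.
    move: E; rewrite [X in _ + X = _]tl_ge; last by rewrite leqNgt h.
    by case: s kn h => kn h /= E; rewrite /fth /kpair /fl /fv0 /fv1 /=; lra.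
- have kn0 : (k < n s)%N by exact: ltnW.
  case: ifP => h; split=> //.
  + by rewrite /= !nextf_layer // /layer_glue /= kn h !eqxx.
  + by rewrite /= !inE /edge_key /= !xpair_eqE !layer_eq // /edge_index /=; lia.
  + by rewrite !big_cat big_seq1 !big_cons !big_nil !fth_layer //=; lra.
  + by rewrite /= !nextf_layer // /layer_glue /= kn h !eqxx.
  + by rewrite /= !inE /edge_key /= !xpair_eqE !layer_eq // /edge_index /=; lia.
  + rewrite !big_cat big_nil !big_cons !big_nil !fth_layer //=.
    by move: E; rewrite [X in _ + X = _]tl_ge; [lra|rewrite leqNgt h].
Qed.

Lemma outer_cycleP s : edge_cycle (outer_cycle s).
Proof.
have E := rfeasible_edge theta_feasible (leqnn (n s).+1).
rewrite edge_sum_outer !e012 in E; rewrite /outer_cycle; case: ifP => h.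
  move: E; rewrite big1 => [|j _]; last by rewrite tl0.
  move=> E; have /eqP h0 := h; rewrite h0 /= !e012 in E.
  split.
  - by case: s {h E h0}.
  - rewrite /= nextf_corner nextf_torusA_corner nextf_torusA_B !nextf_torusB0 //.
    by rewrite !eqxx.
  - by case: s {h E h0}.
  - rewrite !big_cons big_nil; case: s E {h h0} => /= E;
    by rewrite /fth /kpair /fl /fv0 /fv1 /=; lra.
have n0 : (0 < n s)%N by rewrite lt0n h.
have n1 : ((n s).-1 < n s)%N by rewrite prednK.
have eX : layerX theta s (n s) = tl theta s (n s).-1 w0.
  by rewrite /layerX; case: (n s) n0 => //= k _; congr tl; apply: val_inj.
rewrite eX {eX} in E.
have AB : (torusA s == torusB s) = false by case: (s).
have io1 : iota 0 (n s) = rcons (iota 0 (n s).-1) (n s).-1.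
  by case: (n s) n0 => // m _; rewrite -{1}[m.+1]addn1 iotaD cats1.
have io2 : iota 0 (n s) = 0%N :: iota 1 (n s).-1 by case: (n s) n0.
split.
- apply/allP => f; rewrite !(inE, mem_cat).
  by case/or4P => [/eqP->|/mapP[k _ ->]|/eqP->|/orP[/mapP[k _ ->]|/eqP->]].
- rewrite /= rcons_cat /= rcons_cat cat_path /= cat_path.
  have l1 x : last x [seq fl (layer s k) v2 v0 v1 v3 | k <- iota 0 (n s)] =
      fl (layer s (n s).-1) v2 v0 v1 v3 by rewrite io1 map_rcons last_rcons.
  have l2 x : last x [seq fl (layer s k) v1 v3 v2 v0 | k <- rev (iota 0 (n s))] =
      fl (layer s 0) v1 v3 v2 v0 by rewrite io2 rev_cons map_rcons last_rcons.
  rewrite l1 l2; apply/and4P; split.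
  + apply: path_iota => [|k _ km]; first by rewrite /= nextf_torusA.
    by rewrite /= nextf_layer ?(ltnW km) // /layer_glue /= km.
  + by rewrite /= nextf_layer // /layer_glue /= prednK // ltnn.
  + apply: path_rev_iota => [|k km]; first by rewrite /= nextf_layer // /layer_glue /= prednK // ltnn.
    by rewrite /= nextf_layer.
  + by rewrite /= nextf_layer //= eqxx; case: s {E h n0 n1 l1 l2 io1 io2 AB}.
- rewrite /= map_cat /= map_cat /= -!map_comp.
  (* The two runs have edge indices 1 and 4, and within each run the layers are distinct. *)
  set g1 := (X in map X (iota _ _)); set g4 := (X in map X (rev _)).
  have N1 x : x.2 != 1%N -> x \notin map g1 (iota 0 (n s)).
    by move=> hx; apply/negP => /mapP[k _ ex]; rewrite ex in hx.
  have N4 x : x.2 != 4%N -> x \notin map g4 (rev (iota 0 (n s))).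
    by move=> hx; apply/negP => /mapP[k _ ex]; rewrite ex in hx.
  have inj g : (forall k, (g k).1 = layer s k) -> {in iota 0 (n s) &, injective (g : nat -> tet T * nat)}.
    move=> hg k k'; rewrite !mem_iota !add0n => hk hk' /(congr1 fst); rewrite !hg => /eqP.
    by rewrite layer_eq // => /eqP.
  apply/andP; split.
    by rewrite mem_cat inE mem_cat mem_seq1 !negb_or N1 // N4 // /edge_key !xpair_eqE andbF AB.
  rewrite cat_uniq; apply/and3P; split; first by rewrite map_inj_in_uniq ?iota_uniq //; exact: inj.
    apply/hasPn => x; rewrite inE mem_cat mem_seq1.
    by case/or3P => [/eqP->|/mapP[k _ ->]|/eqP->]; apply: N1.
  rewrite cons_uniq; apply/andP; split.
    by rewrite mem_cat mem_seq1 negb_or N4 //= xpair_eqE andbF.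
  rewrite cat_uniq; apply/and3P; split=> //.
    rewrite map_inj_in_uniq ?rev_uniq ?iota_uniq // => k k'; rewrite !mem_rev; exact: inj.
  by apply/hasPn => x; rewrite mem_seq1 => /eqP->; apply: N4.
- rewrite big_cons big_cat big_cons big_cat big_seq1 !big_map fth_layer //.
  have S1 : \sum_(k <- iota 0 (n s)) kfth (fl (layer s k) v2 v0 v1 v3) = \sum_(j < n s) tl theta s j w2.
    rewrite -[X in iota 0 X]subn0 -/(index_iota 0 (n s)) big_mkord.
    by apply: eq_bigr => j _; rewrite fth_layer.
  have S2 : \sum_(k <- rev (iota 0 (n s))) kfth (fl (layer s k) v1 v3 v2 v0) = \sum_(j < n s) tl theta s j w2.
    rewrite (perm_big (iota 0 (n s))) /=; last by rewrite perm_rev.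
    rewrite -[X in iota 0 X]subn0 -/(index_iota 0 (n s)) big_mkord.
    by apply: eq_bigr => j _; rewrite fth_layer.
  rewrite S1 S2 {S1 S2}; move: (\sum_(j < n s) _) (tl _ _ _ _) E => S x E.
  by case: s {h n0 n1 io1 io2 AB} E => E; rewrite /fth /kpair /fl /fv0 /fv1 /=; lra.
Qed.

End EdgeCycles.

(** * Every edge of every tetrahedron lies in one of the cycles *)

Section Covering.
Variables (R : realType) (n : bool -> nat) (theta : rtet n -> 'I_3 -> R).
Hypothesis theta_feasible : feasible (fun e => @rinc R n (rcode e)) (@rangle R n) theta.

Let T := @Triangulation (ktet n) [::].
Notation kth := (fun t i j => theta (reduced t) (kpair t i j)).
Notation key := (@edge_key T).
Notation edge_cycle := (@edge_cycle R T kth (@kglue n)).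

Lemma edge_index_inj i j i' j' : i != j -> edge_index i' j' = edge_index i j ->
  i' = i /\ j' = j \/ i' = j /\ j' = i.
Proof.
case: (ord4E i) => ->; case: (ord4E j) => -> // _;
  by case: (ord4E i') => ->; case: (ord4E j') => -> //; by [left|right].
Qed.

Lemma edge_covered (t : ktet n) (e : nat) : (e < 6)%N ->
  exists2 L, edge_cycle L & (t, e) \in map key L.
Proof.
have cor b x : x \in map key (core_cycle n b) -> exists2 L, edge_cycle L & x \in map key L.
  by move=> h; exists (core_cycle n b); first exact: core_cycleP.
have fst_ s x : x \in map key (first_core n s) -> exists2 L, edge_cycle L & x \in map key L.
  move=> h; exists (first_cycle n s); first exact: first_cycleP.
  by rewrite map_cat mem_cat h.
have via L f : edge_cycle L -> f \in L -> exists2 L, edge_cycle L & key f \in map key L.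
  by move=> hL hf; exists L => //; exact: map_f.
have out s x : x \in [:: (torusA n s, 2%N); (torusB n s, 2%N)] ->
    exists2 L, edge_cycle L & x \in map key L.
  have oc := outer_cycleP theta_feasible s; rewrite /outer_cycle in oc.
  rewrite !inE => /orP[]/eqP->; case: ifP oc => _ oc.
  - by apply: (via _ (fl (torusA n s) v0 v3 v2 v1) oc); rewrite !inE eqxx ?orbT.
  - by apply: (via _ (fl (torusA n s) v0 v3 v1 v2) oc); rewrite !inE eqxx.
  - by apply: (via _ (fl (torusB n s) v3 v0 v1 v2) oc); rewrite !inE eqxx ?orbT.
  - by apply: (via _ (fl (torusB n s) v3 v0 v2 v1) oc); rewrite !(inE, mem_cat) eqxx ?orbT.
(* O_1 has the outer cycle if there is no layer, and the first inner cycle otherwise. *)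
have c1 s x : x \in [:: key (corner n s); (torusB n s, 1%N); (torusA n s, 1%N)] ->
    exists2 L, edge_cycle L & x \in map key L.
  have oc := outer_cycleP theta_feasible s; rewrite /outer_cycle in oc.
  rewrite !inE => hx; case n0 : (n s == 0)%N in oc.
    case/or3P: hx => /eqP->.
    - by apply: (via _ _ oc); rewrite !inE eqxx.
    - by apply: (via _ (fl (torusB n s) v0 v2 v1 v3) oc); rewrite !inE eqxx ?orbT.
    - by apply: (via _ (fl (torusA n s) v2 v0 v3 v1) oc); rewrite !inE eqxx ?orbT.
  have n1 : (0 < n s)%N by rewrite lt0n n0.
  have ic := inner_cycleP theta_feasible n1; rewrite /inner_cycle in ic.
  case/or3P: hx => /eqP->.
  - by apply: (via _ _ ic); rewrite !inE eqxx.
  - by apply: (via _ (fl (torusB n s) v0 v2 v1 v3) ic); rewrite !inE eqxx ?orbT.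
  - by apply: (via _ (fl (torusA n s) v2 v0 v3 v1) ic); rewrite !(inE, mem_cat) eqxx ?orbT.
case: (ktet_cases t) => [[c ->]|[s [k [kn ->]]]].
  case: (ord6E c) => [[]|[]] ->; case: e => [|[|[|[|[|[|//]]]]]] _.
  - exact: (c1 false).
  - exact: (fst_ true).
  - exact: (cor true).
  - exact: (cor false).
  - exact: (fst_ true).
  - exact: (fst_ false).
  - exact: (fst_ true).
  - exact: (c1 false).
  - exact: (out false).
  - exact: (cor true).
  - exact: (fst_ true).
  - exact: (fst_ false).
  - exact: (fst_ true).
  - exact: (c1 false).
  - exact: (out false).
  - exact: (cor false).
  - exact: (fst_ true).
  - exact: (fst_ false).
  - exact: (cor true).
  - exact: (c1 true).
  - exact: (fst_ false).
  - exact: (fst_ false).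
  - exact: (fst_ true).
  - exact: (cor false).
  - exact: (fst_ false).
  - exact: (c1 true).
  - exact: (out true).
  - exact: (cor true).
  - exact: (fst_ false).
  - exact: (fst_ true).
  - exact: (fst_ false).
  - exact: (c1 true).
  - exact: (out true).
  - exact: (cor false).
  - exact: (fst_ false).
  - exact: (fst_ true).
have oc := outer_cycleP theta_feasible s.
rewrite /outer_cycle gtn_eqF in oc; last by apply: leq_ltn_trans kn.
have ki : k \in iota 0 (n s) by rewrite mem_iota.
case: e => [|[|[|[|[|[|//]]]]]] _.
- case: k kn {ki} => [|[|k]] kn.
  + have fc := first_cycleP theta_feasible s; rewrite /first_cycle gtn_eqF // in fc.
    by apply: (via _ (fl (layer n s 0) v0 v1 v3 v2) fc); rewrite mem_cat mem_seq1 eqxx orbT.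
  + have ic := inner_cycleP theta_feasible (ltnW kn); rewrite /inner_cycle kn in ic.
    by apply: (via _ (fl (layer n s 1) v1 v0 v2 v3) ic); rewrite !(inE, mem_cat) eqxx ?orbT.
  + have ic := inner_cycleP theta_feasible (ltnW kn); rewrite /inner_cycle kn in ic.
    by apply: (via _ (fl (layer n s k.+2) v0 v1 v2 v3) ic); rewrite !(inE, mem_cat) eqxx ?orbT.
- apply: (via _ (fl (layer n s k) v2 v0 v1 v3) oc); rewrite inE mem_cat.
  by apply/orP; right; apply/orP; left; apply/mapP; exists k.
- have ic := inner_cycleP theta_feasible kn; case: k kn {ki} ic => [|k] kn ic.
    by apply: (via _ (fl (layer n s 0) v3 v0 v1 v2) ic); rewrite !(inE, mem_cat) eqxx ?orbT.
  by apply: (via _ (fl (layer n s k.+1) v0 v3 v1 v2) ic); rewrite !(inE, mem_cat) eqxx ?orbT.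
- have ic := inner_cycleP theta_feasible kn; case: k kn {ki} ic => [|k] kn ic.
    by apply: (via _ (fl (layer n s 0) v1 v2 v3 v0) ic); rewrite !(inE, mem_cat) eqxx ?orbT.
  by apply: (via _ (fl (layer n s k.+1) v2 v1 v3 v0) ic); rewrite !(inE, mem_cat) eqxx ?orbT.
- apply: (via _ (fl (layer n s k) v1 v3 v2 v0) oc); rewrite inE mem_cat inE mem_cat.
  have -> : fl (layer n s k) v1 v3 v2 v0 \in [seq fl (layer n s k) v1 v3 v2 v0 | k <- rev (iota 0 (n s))].
    by apply/mapP; exists k; rewrite ?mem_rev.
  by rewrite !orbT.
- have [h|h] := ltnP k.+1 (n s).
    have ic := inner_cycleP theta_feasible h; rewrite /inner_cycle in ic.
    by apply: (via _ (fl (layer n s k) v2 v3 v0 v1) ic); rewrite !(inE, mem_cat) eqxx ?orbT.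
  have -> : k = (n s).-1 by lia.
  by apply: (via _ (fl (layer n s (n s).-1) v3 v2 v1 v0) oc); rewrite !(inE, mem_cat) eqxx ?orbT.
Qed.

End Covering.

(** The law of cosines for the triangle whose sides are the sines of its angles, from sin A = sin (B
    + C). *)
Lemma sine_law_cosine (R : realType) (A B C : R) : A + B + C = pi ->
  sin A ^+ 2 = sin B ^+ 2 + sin C ^+ 2 - 2 * sin B * sin C * cos A.
Proof.
move=> h; have -> : A = pi - (B + C) by rewrite -h; ring.
rewrite sinB cosB sinpi cospi sinD cosD.
have b := cos2Dsin2 B; have c := cos2Dsin2 C.
have eb : cos B ^+ 2 = 1 - sin B ^+ 2 by rewrite -b; ring.
have ec : cos C ^+ 2 = 1 - sin C ^+ 2 by rewrite -c; ring.
transitivity (sin B ^+ 2 * cos C ^+ 2 + cos B ^+ 2 * sin C ^+ 2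
    + 2 * sin B * sin C * (cos B * cos C)); first by ring.
by rewrite eb ec; ring.
Qed.

Theorem theorem4p1 (R : realType) (p q : nat) (hp : (2 <= p)%N) (hq : (2 <= q)%N) :
  geometric_triangulation R (T_K p q).
Proof.
pose n := fun s : bool => if s then (p - 2)%N else (q - 2)%N.
have [th [len [r [fth th0 len0 r0 sin_th]]]] := @reduced_solution R n.
have thpi t k : th t k < pi by exact: feasible_lt_pi fth (th0 t).
pose ell (t : ktet n) i j := len (label t i j).
pose kth (t : ktet n) i j := th (reduced t) (kpair t i j).
have sine t i j k l : uniq [:: i; j; k; l] ->
    sin (kth t i j) = r (reduced t) * (ell t i j * ell t k l).
  by move=> u; rewrite /kth sin_th (label_product len t u).
apply: (@geometric_of_edge_cycles R (T_K p q) ell kth _ _ _ _ _ (@kglue n)).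
- by move=> t i j; rewrite /ell /label edge_indexC.
- by move=> t i j; exact: len0.
- by move=> t i j; exact: th0.
- by move=> t i j; exact: thpi.
- move=> t i j k l u.
  have u1 : uniq [:: i; k; j; l].
    by move: u; rewrite /= !inE !negb_or -!andbA [k == j]eq_sym => /and5P[-> -> -> -> /andP[-> ->]].
  have u2 : uniq [:: i; l; j; k].
    move: u; rewrite /= !inE !negb_or -!andbA [l == j]eq_sym [l == k]eq_sym.
    by move=> /and5P[-> -> -> -> /andP[-> ->]].
  have s0 : kth t i j + kth t i k + kth t i l = pi.
    rewrite /kth (kpair_sum (th (reduced t)) t u); case: fth => _ + _; exact.
  (* The sines are [r] times the products of opposite lengths, so the law of cosines holds for these
     products once r^2 is cancelled. *)
  have := sine_law_cosine s0; rewrite (sine _ _ _ _ _ u) (sine _ _ _ _ _ u1) (sine _ _ _ _ _ u2).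
  have r2 : r (reduced t) ^+ 2 != 0 by rewrite expf_neq0 // gt_eqF.
  move: (r _) r2 (cos _) (ell t i j * _) (ell t i k * _) (ell t i l * _) => a a2 c x y z e.
  apply: (mulfI a2); transitivity ((a * x) ^+ 2); first by ring.
  by rewrite e; ring.
- by move=> t l; exact: kglueK.
- by move=> t l i j il jl; rewrite /ell label_glue.
- by move=> t i j k t' i' j' k' h; exact: (pairings_glue h).
- by move=> t l; exact: glue_in_pairings.
- by move=> t l; exact: kglue_nofix.
- exact: ktet_connected.
- move=> t i j ij.
  have e6 : (edge_index i j < 6)%N.
    by move: ij; case: (ord4E i) => ->; case: (ord4E j) => ->.
  have [L cL /mapP[f fL [ft fe]]] := edge_covered fth t e6.
  have [m [m0 itm sm inj]] := edge_cycleP cL fL.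
  exists f, m; split=> //; first by case: cL => /allP/(_ f fL).
  exact: edge_index_inj (esym fe).
Qed.
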